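(* Let $f(z)=|z|^{2(p-1)}G(z)$ be a $p$-harmonic mapping of $\mathbb{D}$ satisfying $G(0)=J_G(0)-1=0$ and $|G(z)|\le M$ for $z\in\mathbb{D}$, where $M\ge1$ and $G$ is harmonic. Then there is a constant $\rho$ $(0<\rho<1)$ such that $D(f)$ is univalent in $\mathbb{D}_\rho$, where $\rho$ satisfies the equation $$\lambda_0(M)-\frac{48M}{\pi^2}s_0\arctan\rho-\frac{2T(M)\rho}{(1-\rho)^3}=0.$$ Moreover, the range $D(f)(\mathbb{D}_\rho)$ contains a univalent disk $\mathbb{D}_R$, where $$R=\rho^{2p-1}\left[\lambda_0(M)-\frac{16M}{\pi^2}s_0\arctan\rho\right].$$ Especially, if $M=1$, then $G(z)=z$, i.e. $f(z)=|z|^{2(p-1)}z$, which is univalent in $\mathbb{D}$.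
   Context: $\mathbb{D}=\{z\in\mathbb{C}:|z|<1\}$ and $\mathbb{D}_r=\{z\in\mathbb{C}:|z|<r\}$. Here $p$ is a positive integer. A $2p$-times continuously differentiable complex-valued function $f$ on $\mathbb{D}$ is $p$-harmonic if $\Delta^pf=0$, where $\Delta=4\frac{\partial^2}{\partial z\partial\overline z}$ and $\Delta^p$ is its $p$-fold iterate; harmonic means $1$-harmonic (complex-valued). $J_G=|G_z|^2-|G_{\overline z}|^2$ is the Jacobian of $G$, and $D(f)=zf_z-\overline z f_{\overline z}$. Constants: $$s_0=\left(\frac{\sqrt{17}-1}{\sqrt{17}-3}\right)\sqrt{\frac{2}{5-\sqrt{17}}}\approx4.1996,$$ $$T(M)=\begin{cases}\sqrt{2M^2-2}&\text{if }1\le M\le M_1:=\frac{\pi}{\sqrt{\pi^2-8}}\approx2.2976,\\[2pt] \frac{4M}{\pi}&\text{if }M>M_1,\end{cases}$$ $$\lambda_0(M)=\begin{cases}\frac{\sqrt2}{\sqrt{M^2-1}+\sqrt{M^2+1}}&\text{if }1\le M\le M_0,\\[2pt] \frac{\pi}{4M}&\text{if }M>M_0,\end{cases}\qquad M_0=\frac{\pi}{2\sqrt[4]{2\pi^2-16}}\approx1.1296.$$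
   Formalization: For M=1 the claim G(z)=z fails (G(z)=iz meets every hypothesis); it is corrected to G(z)=αz and f(z)=α|z|^{2(p-1)}z for some constant α with |α|=1, with f univalent in the unit disk. *)

(* Defs.v *)
From Stdlib Require Import Reals.
From Coquelicot Require Import Coquelicot.

Open Scope R_scope.

Definition disk (r : R) (z : C) : Prop := Cmod z < r.

(* Coquelicot's [Derive] is real-valued, so the partial derivatives of a
   complex-valued function are taken on its real and imaginary parts. *)
Definition dx (f : C -> C) (z : C) : C :=
  (Derive (fun t => Re (f (t, Im z))) (Re z),
   Derive (fun t => Im (f (t, Im z))) (Re z)).

Definition dy (f : C -> C) (z : C) : C :=
  (Derive (fun t => Re (f (Re z, t))) (Im z),
   Derive (fun t => Im (f (Re z, t))) (Im z)).

Definition dz (f : C -> C) (z : C) : C := ((dx f z - Ci * dy f z) / 2)%C.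

Definition dzbar (f : C -> C) (z : C) : C := ((dx f z + Ci * dy f z) / 2)%C.

Definition laplacian (f : C -> C) (z : C) : C := (4 * dz (dzbar f) z)%C.

(* [ex_diff_n u n x y]: all iterated partial derivatives of u of order at most n
   exist and are continuous at (x, y).  Asked at every point of an open set, it
   says that u is n times continuously differentiable there; the values of f
   outside the set play no role. *)
Definition Cn_on (n : nat) (f : C -> C) (A : C -> Prop) : Prop :=
  forall z, A z ->
    ex_diff_n (fun x y => Re (f (x, y))) n (Re z) (Im z) /\
    ex_diff_n (fun x y => Im (f (x, y))) n (Re z) (Im z).

Definition p_harmonic (p : nat) (f : C -> C) : Prop :=
  Cn_on (2 * p) f (disk 1) /\
  forall z, disk 1 z -> Nat.iter p laplacian f z = 0%C.

Definition harmonic (f : C -> C) : Prop := p_harmonic 1 f.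

Definition jacobian (f : C -> C) (z : C) : R :=
  Cmod (dz f z) ^ 2 - Cmod (dzbar f z) ^ 2.

Definition Dop (f : C -> C) (z : C) : C :=
  (z * dz f z - Cconj z * dzbar f z)%C.

Definition univalent_on (f : C -> C) (A : C -> Prop) : Prop :=
  forall z w, A z -> A w -> f z = f w -> z = w.

(* The disk of radius r centred at 0 is the one-to-one image of an open subset
   of A.  (For continuous f such an open set is automatically connected, by
   invariance of domain.) *)
Definition range_contains_univalent_disk
    (f : C -> C) (A : C -> Prop) (r : R) : Prop :=
  0 < r /\
  exists Omega : C -> Prop,
    open Omega /\
    (forall z, Omega z -> A z) /\
    univalent_on f Omega /\
    (forall w, disk r w <-> exists z, Omega z /\ f z = w).

Definition s0 : R :=
  (sqrt 17 - 1) / (sqrt 17 - 3) * sqrt (2 / (5 - sqrt 17)).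

Definition M1 : R := PI / sqrt (PI ^ 2 - 8).

Definition T (M : R) : R :=
  if Rle_dec M M1 then sqrt (2 * M ^ 2 - 2) else 4 * M / PI.

Definition M0 : R := PI / (2 * Rpower (2 * PI ^ 2 - 16) (1 / 4)).

Definition lambda0 (M : R) : R :=
  if Rle_dec M M0 then sqrt 2 / (sqrt (M ^ 2 - 1) + sqrt (M ^ 2 + 1))
  else PI / (4 * M).

(* Main.v *)
(* Write G = u + iv and let S_u = z (u_x - i u_y), S_v = z (v_x - i v_y); these
   are holomorphic and D(G) = - Im S_v + i Im S_u.  As |z|^(2(p-1)) is radial,
   D(f) = |z|^(2(p-1)) D(G).  Cauchy's formula expands S_u and S_v in powers of z
   with coefficients k X_k, k Y_k, where X_k, Y_k are Fourier coefficients of u, v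
   on circles, and Bessel's inequality bounds |X_k|^2 + |Y_k|^2 by 2 M^2.  Hence
   D(G) is a real linear map A with |A z| >= lambda |z| plus a remainder with small
   Lipschitz constant.  The term with s_0 in the equation for rho leaves so much slack that Bessel's
   inequality alone suffices, for lambda as well as for the remainder; the sharp
   bounds by 4M/pi behind T(M) and lambda_0(M) are not needed.

   Univalence: if D(f) takes the same value at z1 and z2 with |z1| <= |z2|, then
   D(G)(z2) = t D(G)(z1) with 0 <= t <= 1, and comparing z2 with t z1 forces z1 = z2.
   Covering: the remainder, precomposed with the projection onto the closed disk,
   is a global perturbation of A, so that A plus it is invertible by the
   contraction principle; an intermediate value argument along the preimage of a
   ray then removes the weight |z|^(2(p-1)). *)
Require Import Defs.
From Stdlib Require Import Reals Lra Lia Psatz ClassicalEpsilon Ranalysis5.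
From Coquelicot Require Import Coquelicot.
Open Scope R_scope.

(** * Perturbations of linear maps *)

(** The coefficient of [atan rho] in the radius equation is at least 19.2 M. Univalence needs only
    10.5 M rho below lambda: 7 for the Lipschitz constant of the remainder and 3.5 for its failure
    to be homogeneous along rays. Covering loses 3.2 M rho. The equation also forces rho <= 1/18, so
    for these estimates one fixed circle of radius 99/100 is close enough to the boundary. The bound
    for A comes from its singular values: their product is the Jacobian 1, and the sum of their
    squares is at most 2 M^2. Bessel's inequality is used for the frequencies 1 and k together. If M
    = 1, the determinant alone forces the energy at frequency 1 up to the maximum 2; every higher
    frequency then vanishes and G is linear and conformal. All hypotheses on G are invariant under G
    -> e^(i theta) G, which is why G(z) = alpha z with |alpha| = 1 appears in the conclusion. *)

Lemma Cmod_minus_sym (z w : C) : Cmod (z - w) = Cmod (w - z).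
Proof. rewrite <- (Cmod_opp (w - z)). f_equal. ring. Qed.

Lemma Cmod_minus_ge (z w : C) : Cmod z - Cmod w <= Cmod (z - w).
Proof.
  assert (H := Cmod_triangle (z - w) w).
  replace (z - w + w)%C with z in H by ring. lra.
Qed.

Lemma Cmod_chain (x y z : C) : Cmod (x - z) <= Cmod (x - y) + Cmod (y - z).
Proof.
  replace (x - z)%C with ((x - y) + (y - z))%C by ring. apply Cmod_triangle.
Qed.

Lemma Cmod_Rscal (t : R) (z : C) : 0 <= t -> Cmod (t * z) = t * Cmod z.
Proof. intros Ht. rewrite Cmod_mult, Cmod_R, Rabs_pos_eq; auto. Qed.

Lemma Cmod_minus_eq_0 (z w : C) : Cmod (z - w) <= 0 -> z = w.
Proof.
  intros H. assert (H0 : (z - w)%C = 0%C).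
  { apply Cmod_eq_0. assert (G := Cmod_ge_0 (z - w)). lra. }
  replace z with ((z - w) + w)%C by ring. rewrite H0. ring.
Qed.

(** One identity encodes additivity and real homogeneity, in the shape [w - t * z] to which it is
    applied. *)
Definition real_linear (A : C -> C) : Prop :=
  forall (z w : C) (s : R), A (z - s * w)%C = (A z - s * A w)%C.

Lemma real_linear_0 (A : C -> C) : real_linear A -> A 0%C = 0%C.
Proof.
  intros HA. assert (H := HA 0%C 0%C 1).
  replace (0 - 1 * 0)%C with (RtoC 0) in H by ring. rewrite H. ring.
Qed.

Lemma real_linear_minus (A : C -> C) (z w : C) :
  real_linear A -> A (z - w)%C = (A z - A w)%C.
Proof.
  intros HA. assert (H := HA z w 1).
  replace (z - 1 * w)%C with (z - w)%C in H by ring. rewrite H. ring.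
Qed.

(** Division by |w|^(2m) gives (A + E)(w) = t (A + E)(z) with t = (|z|/|w|)^(2m). Then A (w - t z)
    is the radial defect t E(z) - E(t z) plus the difference E(t z) - E(w). As |w - t z| >= (1 -
    t)|z|, the defect costs at most Q |w - t z|, and L + Q < lam leaves only w = t z. *)
Lemma weighted_perturbation_injective_aux (m : nat) (rho lam L Q : R)
    (A E : C -> C) (z w : C) :
  real_linear A ->
  (forall z, lam * Cmod z <= Cmod (A z)) ->
  (forall z w, Cmod z < rho -> Cmod w < rho ->
     Cmod (E z - E w) <= L * Cmod (z - w)) ->
  (forall t z, 0 <= t <= 1 -> Cmod z < rho ->
     Cmod (t * E z - E (t * z)%C) <= t * (1 - t) * Q * Cmod z) ->
  0 <= Q -> L + Q < lam ->
  Cmod z < rho -> Cmod w < rho -> Cmod z <= Cmod w ->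
  (RtoC (Cmod z ^ (2 * m)) * (A z + E z))%C =
    (RtoC (Cmod w ^ (2 * m)) * (A w + E w))%C ->
  z = w.
Proof.
  intros HA Hlam HL HQ Q0 HLQ Hz Hw Hzw Heq.
  assert (Pz := Cmod_ge_0 z). assert (Pw := Cmod_ge_0 w).
  destruct (Req_dec (Cmod w) 0) as [W0|W0].
  { rewrite (Cmod_eq_0 w W0), (Cmod_eq_0 z); auto. lra. }
  assert (Hw0 : 0 < Cmod w) by lra.
  set (t := (Cmod z / Cmod w) ^ (2 * m)).
  assert (Hq : 0 <= Cmod z / Cmod w <= 1).
  { split. apply Rdiv_le_0_compat; lra. apply Rle_div_l; lra. }
  assert (Ht : 0 <= t <= 1).
  { split. apply pow_le; tauto.
    unfold t. rewrite <- (pow1 (2 * m)). apply pow_incr. exact Hq. }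
  assert (Hne : RtoC (Cmod w ^ (2 * m)) <> 0%C).
  { intros H. apply RtoC_inj in H. apply (pow_nonzero (Cmod w) (2 * m)); auto. }
  assert (Hray : (A w + E w)%C = (t * (A z + E z))%C).
  { replace (A w + E w)%C
      with (/ Cmod w ^ (2 * m) * (RtoC (Cmod w ^ (2 * m)) * (A w + E w)))%C.
    2:{ rewrite RtoC_pow. field. rewrite <- RtoC_pow. exact Hne. }
    rewrite <- Heq. unfold t, Rdiv. rewrite Rpow_mult_distr, pow_inv, RtoC_mult.
    rewrite RtoC_inv, !RtoC_pow; [ring|]. now apply pow_nonzero. }
  assert (HAd : A (w - t * z)%C = ((t * E z - E (t * z)%C) + (E (t * z)%C - E w))%C).
  { rewrite HA. replace (A w) with ((A w + E w) - E w)%C by ring.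
    rewrite Hray. ring. }
  assert (Htz : Cmod (t * z) < rho).
  { rewrite Cmod_Rscal by tauto. nra. }
  assert (H1 := Hlam (w - t * z)%C). rewrite HAd in H1.
  assert (H2 := Cmod_triangle (t * E z - E (t * z)%C) (E (t * z)%C - E w)).
  assert (H3 := HQ t z Ht Hz). assert (H4 := HL _ _ Htz Hw).
  rewrite (Cmod_minus_sym (t * z)) in H4.
  assert (H5 := Cmod_minus_ge w (t * z)). rewrite Cmod_Rscal in H5 by tauto.
  assert (H6 : t * (1 - t) * Q * Cmod z <= Q * Cmod (w - t * z)).
  { apply Rle_trans with (Q * ((1 - t) * Cmod z)).
    - assert (0 <= Q * ((1 - t) * Cmod z)).
      { apply Rmult_le_pos; auto. apply Rmult_le_pos; lra. }
      nra.
    - apply Rmult_le_compat_l; auto. nra. }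
  assert (Hd : Cmod (w - t * z) <= 0).
  { assert (0 <= Cmod (w - t * z)) by apply Cmod_ge_0. nra. }
  apply Cmod_minus_eq_0 in Hd.
  (* With t <= 1 and |z| <= |w| the moduli must agree, and then t = 1 because w is nonzero. *)
  assert (Hmod : Cmod w = t * Cmod z).
  { rewrite Hd at 1. apply Cmod_Rscal; tauto. }
  assert (Hzw' : Cmod z = Cmod w) by nra.
  assert (Ht1 : t = 1).
  { rewrite Hzw' in Hmod. nra. }
  rewrite Hd, Ht1. ring.
Qed.

Lemma weighted_perturbation_injective (m : nat) (rho lam L Q : R)
    (A E : C -> C) (z w : C) :
  real_linear A ->
  (forall z, lam * Cmod z <= Cmod (A z)) ->
  (forall z w, Cmod z < rho -> Cmod w < rho ->
     Cmod (E z - E w) <= L * Cmod (z - w)) ->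
  (forall t z, 0 <= t <= 1 -> Cmod z < rho ->
     Cmod (t * E z - E (t * z)%C) <= t * (1 - t) * Q * Cmod z) ->
  0 <= Q -> L + Q < lam ->
  Cmod z < rho -> Cmod w < rho ->
  (RtoC (Cmod z ^ (2 * m)) * (A z + E z))%C =
    (RtoC (Cmod w ^ (2 * m)) * (A w + E w))%C ->
  z = w.
Proof.
  intros HA Hlam HL HQ Q0 HLQ Hz Hw Heq.
  destruct (Rle_dec (Cmod z) (Cmod w)) as [H|H].
  - apply (weighted_perturbation_injective_aux m rho lam L Q A E); auto.
  - symmetry.
    apply (weighted_perturbation_injective_aux m rho lam L Q A E); auto. lra.
Qed.

(** Banach's theorem by iteration from 0. Convergence is obtained for the real and imaginary parts
    separately, as Cauchy sequences of reals. *)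
Lemma contraction_fixed_point (Phi : C -> C) (k : R) :
  0 <= k < 1 ->
  (forall z w, Cmod (Phi z - Phi w) <= k * Cmod (z - w)) ->
  exists z, Phi z = z.
Proof.
  intros Hk HPhi.
  set (u := fun n => Nat.iter n Phi 0%C).
  set (d := Cmod (u 1%nat - u 0%nat)).
  assert (Hd : 0 <= d) by apply Cmod_ge_0.
  assert (Hstep : forall n, Cmod (u (S n) - u n) <= k ^ n * d).
  { induction n as [|n IH].
    - simpl. unfold d, u. simpl. lra.
    - change (u (S (S n))) with (Phi (u (S n))). change (u (S n)) with (Phi (u n)) at 2.
      eapply Rle_trans. apply HPhi. simpl. rewrite Rmult_assoc.
      apply Rmult_le_compat_l; tauto. }
  assert (Hdist : forall n p, Cmod (u (n + p)%nat - u n) <= k ^ n * (d / (1 - k))).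
  { intros n p. apply Rle_trans with (k ^ n * (d * (1 - k ^ p) / (1 - k))).
    - induction p as [|p IH].
      + rewrite Nat.add_0_r. replace (u n - u n)%C with (RtoC 0) by ring.
        rewrite Cmod_0. right. simpl. field. lra.
      + eapply Rle_trans. apply (Cmod_chain _ (u (n + p)%nat)).
        rewrite Nat.add_succ_r.
        eapply Rle_trans. apply Rplus_le_compat. apply Hstep. exact IH.
        right. rewrite pow_add. simpl. field. lra.
    - apply Rmult_le_compat_l. apply pow_le; tauto.
      unfold Rdiv. apply Rmult_le_compat_r.
      left. apply Rinv_0_lt_compat. lra.
      assert (0 <= k ^ p) by (apply pow_le; tauto). nra. }
  assert (Hlim : is_lim_seq (fun n => k ^ n * (d / (1 - k))) 0).
  { replace (Finite 0) with (Rbar_mult 0 (d / (1 - k))) by (simpl; f_equal; ring).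
    apply is_lim_seq_scal_r. apply is_lim_seq_geom. rewrite Rabs_pos_eq; tauto. }
  assert (Hcauchy : forall g : C -> R, (forall z w, Rabs (g z - g w) <= Cmod (z - w)) ->
    exists l, is_lim_seq (fun n => g (u n)) (Finite l)).
  { intros g Hg.
    assert (Hc : ex_lim_seq_cauchy (fun n => g (u n))).
    { intros eps.
      assert (He2 : 0 < eps / 2) by (destruct eps; simpl; lra).
      destruct (proj2 (is_lim_seq_spec _ _) Hlim (mkposreal _ He2)) as [N HN].
      exists N. intros n p Hn Hp.
      specialize (HN N (le_n N)). simpl in HN. rewrite Rminus_0_r in HN.
      apply Rabs_def2 in HN.
      assert (forall j, (N <= j)%nat -> Cmod (u j - u N) < eps / 2).
      { intros j Hj. replace j with (N + (j - N))%nat by lia.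
        eapply Rle_lt_trans. apply Hdist. apply HN. }
      eapply Rle_lt_trans. apply Hg. eapply Rle_lt_trans. apply (Cmod_chain _ (u N)).
      rewrite (Cmod_minus_sym (u N)).
      assert (A1 := H n Hn). assert (A2 := H p Hp). lra. }
    apply ex_lim_seq_cauchy_corr in Hc. destruct Hc as [l Hl].
    exists l. exact Hl. }
  destruct (Hcauchy Re) as [a Ha].
  { intros z w. eapply Rle_trans. 2: apply (Rmax_Cmod (z - w)%C).
    apply Rmax_l. }
  destruct (Hcauchy Im) as [b Hb].
  { intros z w. eapply Rle_trans. 2: apply (Rmax_Cmod (z - w)%C).
    apply Rmax_r. }
  exists (a, b). apply Cmod_minus_eq_0.
  (* The constant distance from [Phi (a, b)] to [(a, b)] is squeezed by a null sequence, passing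
     through [u (S n)] and [u n]. *)
  apply (fun H1 H2 => is_lim_seq_le (fun _ => Cmod (Phi (a, b) - (a, b)))
     (fun n => 2 * (Rabs (Re (u n) - a) + Rabs (Im (u n) - b))
       + k ^ n * (d / (1 - k))) _ 0 H1 (is_lim_seq_const _) H2).
  - intros n.
    eapply Rle_trans. apply (Cmod_chain _ (u (S n))).
    assert (S1 := HPhi (a, b) (u n)). change (Phi (u n)) with (u (S n)) in S1.
    assert (S2 := Cmod_chain (u (S n)) (u n) (a, b)).
    assert (S3 := Hdist n 1%nat). rewrite Nat.add_1_r in S3.
    assert (S4 : Cmod (u n - (a, b)) <= Rabs (Re (u n) - a) + Rabs (Im (u n) - b)).
    { destruct (u n) as [x y]. simpl.
      replace ((x, y) - (a, b))%C with (RtoC (x - a) + Ci * RtoC (y - b))%C.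
      2:{ unfold Ci, RtoC, Cminus, Cplus, Cmult, Copp; simpl; f_equal; ring. }
      eapply Rle_trans. apply Cmod_triangle.
      rewrite Cmod_mult, !Cmod_R.
      replace (Cmod Ci) with 1. lra.
      unfold Cmod, Ci; simpl. replace (_ + _) with 1 by ring. now rewrite sqrt_1. }
    assert (S5 := Cmod_minus_sym (a, b) (u n)).
    assert (0 <= Cmod ((a, b) - u n)) by apply Cmod_ge_0.
    assert (0 <= k ^ n * (d / (1 - k))) by (eapply Rle_trans; [apply Cmod_ge_0|exact S3]).
    nra.
  - replace (Finite 0) with (Finite (2 * (0 + 0) + 0)) by (f_equal; ring).
    assert (Habs : forall (v : nat -> R) (l : R), is_lim_seq v l ->
      is_lim_seq (fun n => Rabs (v n - l)) 0).
    { intros v l Hv. replace (Finite 0) with (Rbar_abs (Finite (l - l))).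
      2:{ simpl. f_equal. rewrite Rminus_diag. apply Rabs_R0. }
      apply is_lim_seq_abs. apply is_lim_seq_minus'; auto. apply is_lim_seq_const. }
    apply is_lim_seq_plus'; auto.
    apply (is_lim_seq_scal_l _ 2 (Finite (0 + 0))).
    apply is_lim_seq_plus'; apply Habs; auto.
Qed.

(** The quotient with [Rmax] treats the interior, the exterior and the origin by a single
    formula. *)
Definition disk_proj (rho : R) (z : C) : C := (RtoC (rho / Rmax rho (Cmod z)) * z)%C.

Lemma Cmod_sqr (z : C) : Cmod z ^ 2 = Re z ^ 2 + Im z ^ 2.
Proof. unfold Cmod, Re, Im. rewrite pow2_sqrt; auto. nra. Qed.

Lemma Cmod_sqr_Rscal_minus (s t : R) (z w : C) :
  Cmod (s * z - t * w)%C ^ 2 = s ^ 2 * Cmod z ^ 2 + t ^ 2 * Cmod w ^ 2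
    - 2 * s * t * (Re z * Re w + Im z * Im w).
Proof. rewrite !Cmod_sqr. destruct z, w; simpl. ring. Qed.

Lemma Re_Im_le_Cmod (z w : C) : Re z * Re w + Im z * Im w <= Cmod z * Cmod w.
Proof.
  apply Rsqr_incr_0_var.
  2: apply Rmult_le_pos; apply Cmod_ge_0.
  unfold Rsqr. replace (Cmod z * Cmod w * (Cmod z * Cmod w))
    with (Cmod z ^ 2 * Cmod w ^ 2) by ring.
  rewrite !Cmod_sqr. assert (H := pow2_ge_0 (Re z * Im w - Im z * Re w)). nra.
Qed.

Lemma disk_proj_id (rho : R) (z : C) : 0 < rho -> Cmod z <= rho -> disk_proj rho z = z.
Proof.
  intros H0 H. unfold disk_proj. rewrite Rmax_left by auto.
  replace (rho / rho) with 1 by (field; lra). ring.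
Qed.

Lemma Cmod_disk_proj (rho : R) (z : C) : 0 < rho -> Cmod (disk_proj rho z) <= rho.
Proof.
  intros H0. unfold disk_proj.
  assert (H1 := Rmax_l rho (Cmod z)). assert (H2 := Rmax_r rho (Cmod z)).
  rewrite Cmod_Rscal by (apply Rdiv_le_0_compat; lra).
  apply Rle_trans with (rho / Rmax rho (Cmod z) * Rmax rho (Cmod z)).
  - apply Rmult_le_compat_l; auto. apply Rdiv_le_0_compat; lra.
  - right. field. lra.
Qed.

Lemma disk_proj_lipschitz (rho : R) (z w : C) :
  0 < rho -> Cmod (disk_proj rho z - disk_proj rho w) <= Cmod (z - w).
Proof.
  intros H0. unfold disk_proj.
  apply Rsqr_incr_0_var; [|apply Cmod_ge_0]. rewrite !Rsqr_pow2.
  replace (z - w)%C with (1 * z - 1 * w)%C by ring.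
  rewrite !Cmod_sqr_Rscal_minus.
  assert (Hc := Re_Im_le_Cmod z w). set (c := Re z * Re w + Im z * Im w) in *.
  assert (Pz := Cmod_ge_0 z). assert (Pw := Cmod_ge_0 w).
  (* Here k x = min(rho, x): either nothing is scaled, or the point lands on the boundary circle. *)
  assert (K : forall x, 0 <= x ->
    exists k, rho / Rmax rho x = k /\ 0 < k <= 1 /\ k * x <= rho /\ (k = 1 \/ k * x = rho)).
  { intros x Hx. exists (rho / Rmax rho x). split; auto.
    assert (H1 := Rmax_l rho x). assert (H2 := Rmax_r rho x).
    repeat split.
    - apply Rdiv_lt_0_compat; lra.
    - apply Rle_div_l; lra.
    - apply Rle_trans with (rho / Rmax rho x * Rmax rho x).
      + apply Rmult_le_compat_l; auto. apply Rdiv_le_0_compat; lra.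
      + right. field. lra.
    - destruct (Rle_dec x rho).
      + left. rewrite Rmax_left by auto. field. lra.
      + right. rewrite Rmax_right by lra. field. lra. }
  destruct (K _ Pz) as (s & -> & Hs & Hs1 & Hs2).
  destruct (K _ Pw) as (t & -> & Ht & Ht1 & Ht2).
  set (x := Cmod z) in *. set (y := Cmod w) in *.
  (* the difference of the two sides is
     [(x - y)^2 - (s x - t y)^2 + 2 (1 - s t) (x y - c)] *)
  assert (D : Rabs (s * x - t * y) <= Rabs (x - y)).
  { destruct Hs2 as [->|E1], Ht2 as [->|E2].
    - right. f_equal. ring.
    - apply Rabs_le_between'. unfold Rabs; destruct Rcase_abs; nra.
    - apply Rabs_le_between'. unfold Rabs; destruct Rcase_abs; nra.
    - rewrite E1, E2, Rminus_diag, Rabs_R0. apply Rabs_pos. }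
  apply Rsqr_le_abs_1 in D. unfold Rsqr in D.
  assert (0 <= (1 - s * t) * (x * y - c)) by (apply Rmult_le_pos; nra).
  nra.
Qed.

Lemma continuity_lipschitz (g : R -> R) (K : R) :
  (forall s t, Rabs (g s - g t) <= K * Rabs (s - t)) -> continuity g.
Proof.
  intros HK x eps Heps.
  assert (K0 : 0 <= Rmax K 0) by apply Rmax_r.
  exists (eps / (Rmax K 0 + 1)). split.
  - apply Rdiv_lt_0_compat; lra.
  - intros y [_ Hy]. simpl in *. unfold Rdist in *.
    eapply Rle_lt_trans. apply HK.
    apply Rle_lt_trans with ((Rmax K 0 + 1) * Rabs (y - x)).
    + apply Rmult_le_compat_r. apply Rabs_pos. assert (H := Rmax_l K 0). lra.
    + apply Rmult_lt_compat_l with (r := Rmax K 0 + 1) in Hy; [|lra].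
      replace ((Rmax K 0 + 1) * (eps / (Rmax K 0 + 1))) with eps in Hy by (field; lra).
      exact Hy.
Qed.

Lemma continuous_lipschitz_C (g : C -> C) (K : R) (z : C) :
  (forall z w, Cmod (g z - g w) <= K * Cmod (z - w)) -> continuous g z.
Proof.
  intros HK. apply filterlim_locally. intros eps.
  assert (K0 : 0 < Rmax K 0 + 1) by (assert (H := Rmax_r K 0); lra).
  assert (Hd : 0 < eps / (2 * (Rmax K 0 + 1))).
  { apply Rdiv_lt_0_compat. apply eps. lra. }
  exists (mkposreal _ Hd). intros w [Hx Hy].
  assert (Hzw : Cmod (w - z) < eps / (Rmax K 0 + 1)).
  { unfold ball in Hx, Hy; simpl in Hx, Hy; unfold AbsRing_ball, abs, minus, plus, opp in Hx, Hy; simpl in Hx, Hy.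
    assert (S := Cmod_2Rmax (w - z)%C).
    eapply Rle_lt_trans. apply S.
    assert (Hm : Rmax (Rabs (fst (w - z)%C)) (Rabs (snd (w - z)%C))
       < eps / (2 * (Rmax K 0 + 1))).
    { apply Rmax_lub_lt; [exact Hx|exact Hy]. }
    assert (Hs : sqrt 2 <= 2).
    { rewrite <- (sqrt_square 2) at 2 by lra. apply sqrt_le_1; lra. }
    assert (P := Rabs_pos (fst (w - z)%C)). assert (P2 := Rmax_l (Rabs (fst (w - z)%C)) (Rabs (snd (w - z)%C))).
    replace (eps / (Rmax K 0 + 1)) with (2 * (eps / (2 * (Rmax K 0 + 1)))) by (field; lra).
    assert (P3 := sqrt_pos 2). nra. }
  assert (Hg : Cmod (g w - g z) < eps).
  { eapply Rle_lt_trans. apply HK.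
    apply Rle_lt_trans with ((Rmax K 0 + 1) * Cmod (w - z)).
    - apply Rmult_le_compat_r. apply Cmod_ge_0. assert (H := Rmax_l K 0). lra.
    - replace (pos eps) with ((Rmax K 0 + 1) * (eps / (Rmax K 0 + 1))) by (field; lra).
      apply Rmult_lt_compat_l; auto. }
  assert (Hm := Rmax_Cmod (g w - g z)%C).
  split; unfold ball; simpl; unfold AbsRing_ball, abs, minus, plus, opp; simpl.
  - eapply Rle_lt_trans. 2: exact Hg. eapply Rle_trans. 2: exact Hm. apply Rmax_l.
  - eapply Rle_lt_trans. 2: exact Hg. eapply Rle_trans. 2: exact Hm. apply Rmax_r.
Qed.

Lemma continuous_Cmod (z : C) : continuous (fun z : C => Cmod z) z.
Proof.
  assert (H : continuous (fun z : C => RtoC (Cmod z)) z).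
  { apply continuous_lipschitz_C with 1. intros x y.
    rewrite <- RtoC_minus, Cmod_R, Rmult_1_l.
    assert (H1 := Cmod_minus_ge x y). assert (H2 := Cmod_minus_ge y x).
    rewrite Cmod_minus_sym in H2. unfold Rabs; destruct Rcase_abs; lra. }
  apply (continuous_comp (fun z => RtoC (Cmod z)) fst); auto.
  apply continuous_fst.
Qed.

Lemma open_preimage_lt (g : C -> R) (r : R) :
  (forall z, continuous g z) -> open (fun z => g z < r).
Proof.
  intros Hg. apply (open_comp g (fun y => y < r)).
  - intros z _. apply Hg.
  - apply open_lt.
Qed.

(** The extended map [Ft] has modulus at least r outside [disk rho]. Hence a preimage of a point of
    the r-disk may be sought in the whole plane: it automatically lies in [disk rho], where [Ft] is
    F. The bounds on E are asked on the closed disk because the projection reaches its boundary. *)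
Lemma weighted_perturbation_range (m : nat) (rho lam Lam L e r : R)
    (A B E F : C -> C) :
  0 < rho -> real_linear A -> (forall w, A (B w) = w) ->
  (forall z, lam * Cmod z <= Cmod (A z)) ->
  (forall z, Cmod (A z) <= Lam * Cmod z) ->
  (forall z w, Cmod z <= rho -> Cmod w <= rho ->
     Cmod (E z - E w) <= L * Cmod (z - w)) ->
  0 <= L < lam ->
  (forall z, Cmod z <= rho -> Cmod (E z) <= e * Cmod z) -> 0 <= e ->
  0 < r <= rho ^ (2 * m) * (rho * (lam - e)) ->
  (forall z, Cmod z < rho -> F z = (RtoC (Cmod z ^ (2 * m)) * (A z + E z))%C) ->
  univalent_on F (disk rho) ->
  range_contains_univalent_disk F (disk rho) r.
Proof.
  intros Hrho HA HB Hlam HLam HL HLlam He e0 Hr HF Huniv.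
  set (H := fun z => (A z + E (disk_proj rho z))%C).
  assert (HEP : forall z w, Cmod (E (disk_proj rho z) - E (disk_proj rho w)) <= L * Cmod (z - w)).
  { intros z w. eapply Rle_trans. apply HL; apply Cmod_disk_proj; auto.
    apply Rmult_le_compat_l. tauto. apply disk_proj_lipschitz; auto. }
  assert (Hbelow : forall z w, (lam - L) * Cmod (z - w) <= Cmod (H z - H w)).
  { intros z w. assert (H1 := Hlam (z - w)%C). rewrite real_linear_minus in H1 by auto.
    assert (H2 := HEP z w). unfold H.
    replace (A z + E (disk_proj rho z) - (A w + E (disk_proj rho w)))%C
      with ((A z - A w) - (E (disk_proj rho w) - E (disk_proj rho z)))%C by ring.
    assert (H3 := Cmod_minus_ge (A z - A w) (E (disk_proj rho w) - E (disk_proj rho z))).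
    rewrite (Cmod_minus_sym (E (disk_proj rho w))) in H3. lra. }
  assert (Habove : forall z w, Cmod (H z - H w) <= (Lam + L) * Cmod (z - w)).
  { intros z w. assert (H1 := HLam (z - w)%C). rewrite real_linear_minus in H1 by auto.
    assert (H2 := HEP z w). unfold H.
    replace (A z + E (disk_proj rho z) - (A w + E (disk_proj rho w)))%C
      with ((A z - A w) + (E (disk_proj rho z) - E (disk_proj rho w)))%C by ring.
    assert (H3 := Cmod_triangle (A z - A w) (E (disk_proj rho z) - E (disk_proj rho w))).
    lra. }
  assert (HBlip : forall x y, lam * Cmod (B x - B y) <= Cmod (x - y)).
  { intros x y. eapply Rle_trans. apply Hlam.
    rewrite real_linear_minus, !HB by auto. apply Rle_refl. }
  assert (Hsurj : forall v, exists z, H z = v).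
  { intros v.
    (* B is Lipschitz with constant 1/lam, so the equation z = B (v - E (disk_proj rho z)), which
       implies H z = v, has contraction ratio L/lam < 1. *)
    destruct (contraction_fixed_point (fun z => B (v - E (disk_proj rho z))%C) (L / lam))
      as [z Hz].
    - split. apply Rdiv_le_0_compat; lra. apply Rlt_div_l; lra.
    - intros z w.
      assert (H1 := HBlip (v - E (disk_proj rho z))%C (v - E (disk_proj rho w))%C).
      replace (v - E (disk_proj rho z) - (v - E (disk_proj rho w)))%C
        with (E (disk_proj rho w) - E (disk_proj rho z))%C in H1 by ring.
      assert (H2 := HEP w z). rewrite (Cmod_minus_sym w) in H2.
      apply Rmult_le_reg_l with lam; [lra|].
      replace (lam * (L / lam * Cmod (z - w))) with (L * Cmod (z - w)) by (field; lra).
      lra.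
    - exists z. unfold H. rewrite <- Hz at 1. rewrite HB. ring. }
  set (Ft := fun z => (RtoC (Cmod z ^ (2 * m)) * H z)%C).
  assert (HFt : forall z, Cmod z < rho -> F z = Ft z).
  { intros z Hz. rewrite HF by auto. unfold Ft, H. rewrite disk_proj_id by lra. reflexivity. }
  assert (Hlarge : forall z, rho <= Cmod z -> r <= Cmod (Ft z)).
  { intros z Hz. unfold Ft. rewrite Cmod_Rscal by (apply pow_le, Cmod_ge_0).
    eapply Rle_trans. apply Hr.
    apply Rmult_le_compat.
    - apply pow_le; lra.
    - assert (0 < rho ^ (2 * m)) by (apply pow_lt; auto). nra.
    - apply pow_incr; lra.
    - unfold H. assert (H1 := Hlam z).
      assert (H2 := He _ (Cmod_disk_proj rho z Hrho)).
      assert (H3 := Cmod_disk_proj rho z Hrho).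
      assert (H4 := Cmod_minus_ge (A z) (- E (disk_proj rho z))).
      rewrite Cmod_opp in H4.
      replace (A z - - E (disk_proj rho z))%C with (A z + E (disk_proj rho z))%C in H4 by ring.
      nra. }
  assert (HFt0 : Ft 0%C = 0%C).
  { unfold Ft, H. rewrite real_linear_0 by auto.
    rewrite disk_proj_id by (rewrite ?Cmod_0; lra).
    assert (H1 := He 0%C). rewrite Cmod_0, Rmult_0_r in H1.
    assert (H2 : E 0%C = 0%C).
    { apply Cmod_eq_0. assert (P := Cmod_ge_0 (E 0%C)). lra. }
    rewrite H2. ring. }
  assert (Honto : forall w, Cmod w < r -> exists z, Ft z = w).
  { intros w Hw.
    destruct (Req_dec (Cmod w) 0) as [W0|W0].
    { exists 0%C. rewrite HFt0. symmetry. now apply Cmod_eq_0. }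
    assert (Pw : 0 < Cmod w) by (assert (P := Cmod_ge_0 w); lra).
    (* [Z s] is the preimage of s w under H, so Ft (Z s) = |Z s|^(2m) s w; it remains to find s with
       |Z s|^(2m) s = 1. *)
    destruct (choice (fun (s : R) z => H z = (s * w)%C)) as [Z HZ].
    { intros s. apply Hsurj. }
    assert (CZ : continuity (fun s => Cmod (Z s))).
    { apply continuity_lipschitz with (Cmod w / (lam - L)). intros s t.
      assert (H1 := Hbelow (Z s) (Z t)). rewrite !HZ in H1.
      replace (s * w - t * w)%C with (RtoC (s - t) * w)%C in H1 by (rewrite RtoC_minus; ring).
      rewrite Cmod_mult, Cmod_R in H1.
      assert (H2 := Cmod_minus_ge (Z s) (Z t)). assert (H3 := Cmod_minus_ge (Z t) (Z s)).
      rewrite (Cmod_minus_sym (Z t)) in H3.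
      apply Rle_trans with (Cmod (Z s - Z t)).
      - unfold Rabs; destruct Rcase_abs; lra.
      - apply Rmult_le_reg_l with (lam - L); [lra|].
        replace ((lam - L) * (Cmod w / (lam - L) * Rabs (s - t)))
          with (Rabs (s - t) * Cmod w) by (field; lra). exact H1. }
    assert (Pm : 0 < rho ^ (2 * m)) by (apply pow_lt; auto).
    assert (Pim : 0 < / rho ^ (2 * m)) by now apply Rinv_0_lt_compat.
    (* Large enough that s1 >= rho^(-2m) and that [Z s1] has left the disk, on which |H| <= (Lam +
       L) rho. Hence |Z s|^(2m) s is 0 at s = 0 and at least 1 at s1. *)
    set (s1 := / rho ^ (2 * m) + 1 + (Rabs Lam + L) * rho / Cmod w).
    assert (Ps : 0 <= (Rabs Lam + L) * rho / Cmod w).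
    { apply Rdiv_le_0_compat; auto. assert (Q := Rabs_pos Lam).
      apply Rmult_le_pos; lra. }
    assert (Hexit : rho <= Cmod (Z s1)).
    { apply Rnot_lt_le. intros Hlt.
      assert (H1 := Habove (Z s1) 0%C).
      assert (H0 : H 0%C = 0%C).
      { unfold H. rewrite real_linear_0 by auto.
        rewrite disk_proj_id by (rewrite ?Cmod_0; lra).
        assert (H2 := He 0%C). rewrite Cmod_0, Rmult_0_r in H2.
        rewrite (Cmod_eq_0 (E 0%C)). ring.
        assert (P := Cmod_ge_0 (E 0%C)). lra. }
      rewrite H0, HZ in H1.
      replace (s1 * w - 0)%C with (s1 * w)%C in H1 by ring.
      replace (Z s1 - 0)%C with (Z s1) in H1 by ring.
      rewrite Cmod_Rscal in H1 by (unfold s1; lra).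
      assert (Q := Rle_abs Lam).
      assert (P := Cmod_ge_0 (Z s1)).
      assert (H2 : s1 * Cmod w = (/ rho ^ (2 * m) + 1) * Cmod w + (Rabs Lam + L) * rho).
      { unfold s1. field. lra. }
      assert (H3 : (Lam + L) * Cmod (Z s1) <= (Rabs Lam + L) * rho).
      { assert (Q2 := Rabs_pos Lam). apply Rle_trans with ((Rabs Lam + L) * Cmod (Z s1)); nra. }
      nra. }
    destruct (IVT_gen (fun s => Cmod (Z s) ^ (2 * m) * s) 0 s1 1) as [s [_ Hs]].
    - apply continuity_mult.
      + intros s. apply (continuity_pt_comp (fun s => Cmod (Z s)) (fun x => x ^ (2 * m))).
        apply CZ. apply derivable_continuous_pt, derivable_pt_pow.
      + apply derivable_continuous, derivable_id.
    - rewrite Rmult_0_r. split.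
      + apply Rle_trans with 0; [apply Rmin_l|lra].
      + apply Rle_trans with (Cmod (Z s1) ^ (2 * m) * s1); [|apply Rmax_r].
        apply Rle_trans with (rho ^ (2 * m) * / rho ^ (2 * m)).
        * right. field. lra.
        * apply Rmult_le_compat; try lra.
          -- apply pow_incr. lra.
          -- unfold s1. lra.
    - exists (Z s). unfold Ft. rewrite HZ, Cmult_assoc, <- RtoC_mult, Hs. ring. }
  assert (Hcont : forall z, continuous (fun z => Cmod (Ft z)) z).
  { intros z.
    apply continuous_ext with (fun z => Cmod z ^ (2 * m) * Cmod (H z)).
    { intros y. unfold Ft. rewrite Cmod_Rscal; auto. apply pow_le, Cmod_ge_0. }
    apply (continuous_mult (fun z => Cmod z ^ (2 * m)) (fun z => Cmod (H z))).
    - apply (continuous_comp (fun z : C => Cmod z) (fun x => x ^ (2 * m))).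
      apply continuous_Cmod.
      apply continuity_pt_filterlim, derivable_continuous_pt, derivable_pt_pow.
    - apply (continuous_comp H (fun z : C => Cmod z)).
      apply continuous_lipschitz_C with (Lam + L). exact Habove.
      apply continuous_Cmod. }
  split; [apply Hr|].
  exists (fun z => Cmod z < rho /\ Cmod (Ft z) < r). split; [|split; [|split]].
  - apply open_and; apply open_preimage_lt; auto. apply continuous_Cmod.
  - intros z [Hz _]. exact Hz.
  - intros z w [Hz _] [Hw _]. apply Huniv; auto.
  - intros w. split.
    + intros Hw. destruct (Honto w Hw) as [z Hz]. exists z.
      assert (Hlt : Cmod z < rho).
      { apply Rnot_le_lt. intros Hle. apply Hlarge in Hle. rewrite Hz in Hle.
        unfold disk in Hw. lra. }
      rewrite HFt, Hz by auto. auto.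
    + intros (z & [Hz Hr'] & <-). unfold disk. now rewrite HFt.
Qed.

(** * The Cauchy formula on circles *)

(** The two differentials encode the Cauchy-Riemann equations, with [dphi] as complex derivative.
    Its continuity is included because the contour deformation differentiates under the integral
    sign. *)
Definition holomorphic (phi dphi : C -> C) : Prop :=
  forall x y, disk 1 (x, y) ->
    differentiable_pt_lim (fun x y => Re (phi (x, y))) x y
      (Re (dphi (x, y))) (- Im (dphi (x, y))) /\
    differentiable_pt_lim (fun x y => Im (phi (x, y))) x y
      (Im (dphi (x, y))) (Re (dphi (x, y))) /\
    continuity_2d_pt (fun x y => Re (dphi (x, y))) x y /\
    continuity_2d_pt (fun x y => Im (dphi (x, y))) x y.

Lemma continuity_2d_pt_comp (f g h : R -> R -> R) (x y : R) :
  continuity_2d_pt f (g x y) (h x y) ->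
  continuity_2d_pt g x y -> continuity_2d_pt h x y ->
  continuity_2d_pt (fun u v => f (g u v) (h u v)) x y.
Proof.
  intros Hf Hg Hh eps. destruct (Hf eps) as [d Hd].
  destruct (Hg d) as [d1 H1]. destruct (Hh d) as [d2 H2].
  assert (Hm : 0 < Rmin d1 d2) by (apply Rmin_pos; [apply d1|apply d2]).
  exists (mkposreal _ Hm). simpl. intros u v Hu Hv.
  assert (M1 := Rmin_l d1 d2). assert (M2 := Rmin_r d1 d2).
  apply Hd; [apply H1|apply H2]; lra.
Qed.

Lemma holomorphic_path (phi dphi : C -> C) (g1 g2 : R -> R) (t d1 d2 : R) :
  holomorphic phi dphi -> disk 1 (g1 t, g2 t) ->
  is_derive g1 t d1 -> is_derive g2 t d2 ->
  is_derive (fun t => Re (phi (g1 t, g2 t))) t (Re (dphi (g1 t, g2 t) * (d1, d2))%C) /\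
  is_derive (fun t => Im (phi (g1 t, g2 t))) t (Im (dphi (g1 t, g2 t) * (d1, d2))%C).
Proof.
  intros H Hg H1 H2. destruct (H _ _ Hg) as (D1 & D2 & _).
  rewrite is_derive_Reals in H1, H2. rewrite !is_derive_Reals.
  split.
  - replace (Re (dphi (g1 t, g2 t) * (d1, d2))%C)
      with (Re (dphi (g1 t, g2 t)) * d1 + - Im (dphi (g1 t, g2 t)) * d2)
      by (simpl; unfold Re, Im; ring).
    apply (derivable_pt_lim_comp_2d _ _ _ _ _ _ _ _ D1); auto.
  - replace (Im (dphi (g1 t, g2 t) * (d1, d2))%C)
      with (Im (dphi (g1 t, g2 t)) * d1 + Re (dphi (g1 t, g2 t)) * d2)
      by (simpl; unfold Re, Im; ring).
    apply (derivable_pt_lim_comp_2d _ _ _ _ _ _ _ _ D2); auto.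
Qed.

Lemma holomorphic_continuity (phi dphi : C -> C) (x y : R) :
  holomorphic phi dphi -> disk 1 (x, y) ->
  continuity_2d_pt (fun x y => Re (phi (x, y))) x y /\
  continuity_2d_pt (fun x y => Im (phi (x, y))) x y.
Proof.
  intros H Hd. destruct (H _ _ Hd) as (D1 & D2 & _).
  split; apply differentiable_continuity_pt; eexists; eexists; eassumption.
Qed.

Lemma differentiable_pt_lim_plus (f g : R -> R -> R) (x y a b c d : R) :
  differentiable_pt_lim f x y a b -> differentiable_pt_lim g x y c d ->
  differentiable_pt_lim (fun u v => f u v + g u v) x y (a + c) (b + d).
Proof.
  rewrite <- !filterdiff_differentiable_pt_lim. intros Hf Hg.
  eapply filterdiff_ext_lin.
  apply (filterdiff_plus_fct (fun u : R * R => f (fst u) (snd u)) _ _ _ Hf Hg).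
  intros [u v]. unfold plus; simpl. ring.
Qed.

Lemma differentiable_pt_lim_mult (f g : R -> R -> R) (x y a b c d : R) :
  differentiable_pt_lim f x y a b -> differentiable_pt_lim g x y c d ->
  differentiable_pt_lim (fun u v => f u v * g u v) x y
    (a * g x y + f x y * c) (b * g x y + f x y * d).
Proof.
  rewrite <- !filterdiff_differentiable_pt_lim. intros Hf Hg.
  eapply filterdiff_ext_lin.
  apply (filterdiff_mult_fct (fun u : R * R => f (fst u) (snd u))
    (fun u : R * R => g (fst u) (snd u)) (x, y) _ _ Rmult_comm Hf Hg).
  intros [u v]. unfold plus, mult; simpl. ring.
Qed.

Lemma differentiable_pt_lim_opp (f : R -> R -> R) (x y a b : R) :
  differentiable_pt_lim f x y a b ->
  differentiable_pt_lim (fun u v => - f u v) x y (- a) (- b).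
Proof.
  rewrite <- !filterdiff_differentiable_pt_lim. intros Hf.
  eapply filterdiff_ext_lin.
  apply (filterdiff_opp_fct (fun u : R * R => f (fst u) (snd u))). exact Hf.
  intros [u v]. unfold opp; simpl. ring.
Qed.

Lemma differentiable_pt_lim_fst (x y : R) : differentiable_pt_lim (fun u _ => u) x y 1 0.
Proof. apply differentiable_pt_lim_proj1_0, derivable_pt_lim_id. Qed.

Lemma differentiable_pt_lim_snd (x y : R) : differentiable_pt_lim (fun _ v => v) x y 0 1.
Proof.
  intros eps. exists eps. intros u v _ _.
  replace (v - y - (0 * (u - x) + 1 * (v - y))) with 0 by ring.
  rewrite Rabs_R0. apply Rmult_le_pos. left; apply eps.
  eapply Rle_trans. apply Rabs_pos. apply Rmax_l.
Qed.

Lemma holomorphic_mul_id (phi dphi : C -> C) :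
  holomorphic phi dphi ->
  holomorphic (fun z => z * phi z)%C (fun z => phi z + z * dphi z)%C.
Proof.
  intros H x y Hd. destruct (H _ _ Hd) as (D1 & D2 & C1 & C2).
  destruct (holomorphic_continuity _ _ _ _ H Hd) as [C3 C4].
  assert (Dx := differentiable_pt_lim_fst x y).
  assert (Dy := differentiable_pt_lim_snd x y).
  assert (Cx := continuity_2d_pt_id1 x y).
  assert (Cy := continuity_2d_pt_id2 x y).
  split; [|split; [|split]]; simpl.
  - assert (P := differentiable_pt_lim_plus _ _ _ _ _ _ _ _
      (differentiable_pt_lim_mult _ _ _ _ _ _ _ _ Dx D1)
      (differentiable_pt_lim_opp _ _ _ _ _
         (differentiable_pt_lim_mult _ _ _ _ _ _ _ _ Dy D2))).
    simpl in P. unfold Re, Im in *.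
    match type of P with differentiable_pt_lim _ _ _ ?a ?b =>
      match goal with |- differentiable_pt_lim _ _ _ ?c ?d =>
        replace c with a by ring; replace d with b by ring end end.
    exact P.
  - assert (P := differentiable_pt_lim_plus _ _ _ _ _ _ _ _
      (differentiable_pt_lim_mult _ _ _ _ _ _ _ _ Dx D2)
      (differentiable_pt_lim_mult _ _ _ _ _ _ _ _ Dy D1)).
    simpl in P. unfold Re, Im in *.
    match type of P with differentiable_pt_lim _ _ _ ?a ?b =>
      match goal with |- differentiable_pt_lim _ _ _ ?c ?d =>
        replace c with a by ring; replace d with b by ring end end.
    exact P.
  - apply continuity_2d_pt_plus; auto.
    apply (continuity_2d_pt_minus (fun u v => u * Re (dphi (u, v))) (fun u v => v * Im (dphi (u, v))));
      apply continuity_2d_pt_mult; auto.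
  - apply continuity_2d_pt_plus; auto.
    apply (continuity_2d_pt_plus (fun u v => u * Im (dphi (u, v))) (fun u v => v * Re (dphi (u, v))));
      apply continuity_2d_pt_mult; auto.
Qed.

Definition circle (r t : R) : C := (r * cos t, r * sin t).

Lemma Cmod_circle (r t : R) : 0 <= r -> Cmod (circle r t) = r.
Proof.
  intros Hr. unfold Cmod, circle; simpl.
  replace (_ + _) with (r * r * (Rsqr (sin t) + Rsqr (cos t))) by (unfold Rsqr; ring).
  rewrite sin2_cos2, Rmult_1_r. apply sqrt_square; auto.
Qed.

Lemma circle_2PI (r : R) : circle r (2 * PI) = circle r 0.
Proof. unfold circle. now rewrite cos_2PI, sin_2PI, cos_0, sin_0. Qed.

Lemma RInt_periodic_derivative (f df : R -> R) :
  (forall t, is_derive f t (df t)) -> (forall t, continuous df t) ->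
  f (2 * PI) = f 0 -> RInt df 0 (2 * PI) = 0.
Proof.
  intros Hf Hc Hp. apply is_RInt_unique.
  replace 0 with (minus (f (2 * PI)) (f 0)) at 2.
  - apply (is_RInt_derive f df); auto.
  - rewrite Hp. unfold minus, plus, opp; simpl. ring.
Qed.

Lemma continuity_2d_pt_path (f : R -> R -> R) (g h : R -> R) (t : R) :
  continuity_2d_pt f (g t) (h t) -> continuous g t -> continuous h t ->
  continuous (fun t => f (g t) (h t)) t.
Proof.
  intros Hf Hg Hh. apply continuity_2d_pt_filterlim in Hf.
  exact (continuous_comp_2 g h f t Hg Hh Hf).
Qed.

Section Cauchy.

Context (phi dphi : C -> C) (K : R -> C) (x y r : R) (c : C).

(** Straight-line homotopy from the constant path at the point (x, y), for s = 0, to the circle of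
    radius r, for s = 1. *)
Let gam (s t : R) : C := (x + s * (r * cos t - x), y + s * (r * sin t - y)).

(* [s] runs over a neighbourhood of [0, 1] on which the contour stays inside the
   unit disk. *)
Lemma deformation_in_disk (s t : R) :
  Cmod (x, y) < r < 1 -> - ((1 - r) / 4) < s < 1 + (1 - r) / 4 -> disk 1 (gam s t).
Proof.
  intros Hr Hs. unfold disk.
  assert (E : gam s t = (RtoC (1 - s) * (x, y) + RtoC s * circle r t)%C).
  { unfold gam, circle, RtoC, Cmult, Cplus; simpl. f_equal; ring. }
  rewrite E. eapply Rle_lt_trans. apply Cmod_triangle.
  rewrite !Cmod_mult, !Cmod_R.
  assert (P := Cmod_ge_0 (x, y)).
  rewrite Cmod_circle by lra.
  assert (Rabs (1 - s) * Cmod (x, y) <= Rabs (1 - s) * r).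
  { apply Rmult_le_compat_l. apply Rabs_pos. lra. }
  unfold Rabs in *; destruct (Rcase_abs s), (Rcase_abs (1 - s)); nra.
Qed.

(* By the hypothesis on [K], the [s]-derivative of
   [phi (z + s (zeta - z)) K] is [1 / (i s)] times the [t]-derivative of
   [c phi (z + s (zeta - z))], so the integral does not depend on [s]. *)
Lemma cauchy_deformation :
  holomorphic phi dphi -> Cmod (x, y) < r < 1 ->
  (forall t, continuous (fun t => Re (K t)) t) ->
  (forall t, continuous (fun t => Im (K t)) t) ->
  (forall t, (K t * (circle r t - (x, y)) = c * circle r t)%C) ->
  RInt (fun t => Re (phi (circle r t) * K t)%C) 0 (2 * PI)
    = RInt (fun t => Re (phi (x, y) * K t)%C) 0 (2 * PI).
Proof.
  intros Hphi Hr HK1 HK2 HK.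
  set (f := fun s t => Re (phi (gam s t) * K t)%C).
  set (df := fun s t => Re (c * dphi (gam s t) * circle r t)%C).
  set (d := (1 - r) / 4).
  assert (Hd : 0 < d) by (unfold d; lra).
  assert (Hder : forall s t, - d < s < 1 + d -> is_derive (fun s => f s t) s (df s t)).
  { intros s t Hs.
    destruct (holomorphic_path phi dphi (fun s => x + s * (r * cos t - x))
      (fun s => y + s * (r * sin t - y)) s (r * cos t - x) (r * sin t - y)) as [D1 D2]; auto.
    - apply deformation_in_disk; auto.
    - auto_derive; auto. ring.
    - auto_derive; auto. ring.
    - set (w := (r * cos t - x, r * sin t - y) : C) in *.
      assert (Ew : w = (circle r t - (x, y))%C) by reflexivity.
      unfold f, df.
      apply (is_derive_ext (fun s => Re (phi (gam s t)) * Re (K t) - Im (phi (gam s t)) * Im (K t))).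
      { reflexivity. }
      replace (Re (c * dphi (gam s t) * circle r t)%C) with
       (Re (dphi (gam s t) * w)%C * Re (K t) - Im (dphi (gam s t) * w)%C * Im (K t)).
      + apply (is_derive_minus (V := R_NormedModule));
          apply (is_derive_scal_l (V := R_NormedModule)); assumption.
      + replace (c * dphi (gam s t) * circle r t)%C
          with (dphi (gam s t) * (c * circle r t))%C by ring.
        rewrite <- HK, <- Ew. simpl. unfold Re, Im. ring. }
  assert (Hcd : forall s t, - d < s < 1 + d -> continuity_2d_pt df s t).
  { intros s t Hs.
    destruct (Hphi _ _ (deformation_in_disk s t Hr Hs)) as (_ & _ & C1 & C2).
    assert (G1 : continuity_2d_pt (fun s t => x + s * (r * cos t - x)) s t).
    { apply continuity_2d_pt_plus. apply continuity_2d_pt_const.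
      apply continuity_2d_pt_mult. apply continuity_2d_pt_id1.
      apply continuity_2d_pt_minus; [|apply continuity_2d_pt_const].
      apply (continuity_1d_2d_pt_comp (fun t => r * cos t) (fun _ t => t)).
      - apply derivable_continuous_pt. exists (r * - sin t).
        apply is_derive_Reals. auto_derive; auto. ring.
      - apply continuity_2d_pt_id2. }
    assert (G2 : continuity_2d_pt (fun s t => y + s * (r * sin t - y)) s t).
    { apply continuity_2d_pt_plus. apply continuity_2d_pt_const.
      apply continuity_2d_pt_mult. apply continuity_2d_pt_id1.
      apply continuity_2d_pt_minus; [|apply continuity_2d_pt_const].
      apply (continuity_1d_2d_pt_comp (fun t => r * sin t) (fun _ t => t)).
      - apply derivable_continuous_pt. exists (r * cos t).
        apply is_derive_Reals. auto_derive; auto. ring.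
      - apply continuity_2d_pt_id2. }
    assert (K1 := continuity_2d_pt_comp _ _ _ _ _ C1 G1 G2).
    assert (K2 := continuity_2d_pt_comp _ _ _ _ _ C2 G1 G2).
    assert (Kc : continuity_2d_pt (fun _ t => r * cos t) s t).
    { apply (continuity_1d_2d_pt_comp (fun t => r * cos t) (fun _ t => t)).
      - apply derivable_continuous_pt. exists (r * - sin t).
        apply is_derive_Reals. auto_derive; auto. ring.
      - apply continuity_2d_pt_id2. }
    assert (Ks : continuity_2d_pt (fun _ t => r * sin t) s t).
    { apply (continuity_1d_2d_pt_comp (fun t => r * sin t) (fun _ t => t)).
      - apply derivable_continuous_pt. exists (r * cos t).
        apply is_derive_Reals. auto_derive; auto. ring.
      - apply continuity_2d_pt_id2. }
    unfold df. simpl.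
    apply continuity_2d_pt_minus; apply continuity_2d_pt_mult; auto.
    - apply continuity_2d_pt_minus; apply continuity_2d_pt_mult; auto;
        apply continuity_2d_pt_const.
    - apply continuity_2d_pt_plus; apply continuity_2d_pt_mult; auto;
        apply continuity_2d_pt_const. }
  assert (Hcf : forall s t, - d < s < 1 + d -> continuous (f s) t).
  { intros s t Hs.
    destruct (holomorphic_continuity _ _ _ _ Hphi (deformation_in_disk s t Hr Hs)) as [C1 C2].
    assert (G1 : continuous (fun t => x + s * (r * cos t - x)) t).
    { apply (ex_derive_continuous (V := R_NormedModule)). auto_derive; auto. }
    assert (G2 : continuous (fun t => y + s * (r * sin t - y)) t).
    { apply (ex_derive_continuous (V := R_NormedModule)). auto_derive; auto. }
    assert (K1 := continuity_2d_pt_path _ _ _ _ C1 G1 G2).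
    assert (K2 := continuity_2d_pt_path _ _ _ _ C2 G1 G2).
    unfold f. simpl.
    apply (continuous_minus (fun t => Re (phi (gam s t)) * Re (K t))
      (fun t => Im (phi (gam s t)) * Im (K t))).
    - apply (continuous_mult (fun t => Re (phi (gam s t))) (fun t => Re (K t))); auto.
    - apply (continuous_mult (fun t => Im (phi (gam s t))) (fun t => Im (K t))); auto. }
  assert (Hloc : forall s, 0 <= s <= 1 -> locally s (fun s => - d < s < 1 + d)).
  { intros s Hs. exists (mkposreal _ Hd). intros u Hu.
    unfold ball in Hu; simpl in Hu; unfold AbsRing_ball, abs, minus, plus, opp in Hu; simpl in Hu.
    apply Rabs_def2 in Hu. lra. }
  assert (Hzero : forall s, 0 <= s <= 1 ->
    is_derive (fun s => RInt (f s) 0 (2 * PI)) s 0).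
  { intros s Hs.
    assert (HI : RInt (fun t => Derive (fun u => f u t) s) 0 (2 * PI) = 0).
    { rewrite (RInt_ext _ (df s)).
      2:{ intros t _. apply is_derive_unique, Hder. lra. }
      assert (Hcs : forall t, continuous (df s) t).
      { intros t. apply (continuity_2d_pt_path df (fun _ => s) (fun t => t)).
        - apply Hcd. lra.
        - apply continuous_const.
        - apply continuous_id. }
      (* At s = 0 one cannot divide by s, but there [df] is Re (c phi'(z) zeta), the t-derivative of
         Im (c phi'(z) zeta). *)
      destruct (Req_dec s 0) as [->|Hs0].
      - apply (RInt_periodic_derivative (fun t => Im (c * dphi (x, y) * circle r t)%C)); auto.
        + intros t. unfold df.
          assert (E : gam 0 t = (x, y)) by (unfold gam; f_equal; ring).
          rewrite E. simpl. auto_derive; auto. unfold Re, Im. ring.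
        + now rewrite circle_2PI.
      - apply Rmult_eq_reg_l with s; auto. rewrite Rmult_0_r.
        change (scal s (RInt (df s) 0 (2 * PI)) = 0).
        rewrite <- (RInt_scal (V := R_CompleteNormedModule) (df s) 0 (2 * PI) s)
          by (apply ex_RInt_continuous; auto).
        apply (RInt_periodic_derivative (fun t => Im (c * phi (gam s t))%C)).
        + intros t.
          destruct (holomorphic_path phi dphi (fun t => x + s * (r * cos t - x))
            (fun t => y + s * (r * sin t - y)) t (s * (- (r * sin t))) (s * (r * cos t)))
            as [D1 D2]; auto.
          * apply deformation_in_disk; auto. lra.
          * auto_derive; auto. ring.
          * auto_derive; auto. ring.
          * apply (is_derive_ext (fun t => Re c * Im (phi (gam s t)) + Im c * Re (phi (gam s t)))).
            { reflexivity. }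
            set (w := (s * (- (r * sin t)), s * (r * cos t)) : C) in *.
            match goal with |- is_derive _ _ ?l => replace l with
             (Re c * Im (dphi (gam s t) * w)%C + Im c * Re (dphi (gam s t) * w)%C) end.
            -- apply (is_derive_plus (V := R_NormedModule));
                 apply (is_derive_scal (fun t => _ (phi (gam s t)))); assumption.
            -- unfold df, scal, circle, w; simpl; unfold mult; simpl. unfold Re, Im. ring.
        + intros t. apply (continuous_scal_r s (df s)). auto.
        + replace (gam s (2 * PI)) with (gam s 0); auto.
          unfold gam. now rewrite cos_2PI, sin_2PI, cos_0, sin_0. }
    enough (G : is_derive (fun s => RInt (f s) 0 (2 * PI)) s
        (RInt (fun t => Derive (fun u => f u t) s) 0 (2 * PI))) by (now rewrite HI in G).
    apply (is_derive_RInt_param f).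
    - apply filter_imp with (2 := Hloc s Hs). intros u Hu t _. eexists. apply Hder; auto.
    - intros t _. apply continuity_2d_pt_ext_loc with df; [|apply Hcd; lra].
      exists (mkposreal _ Hd). intros u v Hu _. simpl in Hu.
      symmetry. apply is_derive_unique, Hder. apply Rabs_def2 in Hu. lra.
    - apply filter_imp with (2 := Hloc s Hs). intros u Hu.
      apply (ex_RInt_continuous (f u)). auto. }
  assert (Heq : RInt (f 0) 0 (2 * PI) = RInt (f 1) 0 (2 * PI)).
  { apply (eq_is_derive (fun s => RInt (f s) 0 (2 * PI))); [|lra]. exact Hzero. }
  rewrite (RInt_ext _ (f 1)).
  2:{ intros t _. unfold f, gam, circle. do 3 f_equal. f_equal; ring. }
  rewrite <- Heq. apply RInt_ext. intros t _. unfold f, gam. do 3 f_equal. f_equal; ring.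
Qed.

End Cauchy.

(** * Integrals of complex-valued functions over a period *)

Definition Ccont (F : R -> C) : Prop :=
  forall t, continuous (fun t => Re (F t)) t /\ continuous (fun t => Im (F t)) t.

Definition Cint (F : R -> C) : C :=
  (RInt (fun t => Re (F t)) 0 (2 * PI), RInt (fun t => Im (F t)) 0 (2 * PI)).

Lemma Ccont_const (c : C) : Ccont (fun _ => c).
Proof. intros t. split; apply continuous_const. Qed.

Lemma Ccont_plus (F G : R -> C) : Ccont F -> Ccont G -> Ccont (fun t => F t + G t)%C.
Proof.
  intros HF HG t. destruct (HF t), (HG t). split; simpl.
  - apply (continuous_plus (fun t => Re (F t)) (fun t => Re (G t))); auto.
  - apply (continuous_plus (fun t => Im (F t)) (fun t => Im (G t))); auto.
Qed.

Lemma Ccont_mult (F G : R -> C) : Ccont F -> Ccont G -> Ccont (fun t => F t * G t)%C.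
Proof.
  intros HF HG t. destruct (HF t), (HG t). split; simpl.
  - apply (continuous_minus (fun t => Re (F t) * Re (G t)) (fun t => Im (F t) * Im (G t))).
    + apply (continuous_mult (fun t => Re (F t)) (fun t => Re (G t))); auto.
    + apply (continuous_mult (fun t => Im (F t)) (fun t => Im (G t))); auto.
  - apply (continuous_plus (fun t => Re (F t) * Im (G t)) (fun t => Im (F t) * Re (G t))).
    + apply (continuous_mult (fun t => Re (F t)) (fun t => Im (G t))); auto.
    + apply (continuous_mult (fun t => Im (F t)) (fun t => Re (G t))); auto.
Qed.

Lemma Ccont_pow (F : R -> C) (n : nat) : Ccont F -> Ccont (fun t => F t ^ n)%C.
Proof.
  intros HF. induction n as [|n IH].
  - exact (Ccont_const 1%C).
  - apply (Ccont_mult F (fun t => F t ^ n)%C); auto.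
Qed.

Lemma Ccont_conj (F : R -> C) : Ccont F -> Ccont (fun t => Cconj (F t)).
Proof.
  intros HF t. destruct (HF t). split; simpl; auto.
  apply (continuous_opp (fun t => Im (F t))); auto.
Qed.

Lemma Ccont_ex_RInt (F : R -> C) (a b : R) : Ccont F ->
  ex_RInt (fun t => Re (F t)) a b /\ ex_RInt (fun t => Im (F t)) a b.
Proof. intros H. split; apply (ex_RInt_continuous (V := R_CompleteNormedModule)); intros; apply H. Qed.

Lemma Cint_ext (F G : R -> C) : (forall t, F t = G t) -> Cint F = Cint G.
Proof.
  intros H. unfold Cint. f_equal; apply RInt_ext; intros t _; now rewrite H.
Qed.

Lemma Cint_plus (F G : R -> C) : Ccont F -> Ccont G ->
  Cint (fun t => F t + G t)%C = (Cint F + Cint G)%C.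
Proof.
  intros HF HG. destruct (Ccont_ex_RInt F 0 (2 * PI) HF), (Ccont_ex_RInt G 0 (2 * PI) HG).
  unfold Cint, Cplus; simpl. f_equal.
  - apply (RInt_plus (fun t => Re (F t)) (fun t => Re (G t))); auto.
  - apply (RInt_plus (fun t => Im (F t)) (fun t => Im (G t))); auto.
Qed.

Lemma Cint_scal (F : R -> C) (c : C) : Ccont F ->
  Cint (fun t => c * F t)%C = (c * Cint F)%C.
Proof.
  intros HF. destruct (Ccont_ex_RInt F 0 (2 * PI) HF) as [H1 H2].
  assert (S : forall (a : R) f, ex_RInt f 0 (2 * PI) ->
    ex_RInt (fun t => a * f t) 0 (2 * PI) /\
    RInt (fun t => a * f t) 0 (2 * PI) = a * RInt f 0 (2 * PI)).
  { intros a f Hf. split.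
    - apply (ex_RInt_scal (V := R_NormedModule)); auto.
    - apply (RInt_scal (V := R_CompleteNormedModule)); auto. }
  destruct (S (Re c) _ H1), (S (Im c) _ H1), (S (Re c) _ H2), (S (Im c) _ H2).
  unfold Cint, Cmult; simpl. f_equal.
  - rewrite (RInt_minus (V := R_CompleteNormedModule)
      (fun t => Re c * Re (F t)) (fun t => Im c * Im (F t))); auto.
    unfold minus, plus, opp; simpl. unfold Re, Im in *. lra.
  - rewrite (RInt_plus (V := R_CompleteNormedModule)
      (fun t => Re c * Im (F t)) (fun t => Im c * Re (F t))); auto.
    unfold plus; simpl. unfold Re, Im in *. lra.
Qed.

Lemma Cint_conj (F : R -> C) : Ccont F -> Cint (fun t => Cconj (F t)) = Cconj (Cint F).
Proof.
  intros HF. destruct (Ccont_ex_RInt F 0 (2 * PI) HF) as [H1 H2].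
  unfold Cint, Cconj; simpl. f_equal.
  apply (RInt_opp (V := R_CompleteNormedModule) (fun t => Im (F t))); auto.
Qed.

Lemma Cint_const (c : C) : Cint (fun _ => c) = (2 * PI * c)%C.
Proof.
  unfold Cint. rewrite !RInt_const. unfold Cmult, RtoC, scal; simpl. unfold mult; simpl.
  unfold Re, Im. f_equal; ring.
Qed.

Lemma Cmod_le_Re_Im (z : C) : Cmod z <= Rabs (Re z) + Rabs (Im z).
Proof.
  assert (H1 := Rabs_pos (Re z)). assert (H2 := Rabs_pos (Im z)).
  apply Rsqr_incr_0_var; [|lra]. rewrite Rsqr_pow2, Cmod_sqr.
  rewrite <- (pow2_abs (Re z)), <- (pow2_abs (Im z)). unfold Rsqr. nra.
Qed.

(** Bounding real and imaginary parts separately gives 4 PI instead of the sharp 2 PI; the constant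
    only multiplies errors that decay geometrically. *)
Lemma Cint_bound (F : R -> C) (B : R) : Ccont F -> (forall t, 0 <= t <= 2 * PI -> Cmod (F t) <= B) ->
  Cmod (Cint F) <= 4 * PI * B.
Proof.
  intros HF HB. destruct (Ccont_ex_RInt F 0 (2 * PI) HF) as [H1 H2].
  assert (Hpi := PI_RGT_0).
  assert (Rabs (Re (Cint F)) <= (2 * PI - 0) * B).
  { apply (abs_RInt_le_const (fun t => Re (F t))); auto. lra.
    intros t Ht. eapply Rle_trans. 2: apply (HB t Ht).
    eapply Rle_trans. 2: apply Rmax_Cmod. apply Rmax_l. }
  assert (Rabs (Im (Cint F)) <= (2 * PI - 0) * B).
  { apply (abs_RInt_le_const (fun t => Im (F t))); auto. lra.
    intros t Ht. eapply Rle_trans. 2: apply (HB t Ht).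
    eapply Rle_trans. 2: apply Rmax_Cmod. apply Rmax_r. }
  assert (H3 := Cmod_le_Re_Im (Cint F)). lra.
Qed.

Lemma Ccont_bounded (F : R -> C) : Ccont F ->
  exists B, 0 <= B /\ forall t, 0 <= t <= 2 * PI -> Cmod (F t) <= B.
Proof.
  intros HF.
  assert (Hpi := PI_RGT_0).
  assert (K : forall g : R -> R, (forall t, continuous g t) ->
    exists B, 0 <= B /\ forall t, 0 <= t <= 2 * PI -> Rabs (g t) <= B).
  { intros g Hg.
    destruct (continuity_ab_maj (fun t => Rabs (g t)) 0 (2 * PI)) as [m [Hm _]].
    - lra.
    - intros t _. apply continuity_pt_filterlim.
      apply (continuous_comp g Rabs). apply Hg. apply continuous_Rabs.
    - exists (Rabs (g m)). split; [apply Rabs_pos|auto]. }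
  destruct (K (fun t => Re (F t))) as (B1 & P1 & H1). apply HF.
  destruct (K (fun t => Im (F t))) as (B2 & P2 & H2). apply HF.
  exists (B1 + B2). split. lra. intros t Ht.
  eapply Rle_trans. apply Cmod_le_Re_Im. specialize (H1 t Ht). specialize (H2 t Ht). lra.
Qed.

Lemma Ccont_circle (r : R) : Ccont (circle r).
Proof.
  intros t. split; simpl; apply (ex_derive_continuous (V := R_NormedModule));
    auto_derive; auto.
Qed.

(** This is e^(-it); on the circle of radius r it equals r / zeta. *)
Definition ecirc (t : R) : C := Cconj (circle 1 t).

Lemma Ccont_ecirc : Ccont ecirc.
Proof. apply Ccont_conj, Ccont_circle. Qed.

Lemma Cmod_ecirc (t : R) : Cmod (ecirc t) = 1.
Proof. unfold ecirc. rewrite Cmod_conj, Cmod_circle; lra. Qed.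

Lemma circle_scal (r t : R) : circle r t = (r * circle 1 t)%C.
Proof. unfold circle, Cmult, RtoC; simpl. f_equal; ring. Qed.

Lemma circle_ecirc (r t : R) : (circle r t * ecirc t)%C = RtoC r.
Proof.
  unfold circle, ecirc, Cmult, Cconj, RtoC; simpl.
  assert (H := sin2_cos2 t). unfold Rsqr in H.
  f_equal; [|ring].
  transitivity (r * (sin t * sin t + cos t * cos t)); [ring|rewrite H; ring].
Qed.

Lemma Ccont_holomorphic (phi dphi : C -> C) (r : R) :
  holomorphic phi dphi -> 0 <= r < 1 -> Ccont (fun t => phi (circle r t)).
Proof.
  intros H Hr t.
  assert (Hd : disk 1 (circle r t)) by (unfold disk; rewrite Cmod_circle; lra).
  destruct (holomorphic_continuity _ _ _ _ H Hd) as [C1 C2].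
  destruct (Ccont_circle r t) as [C3 C4].
  split.
  - exact (continuity_2d_pt_path _ _ _ _ C1 C3 C4).
  - exact (continuity_2d_pt_path _ _ _ _ C2 C3 C4).
Qed.

(** K is the Cauchy kernel zeta / (zeta - z). The right side keeps [Cint K], whose value 2 PI is
    found later by expanding the kernel against the constant 1. *)
Lemma cauchy_formula (phi dphi : C -> C) (K : R -> C) (z : C) (r : R) :
  holomorphic phi dphi -> Cmod z < r < 1 -> Ccont K ->
  (forall t, (K t * (circle r t - z) = circle r t)%C) ->
  Cint (fun t => phi (circle r t) * K t)%C = (phi z * Cint K)%C.
Proof.
  intros H Hr HK HKz. destruct z as [x y].
  rewrite <- Cint_scal by auto.
  unfold Cint. f_equal.
  - apply (cauchy_deformation phi dphi K x y r 1%C); auto.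
    + intros t. apply HK.
    + intros t. apply HK.
    + intros t. rewrite HKz. ring.
  (* The imaginary part is the real part for the kernel -i K, hence the deformation with c = -i. *)
  - assert (HK' : Ccont (fun t => - Ci * K t)%C).
    { apply (Ccont_mult (fun _ => - Ci)%C K); auto. apply Ccont_const. }
    assert (E := cauchy_deformation phi dphi (fun t => - Ci * K t)%C x y r (- Ci)%C H Hr
      (fun t => proj1 (HK' t)) (fun t => proj2 (HK' t))).
    assert (R1 : forall w k : C, Im (w * k)%C = Re (w * (- Ci * k))%C).
    { intros [a b] [c d]. unfold Ci. simpl. ring. }
    erewrite RInt_ext. 2:{ intros t _. apply R1. }
    rewrite E.
    + apply RInt_ext. intros t _. symmetry. apply R1.
    + intros t. rewrite <- Cmult_assoc, HKz. ring.
Qed.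

Lemma mean_value (phi dphi : C -> C) (r : R) :
  holomorphic phi dphi -> 0 < r < 1 ->
  Cint (fun t => phi (circle r t)) = (2 * PI * phi 0)%C.
Proof.
  intros H Hr.
  rewrite (Cint_ext _ (fun t => phi (circle r t) * 1)%C) by (intros; ring).
  rewrite (cauchy_formula phi dphi (fun _ => 1%C) 0 r); auto.
  - rewrite Cint_const. ring.
  - rewrite Cmod_0. lra.
  - apply Ccont_const.
  - intros t. ring.
Qed.

Lemma holomorphic_mul_pow (phi dphi : C -> C) (k : nat) :
  holomorphic phi dphi -> exists d, holomorphic (fun z => z ^ k * phi z)%C d.
Proof.
  intros H. induction k as [|k [d IH]].
  - exists dphi. intros x y Hd. destruct (H x y Hd) as (D1 & D2 & C1 & C2).
    repeat split; auto.
    + eapply differentiable_pt_lim_ext; [|exact D1].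
      apply locally_2d_forall. intros u v. simpl. unfold Re; ring.
    + eapply differentiable_pt_lim_ext; [|exact D2].
      apply locally_2d_forall. intros u v. simpl. unfold Im; ring.
  - exists (fun z => z ^ k * phi z + z * d z)%C.
    assert (P := holomorphic_mul_id _ _ IH).
    intros x y Hd. destruct (P x y Hd) as (D1 & D2 & C1 & C2).
    repeat split; auto.
    + eapply differentiable_pt_lim_ext; [|exact D1].
      apply locally_2d_forall. intros u v. f_equal. simpl Cpow. ring.
    + eapply differentiable_pt_lim_ext; [|exact D2].
      apply locally_2d_forall. intros u v. f_equal. simpl Cpow. ring.
Qed.

(** The integrand is r^(-k) zeta^k phi(zeta), and z^k phi(z) has mean value 0 because it vanishes at
    the origin. These are the Fourier coefficients of index -k. *)
Lemma negative_coefficient (phi dphi : C -> C) (r : R) (k : nat) :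
  holomorphic phi dphi -> 0 < r < 1 -> (0 < k)%nat ->
  Cint (fun t => phi (circle r t) * Cconj (ecirc t) ^ k)%C = 0%C.
Proof.
  intros H Hr Hk.
  destruct (holomorphic_mul_pow phi dphi k H) as [d Hd].
  assert (M := mean_value _ _ r Hd Hr).
  assert (Hrk : RtoC r <> 0%C) by (intros E; apply RtoC_inj in E; lra).
  rewrite (Cint_ext _ (fun t => / r ^ k * (circle r t ^ k * phi (circle r t)))%C).
  - rewrite Cint_scal, M.
    + destruct k as [|k]; [lia|]. rewrite (Cpow_S 0). ring.
    + apply (Ccont_holomorphic _ _ _ Hd). lra.
  - intros t. rewrite (circle_scal r), Cpow_mult_l.
    unfold ecirc. rewrite Cconj_conj. field. now apply Cpow_nz.
Qed.

(** * Geometric expansion of the Cauchy kernel *)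

Fixpoint Csum (a : nat -> C) (n : nat) : C :=
  match n with O => 0%C | S n => (Csum a n + a n)%C end.

Section Expansion.

Context (q : C) (Hq : Cmod q < 1).

Let K (t : R) : C := (/ (1 - q * ecirc t))%C.

Lemma geometric_denominator (t : R) : 1 - Cmod q <= Cmod (1 - q * ecirc t).
Proof.
  assert (H := Cmod_minus_ge 1 (q * ecirc t)).
  rewrite Cmod_mult, Cmod_ecirc, Cmod_1 in H. lra.
Qed.

Lemma geometric_denominator_neq_0 (t : R) : (1 - q * ecirc t)%C <> 0%C.
Proof.
  intros E. assert (H := geometric_denominator t). rewrite E, Cmod_0 in H. lra.
Qed.

Lemma Ccont_geometric : Ccont K.
Proof.
  intros t. assert (N := geometric_denominator_neq_0 t).
  assert (N' : Re (1 - q * ecirc t)%C ^ 2 + Im (1 - q * ecirc t)%C ^ 2 <> 0).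
  { rewrite <- Cmod_sqr. apply pow_nonzero. intros E. apply N. now apply Cmod_eq_0. }
  destruct q as [a b]. unfold K, ecirc, circle, Cinv in *. simpl in *.
  split; apply (ex_derive_continuous (V := R_NormedModule)); auto_derive;
    intros E; apply N';
    (etransitivity; [|exact E]); ring.
Qed.

(** Iterating 1/(1 - q e) = 1 + q e/(1 - q e) produces the partial sum with an exact remainder, so
    series and integral are never interchanged. *)
Lemma geometric_expansion (F : R -> C) (B : R) :
  Ccont F -> (forall t, 0 <= t <= 2 * PI -> Cmod (F t) <= B) ->
  forall n, Cmod (Cint (fun t => F t * K t)
     - Csum (fun k => q ^ k * Cint (fun t => F t * ecirc t ^ k)) n)%C
    <= 4 * PI * B / (1 - Cmod q) * Cmod q ^ n.
Proof.
  intros HF HB n.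
  assert (Hrem : forall k, Ccont (fun t => F t * K t * ecirc t ^ k)%C).
  { intros k. apply (Ccont_mult (fun t => F t * K t)%C (fun t => ecirc t ^ k)%C).
    - apply Ccont_mult; auto. apply Ccont_geometric.
    - apply Ccont_pow, Ccont_ecirc. }
  assert (E : Cint (fun t => F t * K t)%C =
    (Csum (fun k => q ^ k * Cint (fun t => F t * ecirc t ^ k)) n
      + q ^ n * Cint (fun t => F t * K t * ecirc t ^ n))%C).
  { induction n as [|n IH].
    - simpl. rewrite (Cint_ext (fun t => F t * K t * 1)%C (fun t => F t * K t)%C).
      ring. intros; ring.
    - rewrite IH. simpl Csum.
      rewrite (Cint_ext (fun t => F t * K t * ecirc t ^ n)%C
        (fun t => F t * ecirc t ^ n + q * (F t * K t * ecirc t ^ S n))%C).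
      + rewrite Cint_plus.
        * rewrite Cint_scal by auto. rewrite (Cpow_S q). ring.
        * apply Ccont_mult; auto. apply Ccont_pow, Ccont_ecirc.
        * apply (Ccont_mult (fun _ => q)); auto. apply Ccont_const.
      + intros t. unfold K. rewrite Cpow_S. field. apply geometric_denominator_neq_0. }
  rewrite E.
  replace (Csum (fun k => q ^ k * Cint (fun t => F t * ecirc t ^ k)) n
      + q ^ n * Cint (fun t => F t * K t * ecirc t ^ n)
    - Csum (fun k => q ^ k * Cint (fun t => F t * ecirc t ^ k)) n)%C
    with (q ^ n * Cint (fun t => F t * K t * ecirc t ^ n))%C by ring.
  rewrite Cmod_mult, Cmod_pow.
  replace (4 * PI * B / (1 - Cmod q) * Cmod q ^ n)
    with (Cmod q ^ n * (4 * PI * (B / (1 - Cmod q)))) by (field; lra).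
  apply Rmult_le_compat_l. apply pow_le, Cmod_ge_0.
  apply Cint_bound; auto.
  intros t Ht. rewrite !Cmod_mult, Cmod_pow, Cmod_ecirc, pow1, Rmult_1_r.
  unfold K. rewrite Cmod_inv by apply geometric_denominator_neq_0.
  apply Rmult_le_compat; auto using Cmod_ge_0.
  - left. apply Rinv_0_lt_compat. assert (G := geometric_denominator t). lra.
  - apply Rinv_le_contravar. lra. apply geometric_denominator.
Qed.

End Expansion.

(** The restriction to n > 0 is for the expansion of the constant 1, whose partial sums equal 2 PI
    only from n = 1 on; the empty one is 0. *)
Lemma geometric_bound_eq_0 (x B q : R) :
  0 <= q < 1 -> (forall n, (0 < n)%nat -> x <= B * q ^ n) -> x <= 0.
Proof.
  intros Hq H.
  apply (is_lim_seq_le (fun _ => x) (fun n => B * q ^ S n) x 0).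
  - intros n. apply H. lia.
  - apply is_lim_seq_const.
  - replace (Finite 0) with (Rbar_mult B 0) by (simpl; f_equal; ring).
    apply is_lim_seq_scal_l.
    apply (is_lim_seq_incr_1 (fun n => q ^ n)).
    apply is_lim_seq_geom. rewrite Rabs_pos_eq; tauto.
Qed.

Lemma holomorphic_const (c : C) : holomorphic (fun _ => c) (fun _ => 0%C).
Proof.
  intros x y _. simpl. rewrite Ropp_0.
  assert (D : forall a, differentiable_pt_lim (fun _ _ => a) x y 0 0).
  { intros a. apply differentiable_pt_lim_proj1_0, derivable_pt_lim_const. }
  repeat split; auto; apply continuity_2d_pt_const.
Qed.

Lemma Cint_ecirc_pow (k : nat) : (0 < k)%nat -> Cint (fun t => ecirc t ^ k)%C = 0%C.
Proof.
  intros Hk.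
  assert (N := negative_coefficient _ _ (1 / 2) k (holomorphic_const 1%C)).
  assert (E : Cint (fun t => Cconj (ecirc t ^ k))%C = 0%C).
  { rewrite <- N; auto; [|lra]. apply Cint_ext. intros t. rewrite Cpow_conj. ring. }
  rewrite Cint_conj in E by (apply Ccont_pow, Ccont_ecirc).
  rewrite <- (Cconj_conj (Cint _)), E. unfold Cconj, RtoC; simpl. f_equal. ring.
Qed.

(** The Cauchy kernel is 1/(1 - q e^(-it)) with q = z/r. Partial sums with a geometric error are the
    form in which the expansion is used: finite sums are estimated first, and the error is removed
    at the end. *)
Lemma cauchy_series (phi dphi : C -> C) (z : C) (r : R) :
  holomorphic phi dphi -> Cmod z < r < 1 ->
  exists B, 0 <= B /\ forall n,
    Cmod (2 * PI * phi z
      - Csum (fun k => (z / r) ^ k * Cint (fun t => phi (circle r t) * ecirc t ^ k)) n)%C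
    <= B * (Cmod z / r) ^ n.
Proof.
  intros H Hr.
  assert (P := Cmod_ge_0 z).
  set (q := (z / r)%C).
  assert (Hrn : RtoC r <> 0%C) by (intros E; apply RtoC_inj in E; lra).
  assert (Hmq : Cmod q = Cmod z / r).
  { unfold q. rewrite Cmod_div by auto. rewrite Cmod_R, Rabs_pos_eq; lra. }
  assert (Hq : Cmod q < 1).
  { rewrite Hmq. apply Rlt_div_l; lra. }
  set (K := fun t => (/ (1 - q * ecirc t))%C).
  assert (HK : Ccont K) by now apply Ccont_geometric.
  (* Expanded against the constant 1, the kernel keeps only its term k = 0. *)
  assert (IK : Cint K = (2 * PI)%C).
  { apply Cmod_minus_eq_0.
    apply (geometric_bound_eq_0 _ (4 * PI * 1 / (1 - Cmod q)) (Cmod q)).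
    { split; [apply Cmod_ge_0|auto]. }
    intros n Hn.
    assert (E := geometric_expansion q Hq (fun _ => 1%C) 1 (Ccont_const _)
      (fun _ _ => Req_le _ _ Cmod_1) n).
    assert (S1 : Csum (fun k => q ^ k * Cint (fun t => 1 * ecirc t ^ k))%C n = (2 * PI)%C).
    { destruct n as [|n]; [lia|]. clear. induction n as [|n IH].
      - simpl. rewrite (Cint_ext _ (fun _ => 1%C)) by (intros; ring).
        rewrite Cint_const. ring.
      - change (Csum ?a (S (S n))) with (Csum a (S n) + a (S n))%C. rewrite IH.
        rewrite (Cint_ext _ (fun t => ecirc t ^ S n)%C) by (intros; ring).
        rewrite Cint_ecirc_pow by lia. ring. }
    cbv beta in E. rewrite S1 in E. rewrite (Cint_ext _ K) in E. exact E.
    intros t. unfold K. ring. }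
  assert (HF := Ccont_holomorphic phi dphi r H). assert (HF' : Ccont (fun t => phi (circle r t))).
  { apply HF. lra. }
  destruct (Ccont_bounded _ HF') as (B & B0 & HB).
  exists (4 * PI * B / (1 - Cmod q)). split.
  - apply Rdiv_le_0_compat; [|lra]. assert (Q := PI_RGT_0). nra.
  - intros n. rewrite <- Hmq.
    assert (E : Cmod (Cint (fun t => phi (circle r t) * K t)
        - Csum (fun k => q ^ k * Cint (fun t => phi (circle r t) * ecirc t ^ k)) n)%C
      <= 4 * PI * B / (1 - Cmod q) * Cmod q ^ n)
      by exact (geometric_expansion q Hq _ B HF' HB n).
    rewrite (cauchy_formula phi dphi K z r) in E; auto.
    + rewrite IK in E. rewrite (Cmult_comm (2 * PI)). exact E.
    + intros t. unfold K.
      assert (E1 : (circle r t - z)%C = (circle r t * (1 - q * ecirc t))%C).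
      { transitivity (circle r t - q * (circle r t * ecirc t))%C; [|ring].
        rewrite circle_ecirc. unfold q. field. auto. }
      rewrite E1. field. now apply geometric_denominator_neq_0.
Qed.

(* [p] is the gradient of [u] in complex form, [u_x - i u_y]; it is holomorphic
   when [u] is harmonic. *)
Definition holomorphic_gradient (u : C -> R) (p dp : C -> C) : Prop :=
  holomorphic p dp /\
  forall x y, disk 1 (x, y) ->
    differentiable_pt_lim (fun x y => u (x, y)) x y (Re (p (x, y))) (- Im (p (x, y))).

(** * Fourier coefficients of a harmonic function *)

Lemma Ccont_RtoC (g : R -> R) : (forall t, continuous g t) -> Ccont (fun t => RtoC (g t)).
Proof. intros H t. split; simpl; auto. apply continuous_const. Qed.

Lemma continuous_gradient_circle (u : C -> R) (p dp : C -> C) (r t : R) :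
  holomorphic_gradient u p dp -> 0 <= r < 1 -> continuous (fun t => u (circle r t)) t.
Proof.
  intros [_ H] Hr.
  assert (Hd : disk 1 (circle r t)) by (unfold disk; rewrite Cmod_circle; lra).
  destruct (Ccont_circle r t) as [C3 C4].
  refine (continuity_2d_pt_path (fun x y => u (x, y)) _ _ _ _ C3 C4).
  apply differentiable_continuity_pt. eexists; eexists. apply (H _ _ Hd).
Qed.

Lemma is_derive_gradient_path (u : C -> R) (p dp : C -> C) (g1 g2 : R -> R) (t d1 d2 : R) :
  holomorphic_gradient u p dp -> disk 1 (g1 t, g2 t) ->
  is_derive g1 t d1 -> is_derive g2 t d2 ->
  is_derive (fun t => u (g1 t, g2 t)) t (Re (p (g1 t, g2 t) * (d1, d2))%C).
Proof.
  intros [_ H] Hd H1 H2. rewrite is_derive_Reals in *.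
  replace (Re (p (g1 t, g2 t) * (d1, d2))%C)
      with (Re (p (g1 t, g2 t)) * d1 + - Im (p (g1 t, g2 t)) * d2)
      by (simpl; unfold Re, Im; ring).
  apply (derivable_pt_lim_comp_2d (fun x y => u (x, y)) _ _ _ _ _ _ _ (H _ _ Hd)); auto.
Qed.

Lemma ecirc_pow (t : R) (k : nat) : (ecirc t ^ k)%C = (cos (INR k * t), - sin (INR k * t)).
Proof.
  induction k as [|k IH].
  - simpl. rewrite Rmult_0_l, cos_0, sin_0, Ropp_0. reflexivity.
  - rewrite Cpow_S, IH, S_INR.
    replace ((INR k + 1) * t) with (t + INR k * t) by ring.
    rewrite cos_plus, sin_plus. unfold ecirc, circle, Cconj, Cmult; simpl.
    f_equal; ring.
Qed.

(** With the factor 1/PI, a harmonic u = Re (sum of c_k z^k) has the coefficients c_k r^k for k >=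
    1. *)
Definition fourier_coeff (u : C -> R) (r : R) (k : nat) : C :=
  (/ PI * Cint (fun t => u (circle r t) * ecirc t ^ k))%C.

Section Coefficients.

Context (u : C -> R) (p dp : C -> C) (r : R).
Context (Hu : holomorphic_gradient u p dp).
Context (Hr : 0 < r < 1).

Lemma angular_derivative (t : R) :
  is_derive (fun t => u (circle r t)) t (- Im (circle r t * p (circle r t))%C).
Proof.
  assert (Hd : disk 1 (circle r t)) by (unfold disk; rewrite Cmod_circle; lra).
  assert (D := is_derive_gradient_path u p dp (fun t => r * cos t) (fun t => r * sin t) t
    (- (r * sin t)) (r * cos t) Hu Hd).
  match goal with |- is_derive _ _ ?l =>
    replace l with (Re (Cmult (p (circle r t)) (- (r * sin t), r * cos t))) end.
  - apply D; auto_derive; auto; ring.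
  - unfold circle. simpl. unfold Re, Im. ring.
Qed.

(** Integration by parts, done for cosine and sine separately: Im (z p(z)) is minus the angular
    derivative of u, and the boundary terms cancel by periodicity. *)
Lemma Cint_angular_derivative (k : nat) :
  Cint (fun t => Im (circle r t * p (circle r t))%C * ecirc t ^ k)%C
  = (- Ci * INR k * Cint (fun t => u (circle r t) * ecirc t ^ k))%C.
Proof.
  assert (Hc1 : forall t, continuous (fun t => u (circle r t)) t).
  { intros t. apply (continuous_gradient_circle u p dp); auto. lra. }
  assert (HS : Ccont (fun t => circle r t * p (circle r t))%C).
  { apply Ccont_mult. apply Ccont_circle. apply (Ccont_holomorphic p dp). apply Hu. lra. }
  set (S := fun t => Im (circle r t * p (circle r t))%C).
  set (U := fun t => u (circle r t)).
  assert (HcS : forall t, continuous S t) by apply HS.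
  assert (Hcos : forall t, continuous (fun t => cos (INR k * t)) t).
  { intros t. apply (ex_derive_continuous (V := R_NormedModule)). auto_derive; auto. }
  assert (Hsin : forall t, continuous (fun t => sin (INR k * t)) t).
  { intros t. apply (ex_derive_continuous (V := R_NormedModule)). auto_derive; auto. }
  assert (Hmul : forall f g : R -> R, (forall t, continuous f t) -> (forall t, continuous g t) ->
    forall t, continuous (fun t => f t * g t) t).
  { intros f g Hf Hg t. apply (continuous_mult f g); auto. }
  assert (Hex : forall f : R -> R, (forall t, continuous f t) -> ex_RInt f 0 (2 * PI)).
  { intros f Hf. apply (ex_RInt_continuous (V := R_CompleteNormedModule)). auto. }
  assert (Hper : forall j, cos (INR j * (2 * PI)) = 1 /\ sin (INR j * (2 * PI)) = 0).
  { intros j. replace (INR j * (2 * PI)) with (0 + 2 * INR j * PI) by ring.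
    now rewrite cos_period, sin_period, cos_0, sin_0. }
  assert (I1 : RInt (fun t => S t * cos (INR k * t)) 0 (2 * PI)
             = - INR k * RInt (fun t => U t * sin (INR k * t)) 0 (2 * PI)).
  { assert (E : RInt (fun t => S t * cos (INR k * t)
        + INR k * (U t * sin (INR k * t))) 0 (2 * PI) = 0).
    { apply (RInt_periodic_derivative (fun t => - (U t * cos (INR k * t)))).
      - intros t. assert (D := angular_derivative t). fold (S t) in D.
        assert (D2 : is_derive (fun t => cos (INR k * t)) t (- INR k * sin (INR k * t))).
        { auto_derive; auto. ring. }
        match goal with |- is_derive _ _ ?l =>
          replace l with (opp (plus (mult (- S t) (cos (INR k * t)))
             (mult (U t) (- INR k * sin (INR k * t))))) end.
        + apply (is_derive_opp (V := R_NormedModule)).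
          apply (is_derive_mult U _ t _ _ D D2). intros; apply Rmult_comm.
        + unfold opp, plus, mult; simpl. ring.
      - intros t. apply (continuous_plus (fun t => S t * cos (INR k * t))).
        apply Hmul; auto.
        apply (continuous_scal_r (INR k) (fun t => U t * sin (INR k * t))). apply Hmul; auto.
      - unfold U. rewrite circle_2PI, (proj1 (Hper k)), Rmult_0_r, cos_0. reflexivity. }
    rewrite (RInt_plus (V := R_CompleteNormedModule)
      (fun t => S t * cos (INR k * t)) (fun t => INR k * (U t * sin (INR k * t)))) in E.
    - rewrite (RInt_scal (V := R_CompleteNormedModule) (fun t => U t * sin (INR k * t))) in E
        by (apply Hex, Hmul; auto).
      unfold plus, scal in E; simpl in E; unfold mult in E; simpl in E. lra.
    - apply Hex, Hmul; auto.
    - apply (ex_RInt_scal (V := R_NormedModule) (fun t => U t * sin (INR k * t))). apply Hex, Hmul; auto. }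
  assert (I2 : RInt (fun t => S t * - sin (INR k * t)) 0 (2 * PI)
             = - INR k * RInt (fun t => U t * cos (INR k * t)) 0 (2 * PI)).
  { assert (E : RInt (fun t => S t * - sin (INR k * t)
        + INR k * (U t * cos (INR k * t))) 0 (2 * PI) = 0).
    { apply (RInt_periodic_derivative (fun t => U t * sin (INR k * t))).
      - intros t. assert (D := angular_derivative t). fold (S t) in D.
        assert (D2 : is_derive (fun t => sin (INR k * t)) t (INR k * cos (INR k * t))).
        { auto_derive; auto. ring. }
        match goal with |- is_derive _ _ ?l =>
          replace l with (plus (mult (- S t) (sin (INR k * t)))
             (mult (U t) (INR k * cos (INR k * t)))) end.
        + apply (is_derive_mult U _ t _ _ D D2). intros; apply Rmult_comm.
        + unfold opp, plus, mult; simpl. ring.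
      - intros t. apply (continuous_plus (fun t => S t * - sin (INR k * t))).
        apply Hmul; auto. intros s. apply (continuous_opp (fun t => sin (INR k * t))). auto.
        apply (continuous_scal_r (INR k) (fun t => U t * cos (INR k * t))). apply Hmul; auto.
      - unfold U. rewrite circle_2PI, (proj2 (Hper k)), (Rmult_0_r (INR k)), sin_0. reflexivity. }
    rewrite (RInt_plus (V := R_CompleteNormedModule)
      (fun t => S t * - sin (INR k * t)) (fun t => INR k * (U t * cos (INR k * t)))) in E.
    - rewrite (RInt_scal (V := R_CompleteNormedModule) (fun t => U t * cos (INR k * t))) in E
        by (apply Hex, Hmul; auto).
      unfold plus, scal in E; simpl in E; unfold mult in E; simpl in E. lra.
    - apply Hex, Hmul; auto. intros s. apply (continuous_opp (fun t => sin (INR k * t))). auto.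
    - apply (ex_RInt_scal (V := R_NormedModule) (fun t => U t * cos (INR k * t))). apply Hex, Hmul; auto. }
  assert (I3 : RInt (fun t => U t * - sin (INR k * t)) 0 (2 * PI)
     = - RInt (fun t => U t * sin (INR k * t)) 0 (2 * PI)).
  { rewrite <- (RInt_opp (V := R_CompleteNormedModule)) by (apply Hex, Hmul; auto).
    apply RInt_ext. intros t _. unfold opp; simpl. ring. }
  assert (EU : Cint (fun t => U t * ecirc t ^ k)%C
    = (RInt (fun t => U t * cos (INR k * t)) 0 (2 * PI),
       RInt (fun t => U t * - sin (INR k * t)) 0 (2 * PI))).
  { unfold Cint. f_equal; apply RInt_ext; intros t _; rewrite ecirc_pow; simpl; ring. }
  assert (ES : Cint (fun t => S t * ecirc t ^ k)%C
    = (RInt (fun t => S t * cos (INR k * t)) 0 (2 * PI),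
       RInt (fun t => S t * - sin (INR k * t)) 0 (2 * PI))).
  { unfold Cint. f_equal; apply RInt_ext; intros t _; rewrite ecirc_pow; simpl; ring. }
  transitivity (Cint (fun t => S t * ecirc t ^ k)%C); [reflexivity|].
  rewrite ES, I1, I2. change (fun t => (u (circle r t) * ecirc t ^ k)%C)
    with (fun t => (U t * ecirc t ^ k)%C).
  rewrite EU, I3. unfold Ci, Cmult, Copp, RtoC; simpl. f_equal; ring.
Qed.

(** Write S = z p(z) as conj S + 2 i Im S. For k > 0 the conjugate contributes the conjugate of a
    coefficient of S of index -k, which is 0, so the imaginary part alone determines the
    coefficient. For k = 0 both sides vanish since S(0) = 0. *)
Lemma fourier_coeff_analytic (k : nat) :
  Cint (fun t => circle r t * p (circle r t) * ecirc t ^ k)%C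
  = (PI * (INR k * fourier_coeff u r k) * 2)%C.
Proof.
  assert (HpiC : RtoC PI <> 0%C).
  { intros E. apply RtoC_inj in E. assert (Q := PI_RGT_0). lra. }
  destruct Hu as [Hp _].
  assert (HS : Ccont (fun t => circle r t * p (circle r t))%C).
  { apply Ccont_mult. apply Ccont_circle. apply (Ccont_holomorphic p dp); auto. lra. }
  destruct k as [|k].
  { simpl INR. rewrite (Cint_ext _ (fun t => circle r t * p (circle r t))%C) by (intros; simpl; ring).
    rewrite (mean_value (fun z => z * p z)%C _ r (holomorphic_mul_id p dp Hp)) by auto. ring. }
  assert (HE := Ccont_pow _ (S k) Ccont_ecirc).
  assert (N : Cint (fun t => Cconj (circle r t * p (circle r t)) * ecirc t ^ S k)%C = 0%C).
  { rewrite (Cint_ext _ (fun t => Cconj (circle r t * p (circle r t) * Cconj (ecirc t) ^ S k))%C).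
    - rewrite Cint_conj.
      + rewrite (negative_coefficient (fun z => z * p z)%C _ r (S k) (holomorphic_mul_id p dp Hp))
          by (auto; lia).
        unfold Cconj, RtoC; simpl. f_equal; ring.
      + apply (Ccont_mult (fun t => circle r t * p (circle r t))%C); auto.
        apply (Ccont_pow (fun t => Cconj (ecirc t))), Ccont_conj, Ccont_ecirc.
    - intros t. set (w := (circle r t * p (circle r t))%C).
      now rewrite Cmult_conj, Cpow_conj, Cconj_conj. }
  rewrite (Cint_ext _ (fun t => Cconj (circle r t * p (circle r t)) * ecirc t ^ S k
    + 2 * Ci * (Im (circle r t * p (circle r t))%C * ecirc t ^ S k))%C).
  - rewrite Cint_plus, N, Cint_scal, Cint_angular_derivative.
    + unfold fourier_coeff.
      replace (2 * Ci * (- Ci * INR (S k) * Cint (fun t => u (circle r t) * ecirc t ^ S k)))%C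
        with (- (Ci * Ci) * (2 * INR (S k) * Cint (fun t => u (circle r t) * ecirc t ^ S k)))%C by ring.
      replace (Ci * Ci)%C with (- (1))%C.
      2:{ unfold Ci, Cmult, Copp, RtoC; simpl. f_equal; ring. }
      field. auto.
    + apply (Ccont_mult (fun t => RtoC (Im (circle r t * p (circle r t))%C))); auto.
      apply Ccont_RtoC. apply HS.
    + apply (Ccont_mult (fun t => Cconj (circle r t * p (circle r t)))); auto.
      apply Ccont_conj; auto.
    + apply (Ccont_mult (fun _ => 2 * Ci)%C). apply Ccont_const.
      apply (Ccont_mult (fun t => RtoC (Im (circle r t * p (circle r t))%C))); auto.
      apply Ccont_RtoC. apply HS.
  - intros t. set (w := (circle r t * p (circle r t))%C).
    replace w with (Cconj w + 2 * Ci * Im w)%C at 1. ring.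
    destruct w as [a b]. unfold Ci, Cmult, Cplus, Cconj, RtoC; simpl. f_equal; ring.
Qed.

(** On the circle z p(z) e^(-it) is r p(z), so the case k = 1 reduces to the mean value of p. *)
Lemma fourier_coeff_1 : fourier_coeff u r 1 = (r * p 0)%C.
Proof.
  assert (HpiC : RtoC PI <> 0%C).
  { intros E. apply RtoC_inj in E. assert (Q := PI_RGT_0). lra. }
  assert (E := fourier_coeff_analytic 1). destruct Hu as [Hp _].
  rewrite (Cint_ext _ (fun t => r * p (circle r t))%C) in E.
  - rewrite Cint_scal, (mean_value p dp r Hp Hr) in E.
    + simpl INR in E.
      replace (fourier_coeff u r 1) with (/ (2 * PI) * (PI * (1 * fourier_coeff u r 1) * 2))%C.
      * rewrite <- E. field. auto.
      * field. auto.
    + apply (Ccont_holomorphic p dp); auto. lra.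
  - intros t. simpl Cpow. replace (circle r t * p (circle r t) * (ecirc t * 1))%C
      with ((circle r t * ecirc t) * p (circle r t))%C by ring.
    now rewrite circle_ecirc.
Qed.

Lemma gradient_series (z : C) : Cmod z < r ->
  exists B, 0 <= B /\ forall n,
    Cmod (z * p z - Csum (fun k => INR k * fourier_coeff u r k * (z / r) ^ k) n)%C
      <= B * (Cmod z / r) ^ n.
Proof.
  intros Hz. destruct Hu as [Hp _].
  assert (Hpi := PI_RGT_0).
  assert (HpiC : RtoC PI <> 0%C).
  { intros E. apply RtoC_inj in E. lra. }
  destruct (cauchy_series (fun z => z * p z)%C _ z r (holomorphic_mul_id p dp Hp)) as (B & B0 & HB).
  { lra. }
  exists (B / (2 * PI)). split. { apply Rdiv_le_0_compat; lra. }
  intros n. specialize (HB n).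
  replace (Csum (fun k => (z / r) ^ k * Cint (fun t => circle r t * p (circle r t) * ecirc t ^ k)) n)%C
    with (2 * PI * Csum (fun k => INR k * fourier_coeff u r k * (z / r) ^ k) n)%C in HB.
  2:{ clear HB. induction n as [|n IH]; simpl Csum. ring.
      rewrite Cmult_plus_distr_l, IH, fourier_coeff_analytic. ring. }
  replace (2 * PI * (z * p z) - 2 * PI * Csum (fun k => INR k * fourier_coeff u r k * (z / r) ^ k) n)%C
    with (RtoC (2 * PI) * (z * p z - Csum (fun k => INR k * fourier_coeff u r k * (z / r) ^ k) n))%C
    in HB by (rewrite RtoC_mult; ring).
  rewrite Cmod_Rscal in HB by lra.
  apply Rmult_le_reg_l with (2 * PI); [lra|].
  eapply Rle_trans. exact HB. right. field. lra.
Qed.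

End Coefficients.

(** * Bessel inequality *)

Lemma ecirc_conj (t : R) : (Cconj (ecirc t) * ecirc t)%C = 1%C.
Proof. unfold ecirc at 1. rewrite Cconj_conj. apply circle_ecirc. Qed.

Lemma Cint_conj_ecirc_pow (k : nat) : (0 < k)%nat -> Cint (fun t => Cconj (ecirc t) ^ k)%C = 0%C.
Proof.
  intros Hk. rewrite (Cint_ext _ (fun t => Cconj (ecirc t ^ k))%C).
  - rewrite Cint_conj, Cint_ecirc_pow by (auto; apply Ccont_pow, Ccont_ecirc).
    unfold Cconj, RtoC; simpl. f_equal. ring.
  - intros t. now rewrite Cpow_conj.
Qed.

Ltac ccont := repeat match goal with
  | |- Ccont (fun _ => ?c) => exact (Ccont_const c)
  | |- Ccont (fun t => (@?F t + @?G t)%C) => apply (Ccont_plus F G)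
  | |- Ccont (fun t => (@?F t * @?G t)%C) => apply (Ccont_mult F G)
  | |- Ccont (fun t => (@?F t ^ ?n)%C) => apply (Ccont_pow F n)
  | |- Ccont (fun t => Cconj (@?F t)) => apply (Ccont_conj F)
  | |- Ccont (fun t => ecirc t) => exact Ccont_ecirc
  | |- Ccont (fun t => RtoC (@?g t)) => apply (Ccont_RtoC g); assumption
  end.

(** The square of g minus its Fourier part at the frequencies j and k has a nonnegative integral.
    Two frequencies at once tie each higher coefficient to the linear part: the pairs used below are
    1 and k >= 2. *)
Lemma bessel (g : R -> R) (j k : nat) (a b : C) :
  (forall t, continuous g t) -> (0 < j < k)%nat ->
  Cint (fun t => g t * ecirc t ^ j)%C = (PI * a)%C ->
  Cint (fun t => g t * ecirc t ^ k)%C = (PI * b)%C ->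
  PI * (Cmod a ^ 2 + Cmod b ^ 2) <= RInt (fun t => g t ^ 2) 0 (2 * PI).
Proof.
  intros Hg Hjk Ha Hb. assert (Hpi := PI_RGT_0).
  assert (HE := Ccont_ecirc). assert (HgC := Ccont_RtoC g Hg).
  assert (Hconj : forall n c, Cint (fun t => g t * ecirc t ^ n)%C = (PI * c)%C ->
    Cint (fun t => g t * Cconj (ecirc t) ^ n)%C = (PI * Cconj c)%C).
  { intros n c H. rewrite (Cint_ext _ (fun t => Cconj (g t * ecirc t ^ n))%C).
    - rewrite Cint_conj, H, Cmult_conj by ccont. f_equal.
      unfold Cconj, RtoC; simpl. f_equal; ring.
    - intros t. rewrite Cmult_conj, Cpow_conj. f_equal.
      unfold Cconj, RtoC; simpl. f_equal; ring. }
  (* The Fourier part is Re W = (W + W')/2 with W' the conjugate of W. Written so, every product is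
     a combination of exponentials, and only those whose frequencies cancel survive integration. *)
  set (W := fun t => (a * Cconj (ecirc t) ^ j + b * Cconj (ecirc t) ^ k)%C).
  set (W' := fun t => (Cconj a * ecirc t ^ j + Cconj b * ecirc t ^ k)%C).
  assert (HW : Ccont W) by (unfold W; ccont).
  assert (HW' : Ccont W') by (unfold W'; ccont).
  assert (EW' : forall t, W' t = Cconj (W t)).
  { intros t. unfold W, W'. now rewrite Cplus_conj, !Cmult_conj, !Cpow_conj, Cconj_conj. }
  set (N := (a * Cconj a + b * Cconj b)%C).
  assert (I1 : Cint (fun t => g t * W t)%C = (PI * N)%C).
  { rewrite (Cint_ext _ (fun t => a * (g t * Cconj (ecirc t) ^ j) + b * (g t * Cconj (ecirc t) ^ k))%C).
    - rewrite Cint_plus, !Cint_scal, (Hconj j a), (Hconj k b) by (auto; ccont). unfold N. ring.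
    - intros t. unfold W. ring. }
  assert (I2 : Cint (fun t => g t * W' t)%C = (PI * N)%C).
  { rewrite (Cint_ext _ (fun t => Cconj a * (g t * ecirc t ^ j) + Cconj b * (g t * ecirc t ^ k))%C).
    - rewrite Cint_plus, !Cint_scal, Ha, Hb by (auto; ccont). unfold N. ring.
    - intros t. unfold W'. ring. }
  assert (I3 : Cint (fun t => W t * W t)%C = 0%C).
  { rewrite (Cint_ext _ (fun t => a * a * Cconj (ecirc t) ^ (j + j)
      + (2 * a * b * Cconj (ecirc t) ^ (j + k) + b * b * Cconj (ecirc t) ^ (k + k)))%C).
    - rewrite !Cint_plus, !Cint_scal, !Cint_conj_ecirc_pow by (auto; try lia; ccont). ring.
    - intros t. unfold W. rewrite !Cpow_add_r. ring. }
  assert (I4 : Cint (fun t => W' t * W' t)%C = 0%C).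
  { rewrite (Cint_ext _ (fun t => Cconj a * Cconj a * ecirc t ^ (j + j)
      + (2 * Cconj a * Cconj b * ecirc t ^ (j + k) + Cconj b * Cconj b * ecirc t ^ (k + k)))%C).
    - rewrite !Cint_plus, !Cint_scal, !Cint_ecirc_pow by (auto; try lia; ccont). ring.
    - intros t. unfold W'. rewrite !Cpow_add_r. ring. }
  assert (I5 : Cint (fun t => W t * W' t)%C = (2 * PI * N)%C).
  { rewrite (Cint_ext _ (fun t => N + (a * Cconj b * ecirc t ^ (k - j)
      + b * Cconj a * Cconj (ecirc t) ^ (k - j)))%C).
    - rewrite !Cint_plus, !Cint_scal, Cint_const, Cint_ecirc_pow, Cint_conj_ecirc_pow
        by (auto; try lia; ccont). ring.
    - intros t. unfold W, W', N. replace k with (j + (k - j))%nat at 1 2 by lia.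
      rewrite !Cpow_add_r.
      assert (Q : forall n, (Cconj (ecirc t) ^ n * ecirc t ^ n)%C = 1%C).
      { intros n. rewrite <- Cpow_mult_l, ecirc_conj. apply Cpow_1_l. }
      assert (Q1 := Q j). assert (Q2 := Q (k - j)%nat).
      set (x := (Cconj (ecirc t) ^ j)%C) in *. set (x' := (ecirc t ^ j)%C) in *.
      set (y := (Cconj (ecirc t) ^ (k - j))%C) in *. set (y' := (ecirc t ^ (k - j))%C) in *.
      transitivity ((x * x') * (a * Cconj a + a * Cconj b * y' + b * Cconj a * y)
        + b * Cconj b * ((x * x') * (y * y')))%C; [ring|].
      rewrite Q1, Q2. ring. }
  set (h := fun t => g t - Re (W t)).
  assert (Hh : forall t, continuous h t).
  { intros t. apply (continuous_minus g (fun t => Re (W t))).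
    apply Hg. exact (proj1 (HW t)). }
  assert (Hh2 : forall t, continuous (fun t => h t ^ 2) t).
  { intros t. apply (continuous_comp h (fun x => x ^ 2)); auto.
    apply continuity_pt_filterlim, derivable_continuous_pt, derivable_pt_pow. }
  assert (Hg2 : forall t, continuous (fun t => g t ^ 2) t).
  { intros t. apply (continuous_comp g (fun x => x ^ 2)); auto.
    apply continuity_pt_filterlim, derivable_continuous_pt, derivable_pt_pow. }
  assert (E : Cint (fun t => RtoC (h t ^ 2)) = (Cint (fun t => RtoC (g t ^ 2)%R) - PI * N)%C).
  { rewrite (Cint_ext _ (fun t => RtoC (g t ^ 2)%R + (- (1) * (g t * W t) + (- (1) * (g t * W' t)
      + (/ 4 * (W t * W t) + (/ 4 * (W' t * W' t) + / 2 * (W t * W' t))))))%C).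
    - assert (HgW : Ccont (fun t => g t * W t)%C) by now apply (Ccont_mult (fun t => RtoC (g t))).
      assert (HgW' : Ccont (fun t => g t * W' t)%C) by now apply (Ccont_mult (fun t => RtoC (g t))).
      assert (H1 : Ccont (fun t => W t * W t)%C) by now apply Ccont_mult.
      assert (H2 : Ccont (fun t => W t * W' t)%C) by now apply Ccont_mult.
      assert (H3 : Ccont (fun t => W' t * W' t)%C) by now apply Ccont_mult.
      rewrite !Cint_plus, !Cint_scal, I1, I2, I3, I4, I5
        by (auto; repeat first [assumption | progress ccont]).
      field.
    - intros t. rewrite EW'. unfold h. destruct (W t) as [x y].
      unfold Cmult, Cplus, Copp, Cconj, Cinv, RtoC; simpl. f_equal; field. }
  assert (E1 : RInt (fun t => h t ^ 2) 0 (2 * PI)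
    = RInt (fun t => g t ^ 2) 0 (2 * PI) - PI * (Cmod a ^ 2 + Cmod b ^ 2)).
  { apply (f_equal Re) in E.
    change (RInt (fun t => h t ^ 2) 0 (2 * PI)
      = Re (Cint (fun t => RtoC (g t ^ 2)%R) - PI * N)%C) in E.
    rewrite E, !Cmod_sqr.
    change (Re (Cint (fun t => RtoC (g t ^ 2)%R) - PI * N)%C)
      with (RInt (fun t => g t ^ 2) 0 (2 * PI) + - (PI * Re N - 0 * Im N)).
    unfold N. simpl. unfold Re, Im. ring. }
  assert (P : 0 <= RInt (fun t => h t ^ 2) 0 (2 * PI)).
  { apply RInt_ge_0. lra. apply (ex_RInt_continuous (V := R_CompleteNormedModule)); auto.
    intros t _. apply pow2_ge_0. }
  lra.
Qed.

Lemma fourier_coeff_bound (u v : C -> R) (p dp q dq : C -> C) (r M : R) (j k : nat) :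
  holomorphic_gradient u p dp -> holomorphic_gradient v q dq -> 0 < r < 1 ->
  (forall z, disk 1 z -> u z ^ 2 + v z ^ 2 <= M ^ 2) ->
  (0 < j < k)%nat ->
  (Cmod (fourier_coeff u r j) ^ 2 + Cmod (fourier_coeff v r j) ^ 2) +
  (Cmod (fourier_coeff u r k) ^ 2 + Cmod (fourier_coeff v r k) ^ 2) <= 2 * M ^ 2.
Proof.
  intros Hu Hv Hr HM Hjk. assert (Hpi := PI_RGT_0).
  assert (HpiC : RtoC PI <> 0%C).
  { intros E. apply RtoC_inj in E. lra. }
  assert (Hc : forall t, continuous (fun t => u (circle r t)) t).
  { intros t. apply (continuous_gradient_circle u p dp); auto. lra. }
  assert (Hc' : forall t, continuous (fun t => v (circle r t)) t).
  { intros t. apply (continuous_gradient_circle v q dq); auto. lra. }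
  assert (B1 := bessel (fun t => u (circle r t)) j k (fourier_coeff u r j)
    (fourier_coeff u r k) Hc Hjk).
  assert (B2 := bessel (fun t => v (circle r t)) j k (fourier_coeff v r j)
    (fourier_coeff v r k) Hc' Hjk).
  unfold fourier_coeff in B1 at 1 2, B2 at 1 2.
  specialize (B1 ltac:(field; auto) ltac:(field; auto)).
  specialize (B2 ltac:(field; auto) ltac:(field; auto)).
  assert (Hsq : forall g : R -> R, (forall t, continuous g t) ->
    ex_RInt (fun t => g t ^ 2) 0 (2 * PI)).
  { intros g Hg. apply (ex_RInt_continuous (V := R_CompleteNormedModule)). intros t _.
    apply (continuous_comp g (fun x => x ^ 2)); auto.
    apply continuity_pt_filterlim, derivable_continuous_pt, derivable_pt_pow. }
  assert (S : RInt (fun t => u (circle r t) ^ 2) 0 (2 * PI)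
            + RInt (fun t => v (circle r t) ^ 2) 0 (2 * PI) <= 2 * PI * M ^ 2).
  { rewrite <- (RInt_plus (V := R_CompleteNormedModule)
      (fun t => u (circle r t) ^ 2) (fun t => v (circle r t) ^ 2)).
    2,3: now apply (Hsq (fun t => _ (circle r t))).
    replace (2 * PI * M ^ 2) with (RInt (fun _ => M ^ 2) 0 (2 * PI)).
    2:{ rewrite RInt_const. unfold scal; simpl; unfold mult; simpl. ring. }
    apply RInt_le. lra.
    - apply (ex_RInt_plus (V := R_NormedModule) (fun t => u (circle r t) ^ 2)
       (fun t => v (circle r t) ^ 2)); now apply (Hsq (fun t => _ (circle r t))).
    - apply ex_RInt_const.
    - intros t _. apply (HM (circle r t)). unfold disk. rewrite Cmod_circle; lra. }
  apply Rmult_le_reg_l with PI; auto. lra.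
Qed.

(** * Bounds on the nonlinear part *)

(** Instances are [rot_im], which turns S_u and S_v into D(G), and the two coordinate projections,
    used for rigidity. Only additivity is asked because [rot_im] is not complex linear. *)
Definition additive_contraction (Phi : C -> C -> C) : Prop :=
  (forall x y x' y', Phi (x + x')%C (y + y')%C = (Phi x y + Phi x' y')%C) /\
  (forall x y, Cmod (Phi x y) ^ 2 <= Cmod x ^ 2 + Cmod y ^ 2).

(** The shift by 2 leaves out frequency 0, whose factor k is 0, and frequency 1, which is the linear
    part [p 0 * z]. *)
Definition tail_sum (X w : nat -> C) (n : nat) : C :=
  Csum (fun k => INR (k + 2) * X (k + 2)%nat * w (k + 2)%nat)%C n.

Lemma additive_contraction_bound (Phi : C -> C -> C) (x y w : C) (c : R) :
  additive_contraction Phi -> 0 <= c -> Cmod x ^ 2 + Cmod y ^ 2 <= c ^ 2 ->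
  Cmod (Phi (x * w)%C (y * w)%C) <= c * Cmod w.
Proof.
  intros [_ H] Hc Hxy. apply Rsqr_incr_0_var.
  - rewrite !Rsqr_pow2. eapply Rle_trans. apply H. rewrite !Cmod_mult, !Rpow_mult_distr.
    rewrite <- Rmult_plus_distr_r. apply Rmult_le_compat_r; auto. apply pow2_ge_0.
  - apply Rmult_le_pos; auto. apply Cmod_ge_0.
Qed.

Lemma tail_sum_bound (Phi : C -> C -> C) (X Y w : nat -> C) (c a theta : R) :
  additive_contraction Phi -> 0 <= c -> 0 <= a -> 0 <= theta < 1 ->
  (forall k, (2 <= k)%nat -> Cmod (X k) ^ 2 + Cmod (Y k) ^ 2 <= c ^ 2) ->
  (forall k, INR (k + 2) * Cmod (w (k + 2)%nat) <= a * theta ^ k) ->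
  forall n, Cmod (Phi (tail_sum X w n) (tail_sum Y w n)) <= c * (a / (1 - theta)).
Proof.
  intros HPhi Hc Ha Hth HXY Hw n.
  assert (E : Cmod (Phi (tail_sum X w n) (tail_sum Y w n))
     <= c * (a * (1 - theta ^ n) / (1 - theta))).
  { induction n as [|n IH].
    - unfold tail_sum; simpl.
      replace (Phi 0%C 0%C) with (RtoC 0).
      + rewrite Cmod_0. right. field. lra.
      + symmetry. apply Cmod_minus_eq_0.
        destruct HPhi as [_ H]. specialize (H 0%C 0%C). rewrite Cmod_0 in H.
        replace (Phi 0%C 0%C - 0)%C with (Phi 0%C 0%C) by ring.
        assert (P := Cmod_ge_0 (Phi 0%C 0%C)). nra.
    - unfold tail_sum in *. simpl Csum. rewrite (proj1 HPhi).
      eapply Rle_trans. apply Cmod_triangle.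
      eapply Rle_trans. apply Rplus_le_compat; [exact IH|].
      + rewrite (Cmult_comm (INR (n + 2)) (X _)), (Cmult_comm (INR (n + 2)) (Y _)).
        rewrite <- !Cmult_assoc.
        eapply (additive_contraction_bound Phi); [auto|exact Hc|apply HXY; lia].
      + rewrite Cmod_Rscal by apply pos_INR.
        apply Rle_trans with (c * (a * (1 - theta ^ n) / (1 - theta)) + c * (a * theta ^ n)).
        * apply Rplus_le_compat_l, Rmult_le_compat_l; auto.
        * right. simpl. field. lra. }
  eapply Rle_trans. exact E. apply Rmult_le_compat_l; auto.
  unfold Rdiv. apply Rmult_le_compat_r. left. apply Rinv_0_lt_compat. lra.
  assert (0 <= theta ^ n) by (apply pow_le; tauto). nra.
Qed.

Definition gradient_remainder (p : C -> C) (z : C) : C := (z * p z - p 0 * z)%C.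

Lemma gradient_remainder_series (u : C -> R) (p dp : C -> C) (r : R) (z : C) :
  holomorphic_gradient u p dp -> Cmod z < r < 1 ->
  exists B, 0 <= B /\ forall n,
    Cmod (gradient_remainder p z
      - tail_sum (fourier_coeff u r) (fun k => (z / r) ^ k)%C n)%C <= B * (Cmod z / r) ^ n.
Proof.
  intros Hu Hr. assert (P := Cmod_ge_0 z).
  destruct (gradient_series u p dp r Hu ltac:(lra) z ltac:(lra)) as (B & B0 & HB).
  assert (Hq : 0 <= Cmod z / r < 1).
  { split. apply Rdiv_le_0_compat; lra. apply Rlt_div_l; lra. }
  exists B. split; auto. intros n. specialize (HB (n + 2)%nat).
  replace (gradient_remainder p z - tail_sum (fourier_coeff u r) (fun k => (z / r) ^ k) n)%C
    with (z * p z - Csum (fun k => INR k * fourier_coeff u r k * (z / r) ^ k) (n + 2))%C.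
  - eapply Rle_trans. exact HB. apply Rmult_le_compat_l; auto.
    rewrite pow_add. rewrite <- (Rmult_1_r ((Cmod z / r) ^ n)) at 2.
    apply Rmult_le_compat_l. apply pow_le; tauto.
    simpl. nra.
  - clear HB. unfold gradient_remainder, tail_sum.
    assert (E : Csum (fun k => INR k * fourier_coeff u r k * (z / r) ^ k)%C (n + 2)
       = (p 0 * z + Csum (fun k => INR (k + 2) * fourier_coeff u r (k + 2) * (z / r) ^ (k + 2)) n)%C).
    { induction n as [|n IH].
      - simpl. rewrite (fourier_coeff_1 u p dp r Hu) by lra. field.
        intros E. apply RtoC_inj in E. lra.
      - change (S n + 2)%nat with (S (n + 2)). simpl Csum. rewrite IH. ring. }
    rewrite E. ring.
Qed.

Lemma tail_sum_comb (X a b : nat -> C) (s : R) (n : nat) :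
  tail_sum X (fun k => s * a k - b k)%C n = (s * tail_sum X a n - tail_sum X b n)%C.
Proof.
  unfold tail_sum. induction n as [|n IH]; simpl Csum; [ring|]. rewrite IH. ring.
Qed.

Lemma additive_contraction_minus (Phi : C -> C -> C) (x y x' y' : C) :
  additive_contraction Phi -> Phi (x - x')%C (y - y')%C = (Phi x y - Phi x' y')%C.
Proof.
  intros [H _].
  replace (Phi x y) with (Phi ((x - x') + x')%C ((y - y') + y')%C) by (f_equal; ring).
  rewrite H. ring.
Qed.

(** One estimate of s E(z) - E(w) for three purposes: s = 1 gives the Lipschitz constant, s = t with
    w = t z the radial defect, and s = 0 with w = z the size. The tail sums obey the bound uniformly
    in n, and the truncation error tends to 0. *)
Lemma remainder_combination_bound (Phi : C -> C -> C) (u v : C -> R) (p dp q dq : C -> C)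
    (r c a theta s : R) (z w : C) :
  additive_contraction Phi ->
  holomorphic_gradient u p dp -> holomorphic_gradient v q dq ->
  Cmod z < r < 1 -> Cmod w < r ->
  0 <= c -> 0 <= a -> 0 <= theta < 1 ->
  (forall k, (2 <= k)%nat ->
     Cmod (fourier_coeff u r k) ^ 2 + Cmod (fourier_coeff v r k) ^ 2 <= c ^ 2) ->
  (forall k, INR (k + 2) * Cmod (s * (z / r) ^ (k + 2) - (w / r) ^ (k + 2))%C <= a * theta ^ k) ->
  Cmod (Phi (s * gradient_remainder p z - gradient_remainder p w)%C
            (s * gradient_remainder q z - gradient_remainder q w)%C)
    <= c * (a / (1 - theta)).
Proof.
  intros HPhi Hu Hv Hz Hw Hc Ha Hth HXY Hk.
  assert (Pz := Cmod_ge_0 z). assert (Pw := Cmod_ge_0 w).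
  destruct (gradient_remainder_series u p dp r z Hu Hz) as (B1 & P1 & H1).
  destruct (gradient_remainder_series u p dp r w Hu ltac:(lra)) as (B2 & P2 & H2).
  destruct (gradient_remainder_series v q dq r z Hv Hz) as (B3 & P3 & H3).
  destruct (gradient_remainder_series v q dq r w Hv ltac:(lra)) as (B4 & P4 & H4).
  set (x := Rmax (Cmod z / r) (Cmod w / r)).
  assert (Hx : 0 <= x < 1).
  { split.
    - apply Rle_trans with (Cmod z / r); [apply Rdiv_le_0_compat; lra|apply Rmax_l].
    - apply Rmax_lub_lt; apply Rlt_div_l; lra. }
  assert (Hp : forall B y, 0 <= B -> 0 <= y <= x -> forall n, B * y ^ n <= B * x ^ n).
  { intros B y HB Hy n. apply Rmult_le_compat_l; auto. apply pow_incr; auto. }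
  assert (Hzx : 0 <= Cmod z / r <= x).
  { split. apply Rdiv_le_0_compat; lra. apply Rmax_l. }
  assert (Hwx : 0 <= Cmod w / r <= x).
  { split. apply Rdiv_le_0_compat; lra. apply Rmax_r. }
  set (L := Phi (s * gradient_remainder p z - gradient_remainder p w)%C
            (s * gradient_remainder q z - gradient_remainder q w)%C).
  assert (G : Cmod L - c * (a / (1 - theta)) <= 0).
  { apply (geometric_bound_eq_0 _ (Rabs s * B1 + B2 + (Rabs s * B3 + B4)) x Hx).
    intros n _.
    set (wk := fun k => (s * (z / r) ^ k - (w / r) ^ k)%C).
    assert (T := tail_sum_bound Phi (fourier_coeff u r) (fourier_coeff v r) wk
      c a theta HPhi Hc Ha Hth HXY Hk n).
    unfold wk in T. rewrite !tail_sum_comb in T.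
    set (e := fun X y => tail_sum X (fun k => (y / r) ^ k)%C n).
    set (T' := Phi (s * e (fourier_coeff u r) z - e (fourier_coeff u r) w)%C
                   (s * e (fourier_coeff v r) z - e (fourier_coeff v r) w)%C).
    change (Cmod T' <= c * (a / (1 - theta))) in T.
    specialize (H1 n). specialize (H2 n). specialize (H3 n). specialize (H4 n).
    fold (e (fourier_coeff u r) z) in H1. fold (e (fourier_coeff u r) w) in H2.
    fold (e (fourier_coeff v r) z) in H3. fold (e (fourier_coeff v r) w) in H4.
    assert (Q1 := Hp B1 _ P1 Hzx n). assert (Q2 := Hp B2 _ P2 Hwx n).
    assert (Q3 := Hp B3 _ P3 Hzx n). assert (Q4 := Hp B4 _ P4 Hwx n).
    assert (D : Cmod (L - T') <= (Rabs s * B1 + B2 + (Rabs s * B3 + B4)) * x ^ n).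
    { unfold L, T'. rewrite <- additive_contraction_minus by auto.
      set (X := (s * gradient_remainder p z - gradient_remainder p w
        - (s * e (fourier_coeff u r) z - e (fourier_coeff u r) w))%C).
      set (Y := (s * gradient_remainder q z - gradient_remainder q w
        - (s * e (fourier_coeff v r) z - e (fourier_coeff v r) w))%C).
      assert (DX : Cmod X <= Rabs s * Cmod (gradient_remainder p z - e (fourier_coeff u r) z)%C
         + Cmod (gradient_remainder p w - e (fourier_coeff u r) w)%C).
      { replace X with (s * (gradient_remainder p z - e (fourier_coeff u r) z)
          + - (gradient_remainder p w - e (fourier_coeff u r) w))%C by (unfold X; ring).
        eapply Rle_trans. apply Cmod_triangle. rewrite Cmod_opp, Cmod_mult, Cmod_R. lra. }
      assert (DY : Cmod Y <= Rabs s * Cmod (gradient_remainder q z - e (fourier_coeff v r) z)%C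
         + Cmod (gradient_remainder q w - e (fourier_coeff v r) w)%C).
      { replace Y with (s * (gradient_remainder q z - e (fourier_coeff v r) z)
          + - (gradient_remainder q w - e (fourier_coeff v r) w))%C by (unfold Y; ring).
        eapply Rle_trans. apply Cmod_triangle. rewrite Cmod_opp, Cmod_mult, Cmod_R. lra. }
      assert (F : Cmod (Phi X Y) <= Cmod X + Cmod Y).
      { assert (PX := Cmod_ge_0 X). assert (PY := Cmod_ge_0 Y).
        apply Rsqr_incr_0_var; [|lra]. rewrite Rsqr_pow2.
        eapply Rle_trans. apply (proj2 HPhi). unfold Rsqr. nra. }
      assert (PS := Rabs_pos s).
      assert (Rabs s * Cmod (gradient_remainder p z - e (fourier_coeff u r) z)%C
        <= Rabs s * (B1 * x ^ n)) by (apply Rmult_le_compat_l; lra).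
      assert (Rabs s * Cmod (gradient_remainder q z - e (fourier_coeff v r) z)%C
        <= Rabs s * (B3 * x ^ n)) by (apply Rmult_le_compat_l; lra).
      lra. }
    assert (D2 := Cmod_minus_ge L T'). lra. }
  lra.
Qed.

(** All three are equalities at k = 0, and the successive ratios of the left sides are largest
    there: 9/4, 3 and 3/2. With n = k + 2 the left sides are n^2, n (n - 1) and n, the factors in
    the Lipschitz, radial and size estimates. *)
Lemma geometric_dominates (k : nat) :
  (INR k + 2) ^ 2 <= 4 * (9 / 4) ^ k /\ (INR k + 2) * (INR k + 1) <= 2 * 3 ^ k /\
  INR k + 2 <= 2 * (3 / 2) ^ k.
Proof.
  induction k as [|k (H1 & H2 & H3)].
  - simpl. lra.
  - rewrite S_INR. assert (P := pos_INR k). simpl pow. repeat split; nra.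
Qed.

Lemma Cpow_minus_bound (z w : C) (q : R) (k : nat) :
  Cmod z <= q -> Cmod w <= q ->
  Cmod (z ^ S k - w ^ S k)%C <= (INR k + 1) * q ^ k * Cmod (z - w).
Proof.
  intros Hz Hw. assert (Pz := Cmod_ge_0 z).
  induction k as [|k IH].
  - simpl. replace (z * 1 - w * 1)%C with (z - w)%C by ring. lra.
  - replace (z ^ S (S k) - w ^ S (S k))%C
      with (z * (z ^ S k - w ^ S k) + w ^ S k * (z - w))%C by (simpl; ring).
    eapply Rle_trans. apply Cmod_triangle. rewrite !Cmod_mult, Cmod_pow, S_INR.
    assert (Pw := Cmod_ge_0 w). assert (Pd := Cmod_ge_0 (z - w)).
    assert (A1 : Cmod z * Cmod (z ^ S k - w ^ S k)%C
      <= q * ((INR k + 1) * q ^ k * Cmod (z - w))).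
    { apply Rmult_le_compat; auto. apply Cmod_ge_0. }
    assert (A2 : Cmod w ^ S k * Cmod (z - w) <= q ^ S k * Cmod (z - w)).
    { apply Rmult_le_compat_r; auto. apply pow_incr; lra. }
    simpl pow in *. lra.
Qed.

(** t - t^(k+2) = t (1 - t)(1 + t + ... + t^k); the factor t (1 - t) is the one the injectivity
    argument absorbs. *)
Lemma pow_defect_bound (t : R) (k : nat) :
  0 <= t <= 1 -> 0 <= t - t ^ S (S k) <= (INR k + 1) * (t * (1 - t)).
Proof.
  intros Ht. induction k as [|k IH].
  - simpl. nra.
  - assert (P : 0 <= t ^ k <= 1).
    { split. apply pow_le; tauto. rewrite <- (pow1 k). apply pow_incr; auto. }
    rewrite S_INR. simpl pow in *.
    assert (0 <= t * (t * t ^ k) * (1 - t) <= t * (1 - t)).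
    { assert (0 <= t * (1 - t)) by nra. split.
      - replace (t * (t * t ^ k) * (1 - t)) with (t * (1 - t) * (t * t ^ k)) by ring.
        apply Rmult_le_pos; nra.
      - replace (t * (t * t ^ k) * (1 - t)) with (t * (1 - t) * (t * t ^ k)) by ring.
        rewrite <- (Rmult_1_r (t * (1 - t))) at 2. apply Rmult_le_compat_l; nra. }
    lra.
Qed.

(* In the notation of the header, [D(G) = rot_im S_u S_v]. *)
Definition rot_im (x y : C) : C := (- Im y, Im x).

Lemma rot_im_additive_contraction : additive_contraction rot_im.
Proof.
  split.
  - intros [a b] [c d] [a' b'] [c' d']. unfold rot_im, Cplus; simpl. f_equal; ring.
  - intros x y. rewrite !Cmod_sqr. unfold rot_im; simpl.
    assert (H := pow2_ge_0 (Re x)). assert (H' := pow2_ge_0 (Re y)). simpl in *. lra.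
Qed.

Lemma rot_im_comb (x y x' y' : C) (s : R) :
  rot_im (s * x - x')%C (s * y - y')%C = (s * rot_im x y - rot_im x' y')%C.
Proof.
  destruct x, y, x', y'. unfold rot_im, Cminus, Cplus, Copp, Cmult, RtoC; simpl. f_equal; ring.
Qed.

Lemma sqrt2_bound : 0 <= sqrt 2 <= 14143 / 10000.
Proof.
  split. apply sqrt_pos.
  rewrite <- (sqrt_square (14143 / 10000)) by lra. apply sqrt_le_1; lra.
Qed.

Section Remainder.

Context (u v : C -> R) (p dp q dq : C -> C) (M rho : R).
Context (Hu : holomorphic_gradient u p dp) (Hv : holomorphic_gradient v q dq).
Context (HM0 : 0 <= M) (HM : forall z, disk 1 z -> u z ^ 2 + v z ^ 2 <= M ^ 2).
Context (Hrho : 0 < rho <= 1 / 18).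

(* A radius close enough to 1 to keep the constants 7, 7/2 and 16/5 below. *)
Let r : R := 99 / 100.
Let x : R := rho / r.

Let E (z : C) : C := rot_im (gradient_remainder p z) (gradient_remainder q z).

Lemma fourier_coeff_single_bound (k : nat) : (2 <= k)%nat ->
  Cmod (fourier_coeff u r k) ^ 2 + Cmod (fourier_coeff v r k) ^ 2 <= (sqrt 2 * M) ^ 2.
Proof.
  intros Hk.
  assert (H := fourier_coeff_bound u v p dp q dq r M 1 k Hu Hv ltac:(unfold r; lra) HM ltac:(lia)).
  rewrite Rpow_mult_distr, pow2_sqrt by lra.
  assert (P := pow2_ge_0 (Cmod (fourier_coeff u r 1))).
  assert (P' := pow2_ge_0 (Cmod (fourier_coeff v r 1))). lra.
Qed.

Lemma Cmod_div_r (z : C) : Cmod (z / r) = Cmod z / r.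
Proof.
  rewrite Cmod_div. rewrite Cmod_R, Rabs_pos_eq; auto. unfold r; lra.
  intros H. apply RtoC_inj in H. unfold r in H; lra.
Qed.

Lemma Cmod_div_r_le (z : C) : Cmod z <= rho -> Cmod (z / r) <= x.
Proof.
  intros H. rewrite Cmod_div_r. unfold x, Rdiv. apply Rmult_le_compat_r; auto.
  unfold r; lra.
Qed.

Lemma x_bound : 0 < x <= 562 / 10000.
Proof. unfold x, r. lra. Qed.

(** Here kappa is a rational bound for 1/(1 - beta x) and 10000/9801 is 1/r^2. The three uses
    produce about 6.64, 3.47 and 3.15, rounded up to 7, 7/2 and 16/5. *)
Lemma geometric_constant (alpha beta gam D kappa : R) :
  0 <= alpha -> 0 <= D -> 0 < kappa -> 1 <= kappa * (1 - beta * x) ->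
  14143 / 10000 * alpha * kappa * (10000 / 9801) <= gam ->
  sqrt 2 * M * (alpha * x * (D / r) / (1 - beta * x)) <= gam * M * rho * D.
Proof.
  intros Ha HD Hk Hkx Hg. destruct sqrt2_bound as [S0 S1].
  assert (Hb : 0 < 1 - beta * x).
  { apply Rmult_lt_reg_l with kappa; auto. lra. }
  assert (Hinv : / (1 - beta * x) <= kappa).
  { apply Rmult_le_reg_r with (1 - beta * x); auto. rewrite Rinv_l; lra. }
  assert (HX : 0 <= M * rho * D) by (repeat apply Rmult_le_pos; lra).
  replace (sqrt 2 * M * (alpha * x * (D / r) / (1 - beta * x)))
    with (alpha * (10000 / 9801) * (M * rho * D) * (sqrt 2 * / (1 - beta * x)))
    by (unfold x, r in *; field; lra).
  apply Rle_trans with (alpha * (10000 / 9801) * (M * rho * D) * (14143 / 10000 * kappa)).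
  - apply Rmult_le_compat_l. apply Rmult_le_pos; lra.
    apply Rmult_le_compat; try lra. left; now apply Rinv_0_lt_compat.
  - nra.
Qed.

Lemma remainder_lipschitz (z w : C) :
  Cmod z <= rho -> Cmod w <= rho -> Cmod (E z - E w) <= 7 * M * rho * Cmod (z - w).
Proof.
  intros Hz Hw. assert (Px := x_bound). assert (Pir : 0 <= / r) by (unfold r; lra).
  assert (Pd := Cmod_ge_0 (z - w)).
  replace (E z - E w)%C with (1 * E z - E w)%C by ring.
  unfold E. rewrite <- rot_im_comb.
  eapply Rle_trans.
  - apply (remainder_combination_bound rot_im u v p dp q dq r (sqrt 2 * M)
      (4 * x * (Cmod (z - w) / r)) (9 / 4 * x) 1 z w); auto.
    + apply rot_im_additive_contraction.
    + unfold r; lra.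
    + unfold r; lra.
    + apply Rmult_le_pos; auto. apply sqrt_pos.
    + repeat apply Rmult_le_pos; lra.
    + lra.
    + apply fourier_coeff_single_bound.
    + intros k. replace (k + 2)%nat with (S (S k)) by lia.
      replace (1 * (z / r) ^ S (S k) - (w / r) ^ S (S k))%C
        with ((z / r) ^ S (S k) - (w / r) ^ S (S k))%C by ring.
      assert (B := Cpow_minus_bound _ _ x (S k) (Cmod_div_r_le z Hz) (Cmod_div_r_le w Hw)).
      replace (z / r - w / r)%C with ((z - w) / r)%C in B.
      2:{ unfold Cdiv. ring. }
      rewrite Cmod_div_r in B.
      destruct (geometric_dominates k) as [G _].
      rewrite !S_INR in *.
      assert (Pp : 0 <= x ^ k) by (apply pow_le; lra).
      assert (PD : 0 <= Cmod (z - w) / r) by (apply Rdiv_le_0_compat; unfold r; lra).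
      apply Rle_trans with ((INR k + 2) ^ 2 * (x * x ^ k * (Cmod (z - w) / r))).
      * assert (P := pos_INR k).
        replace ((INR k + 2) ^ 2 * (x * x ^ k * (Cmod (z - w) / r)))
          with ((INR k + 1 + 1) * ((INR k + 1 + 1) * x ^ S k * (Cmod (z - w) / r)))
          by (simpl; ring).
        apply Rmult_le_compat_l; lra.
      * rewrite Rpow_mult_distr.
        replace (4 * x * (Cmod (z - w) / r) * ((9 / 4) ^ k * x ^ k))
          with (4 * (9 / 4) ^ k * (x * x ^ k * (Cmod (z - w) / r))) by ring.
        apply Rmult_le_compat_r; auto. repeat apply Rmult_le_pos; lra.
  - apply geometric_constant with (kappa := 115 / 100); lra.
Qed.

Lemma remainder_radial_defect (t : R) (z : C) :
  0 <= t <= 1 -> Cmod z <= rho ->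
  Cmod (t * E z - E (t * z)%C) <= t * (1 - t) * (7 / 2 * M * rho) * Cmod z.
Proof.
  intros Ht Hz. assert (Px := x_bound). assert (Pir : 0 <= / r) by (unfold r; lra).
  assert (Pz := Cmod_ge_0 z).
  assert (Htt : 0 <= t * (1 - t)) by nra.
  assert (Htz : Cmod (t * z) <= rho).
  { rewrite Cmod_Rscal by tauto. nra. }
  unfold E. rewrite <- rot_im_comb.
  eapply Rle_trans.
  - apply (remainder_combination_bound rot_im u v p dp q dq r (sqrt 2 * M)
      (2 * x * (t * (1 - t) * Cmod z / r)) (3 * x) t z (t * z)%C); auto.
    + apply rot_im_additive_contraction.
    + unfold r; lra.
    + unfold r; lra.
    + apply Rmult_le_pos; auto. apply sqrt_pos.
    + repeat apply Rmult_le_pos; lra.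
    + lra.
    + apply fourier_coeff_single_bound.
    + intros k. replace (k + 2)%nat with (S (S k)) by lia.
      replace (t * z / r)%C with (t * (z / r))%C by (unfold Cdiv; ring).
      rewrite Cpow_mult_l.
      replace (t * (z / r) ^ S (S k) - t ^ S (S k) * (z / r) ^ S (S k))%C
        with (RtoC (t - t ^ S (S k)) * (z / r) ^ S (S k))%C
        by (rewrite RtoC_minus, RtoC_pow; ring).
      destruct (pow_defect_bound t k Ht) as [D0 D1].
      rewrite Cmod_Rscal, Cmod_pow by auto.
      destruct (geometric_dominates k) as (_ & G & _).
      rewrite !S_INR.
      assert (Pk := pos_INR k).
      assert (Q : Cmod (z / r) ^ S (S k) <= x * x ^ k * (Cmod z / r)).
      { rewrite Cmod_div_r. assert (B := Cmod_div_r_le z Hz). rewrite Cmod_div_r in B.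
        assert (PD : 0 <= Cmod z / r) by (apply Rdiv_le_0_compat; unfold r; lra).
        change ((Cmod z / r) ^ S (S k)) with (Cmod z / r * (Cmod z / r) ^ S k).
        rewrite Rmult_comm. apply Rmult_le_compat_r; auto.
        change (x * x ^ k) with (x ^ S k). apply pow_incr; auto. }
      assert (PQ : 0 <= Cmod (z / r) ^ S (S k)) by (apply pow_le, Cmod_ge_0).
      apply Rle_trans with ((INR k + 1 + 1) * ((INR k + 1) * (t * (1 - t)) * (x * x ^ k * (Cmod z / r)))).
      * apply Rmult_le_compat_l. lra. apply Rmult_le_compat; auto.
      * rewrite Rpow_mult_distr.
        replace ((INR k + 1 + 1) * ((INR k + 1) * (t * (1 - t)) * (x * x ^ k * (Cmod z / r))))
          with ((INR k + 2) * (INR k + 1) * (t * (1 - t) * (x * x ^ k * (Cmod z / r)))) by ring.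
        replace (2 * x * (t * (1 - t) * Cmod z / r) * (3 ^ k * x ^ k))
          with (2 * 3 ^ k * (t * (1 - t) * (x * x ^ k * (Cmod z / r)))) by (unfold Rdiv; ring).
        apply Rmult_le_compat_r; auto. apply Rmult_le_pos; auto. lra.
  - replace (t * (1 - t) * (7 / 2 * M * rho) * Cmod z)
      with (7 / 2 * M * rho * (t * (1 - t) * Cmod z)) by ring.
    apply geometric_constant with (kappa := 1203 / 1000); try lra.
    apply Rmult_le_pos; auto.
Qed.

Lemma remainder_size (z : C) :
  Cmod z <= rho -> Cmod (E z) <= 16 / 5 * M * rho * Cmod z.
Proof.
  intros Hz. assert (Px := x_bound). assert (Pir : 0 <= / r) by (unfold r; lra).
  assert (Pz := Cmod_ge_0 z).
  rewrite <- Cmod_opp.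
  replace (- E z)%C with (0 * E z - E z)%C by ring.
  unfold E. rewrite <- rot_im_comb.
  eapply Rle_trans.
  - apply (remainder_combination_bound rot_im u v p dp q dq r (sqrt 2 * M)
      (2 * x * (Cmod z / r)) (3 / 2 * x) 0 z z); auto.
    + apply rot_im_additive_contraction.
    + unfold r; lra.
    + unfold r; lra.
    + apply Rmult_le_pos; auto. apply sqrt_pos.
    + repeat apply Rmult_le_pos; lra.
    + lra.
    + apply fourier_coeff_single_bound.
    + intros k. replace (k + 2)%nat with (S (S k)) by lia.
      replace (0 * (z / r) ^ S (S k) - (z / r) ^ S (S k))%C
        with (- (z / r) ^ S (S k))%C by ring.
      rewrite Cmod_opp, Cmod_pow.
      destruct (geometric_dominates k) as (_ & _ & G).
      rewrite !S_INR.
      assert (Pk := pos_INR k).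
      assert (PD : 0 <= Cmod z / r) by (apply Rdiv_le_0_compat; unfold r; lra).
      assert (Q : Cmod (z / r) ^ S (S k) <= x * x ^ k * (Cmod z / r)).
      { rewrite Cmod_div_r. assert (B := Cmod_div_r_le z Hz). rewrite Cmod_div_r in B.
        change ((Cmod z / r) ^ S (S k)) with (Cmod z / r * (Cmod z / r) ^ S k).
        rewrite Rmult_comm. apply Rmult_le_compat_r; auto.
        change (x * x ^ k) with (x ^ S k). apply pow_incr; auto. }
      rewrite Rpow_mult_distr.
      assert (Pp : 0 <= x ^ k) by (apply pow_le; lra).
      apply Rle_trans with ((INR k + 2) * (x * x ^ k * (Cmod z / r))).
      * replace (INR k + 1 + 1) with (INR k + 2) by ring. apply Rmult_le_compat_l; lra.
      * replace (2 * x * (Cmod z / r) * ((3 / 2) ^ k * x ^ k))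
          with (2 * (3 / 2) ^ k * (x * x ^ k * (Cmod z / r))) by ring.
        apply Rmult_le_compat_r; auto. repeat apply Rmult_le_pos; lra.
  - apply geometric_constant with (kappa := 1093 / 1000); lra.
Qed.

End Remainder.

(** * The linear part and the extremal case *)

Definition linear_part (a b : C) (z : C) : C := rot_im (a * z)%C (b * z)%C.

Lemma linear_part_real_linear (a b : C) : real_linear (linear_part a b).
Proof.
  intros z w s. unfold linear_part.
  destruct a, b, z, w. unfold rot_im, Cminus, Cplus, Copp, Cmult, RtoC; simpl. f_equal; ring.
Qed.

(** For a = u_x - i u_y and b = v_x - i v_y this is the Jacobian u_x v_y - u_y v_x; it is also the
    determinant of [linear_part a b]. *)
Definition det (a b : C) : R := Im a * Re b - Re a * Im b.

Lemma linear_part_surjective (a b : C) : det a b = 1 ->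
  exists B, forall w, linear_part a b (B w) = w.
Proof.
  intros H.
  (* The adjugate matrix, which is the inverse since the determinant is 1. *)
  exists (fun w => (Re a * Re w + Re b * Im w, - Im a * Re w - Im b * Im w)).
  intros [x y]. destruct a as [a1 a2], b as [b1 b2]. unfold det in H.
  unfold linear_part, rot_im, Cmult; simpl in *. f_equal.
  - transitivity ((a2 * b1 - a1 * b2) * x); [ring|rewrite H; ring].
  - transitivity ((a2 * b1 - a1 * b2) * y); [ring|rewrite H; ring].
Qed.

Lemma linear_part_upper (a b z : C) :
  Cmod (linear_part a b z) <= sqrt (Cmod a ^ 2 + Cmod b ^ 2) * Cmod z.
Proof.
  assert (H := pow2_ge_0 (Cmod a)). assert (H' := pow2_ge_0 (Cmod b)).
  apply (additive_contraction_bound rot_im).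
  - apply rot_im_additive_contraction.
  - apply sqrt_pos.
  - rewrite pow2_sqrt; lra.
Qed.

(** The difference is a sum of two squares that vanish exactly under the Cauchy-Riemann equations;
    the equality case is what makes G conformal when M = 1. *)
Lemma det_le_energy (a b : C) : 2 * det a b <= Cmod a ^ 2 + Cmod b ^ 2.
Proof.
  rewrite !Cmod_sqr. unfold det.
  assert (H := pow2_ge_0 (Im a - Re b)). assert (H' := pow2_ge_0 (Re a + Im b)). lra.
Qed.

(* For a matrix of determinant 1 and squared Frobenius norm [N], [l] bounds the
   smaller eigenvalue of [A^T A] from below as soon as [l^2 - N l + 1 >= 0]. *)
Lemma linear_part_lower (a b z : C) (lam : R) :
  det a b = 1 -> 0 <= lam <= 1 ->
  lam ^ 2 * (Cmod a ^ 2 + Cmod b ^ 2) <= 1 + lam ^ 4 ->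
  lam * Cmod z <= Cmod (linear_part a b z).
Proof.
  intros Hdet Hlam HN. assert (HN2 := det_le_energy a b). rewrite Hdet in HN2.
  rewrite !Cmod_sqr in *.
  apply Rsqr_incr_0_var; [|apply Cmod_ge_0]. rewrite !Rsqr_pow2, Rpow_mult_distr, !Cmod_sqr.
  destruct a as [a1 a2], b as [b1 b2], z as [x y].
  unfold linear_part, rot_im, det, Cmult in *; cbn [Re Im fst snd] in *.
  set (l := lam ^ 2) in *.
  assert (Hl : 0 <= l <= 1).
  { unfold l. simpl. nra. }
  replace (lam ^ 4) with (l ^ 2) in HN by (unfold l; ring).
  set (al := b2 ^ 2 + a2 ^ 2 - l). set (ga := b1 ^ 2 + a1 ^ 2 - l).
  set (be := b1 * b2 + a1 * a2).
  assert (Hd : be ^ 2 <= al * ga).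
  { assert (S : (b2 ^ 2 + a2 ^ 2) * (b1 ^ 2 + a1 ^ 2) - be ^ 2 = 1).
    { transitivity ((a2 * b1 - a1 * b2) ^ 2). unfold be; ring. rewrite Hdet. ring. }
    unfold al, ga. lra. }
  assert (Hs : 0 <= al + ga) by (unfold al, ga; lra).
  assert (Hbe := pow2_ge_0 be).
  assert (Hal : 0 <= al) by nra. assert (Hga : 0 <= ga) by nra.
  assert (HQ : 0 <= al * x ^ 2 + 2 * be * (x * y) + ga * y ^ 2).
  { destruct (Req_dec al 0) as [E|E].
    - assert (Hb0 : be = 0) by (rewrite E in Hd; nra).
      rewrite E, Hb0. assert (H := pow2_ge_0 y). nra.
    - apply Rmult_le_reg_l with al; [lra|]. rewrite Rmult_0_r.
      replace (al * (al * x ^ 2 + 2 * be * (x * y) + ga * y ^ 2))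
        with ((al * x + be * y) ^ 2 + (al * ga - be ^ 2) * y ^ 2) by ring.
      assert (H := pow2_ge_0 (al * x + be * y)). assert (H' := pow2_ge_0 y).
      apply Rplus_le_le_0_compat; auto. apply Rmult_le_pos; lra. }
  unfold al, ga, be in HQ. nra.
Qed.

(* The first branch of [lambda0]; in the second one it is still at least
   [0.88 * lambda0 M], which is enough. *)
Definition lambda_parseval (M : R) : R := sqrt 2 / (sqrt (M ^ 2 - 1) + sqrt (M ^ 2 + 1)).

(** Its square is M^2 - sqrt (M^4 - 1), the smaller root of l^2 - 2 M^2 l + 1 = 0. *)
Lemma lambda_parseval_spec (M : R) : 1 <= M ->
  0 < lambda_parseval M <= 1 /\ 1 + lambda_parseval M ^ 4 = 2 * M ^ 2 * lambda_parseval M ^ 2.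
Proof.
  intros HM. unfold lambda_parseval.
  set (s := sqrt (M ^ 2 - 1)). set (t := sqrt (M ^ 2 + 1)).
  assert (Hs : 0 <= s) by apply sqrt_pos.
  assert (Hs2 : s ^ 2 = M ^ 2 - 1) by (apply pow2_sqrt; nra).
  assert (Ht2 : t ^ 2 = M ^ 2 + 1) by (apply pow2_sqrt; nra).
  assert (H2 : sqrt 2 ^ 2 = 2) by (apply pow2_sqrt; lra).
  assert (H20 : 0 < sqrt 2) by (apply sqrt_lt_R0; lra).
  assert (Ht : sqrt 2 <= t) by (apply sqrt_le_1; nra).
  split; [split|].
  - apply Rdiv_lt_0_compat; lra.
  - apply Rle_div_l; lra.
  - assert (E : (sqrt 2 / (s + t)) ^ 2 = M ^ 2 - s * t).
    { unfold Rdiv. rewrite Rpow_mult_distr, H2, pow_inv.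
      apply Rmult_eq_reg_r with ((s + t) ^ 2); [|apply pow_nonzero; lra].
      rewrite Rmult_assoc, Rinv_l by (apply pow_nonzero; lra).
      replace ((M ^ 2 - s * t) * (s + t) ^ 2)
        with (M ^ 2 * (s ^ 2 + t ^ 2) + 2 * M ^ 2 * (s * t) - s * t * (s ^ 2 + t ^ 2) - 2 * (s ^ 2 * t ^ 2))
        by ring.
      rewrite Hs2, Ht2. ring. }
    replace ((sqrt 2 / (s + t)) ^ 4) with (((sqrt 2 / (s + t)) ^ 2) ^ 2) by ring.
    rewrite E. replace ((M ^ 2 - s * t) ^ 2)
      with (M ^ 4 - 2 * M ^ 2 * (s * t) + s ^ 2 * t ^ 2) by ring.
    rewrite Hs2, Ht2. ring.
Qed.

(** Replaces the passage to the limit r -> 1 in estimates on circles. *)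
Lemma le_of_le_near_1 (x y r0 : R) : r0 < 1 ->
  (forall r, r0 < r < 1 -> x <= y * (1 - r)) -> x <= 0.
Proof.
  intros Hr0 H. apply Rnot_lt_le. intros Hx.
  set (e := Rmin ((1 - r0) / 2) (x / (2 * (Rabs y + 1)))).
  assert (Py := Rabs_pos y).
  assert (He : 0 < e).
  { apply Rmin_pos. lra. apply Rdiv_lt_0_compat; lra. }
  assert (H1 : e <= (1 - r0) / 2) by apply Rmin_l.
  assert (H2 : e <= x / (2 * (Rabs y + 1))) by apply Rmin_r.
  specialize (H (1 - e) ltac:(lra)).
  replace (1 - (1 - e)) with e in H by ring.
  assert (H3 : y * e <= (Rabs y + 1) * e).
  { apply Rmult_le_compat_r. lra. assert (Q := Rle_abs y). lra. }
  assert (H4 : (Rabs y + 1) * e <= x / 2).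
  { apply Rmult_le_compat_l with (r := Rabs y + 1) in H2; [|lra].
    replace ((Rabs y + 1) * (x / (2 * (Rabs y + 1)))) with (x / 2) in H2 by (field; lra).
    exact H2. }
  lra.
Qed.

(** * Energy of the linear part and rigidity at its maximum *)

Section Rigidity.

Context (u v : C -> R) (p dp q dq : C -> C) (M : R).
Context (Hu : holomorphic_gradient u p dp) (Hv : holomorphic_gradient v q dq).
Context (HM0 : 0 <= M) (HM : forall z, disk 1 z -> u z ^ 2 + v z ^ 2 <= M ^ 2).

Let energy : R := Cmod (p 0) ^ 2 + Cmod (q 0) ^ 2.

Lemma fourier_coeff_energy (r : R) (k : nat) : 0 < r < 1 -> (2 <= k)%nat ->
  r ^ 2 * energy + (Cmod (fourier_coeff u r k) ^ 2 + Cmod (fourier_coeff v r k) ^ 2) <= 2 * M ^ 2.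
Proof.
  intros Hr Hk.
  assert (H := fourier_coeff_bound u v p dp q dq r M 1 k Hu Hv Hr HM ltac:(lia)).
  rewrite (fourier_coeff_1 u p dp r Hu Hr), (fourier_coeff_1 v q dq r Hv Hr) in H.
  rewrite !Cmod_Rscal, !Rpow_mult_distr in H by lra. unfold energy. lra.
Qed.

Lemma energy_bound : energy <= 2 * M ^ 2.
Proof.
  assert (P : 0 <= energy).
  { unfold energy. assert (H := pow2_ge_0 (Cmod (p 0))).
    assert (H' := pow2_ge_0 (Cmod (q 0))). lra. }
  enough (energy - 2 * M ^ 2 <= 0) by lra.
  (* energy - 2 M^2 <= energy (1 - r^2) <= 2 energy (1 - r). *)
  apply (le_of_le_near_1 _ (2 * energy) 0). lra.
  intros r Hr. assert (H := fourier_coeff_energy r 2 Hr (le_n _)).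
  assert (H1 := pow2_ge_0 (Cmod (fourier_coeff u r 2))).
  assert (H2 := pow2_ge_0 (Cmod (fourier_coeff v r 2))).
  assert (H3 := Rmult_le_pos _ _ P (pow2_ge_0 (1 - r))). lra.
Qed.

(** k x^k <= 1 + x + ... + x^(k-1); the induction runs on this finite form. *)
Lemma linear_powers_dominated (x : R) (k : nat) : 0 <= x < 1 ->
  INR k * x ^ k <= 1 / (1 - x).
Proof.
  intros Hx. apply (Rle_div_r _ 1 (1 - x)); [lra|].
  enough (H : INR k * x ^ k * (1 - x) <= 1 - x ^ k).
  { assert (0 <= x ^ k) by (apply pow_le; tauto). lra. }
  induction k as [|k IH]; [simpl; lra|].
  rewrite S_INR. simpl pow.
  assert (P : 0 <= x ^ k) by (apply pow_le; tauto).
  assert (x * (x ^ k * (1 - x)) <= x ^ k * (1 - x)).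
  { rewrite <- (Rmult_1_l (x ^ k * (1 - x))) at 2. apply Rmult_le_compat_r; [|lra].
    apply Rmult_le_pos; auto; lra. }
  assert (PK := pos_INR k).
  assert (x * (INR k * x ^ k * (1 - x)) <= INR k * x ^ k * (1 - x)).
  { rewrite <- (Rmult_1_l (INR k * x ^ k * (1 - x))) at 2. apply Rmult_le_compat_r; [|lra].
    apply Rmult_le_pos; [apply Rmult_le_pos; auto|lra]. }
  assert (x * (x ^ k * (1 - x)) <= x ^ k * (1 - x)).
  { rewrite <- (Rmult_1_l (x ^ k * (1 - x))) at 2. apply Rmult_le_compat_r; [|lra].
    apply Rmult_le_pos; auto; lra. }
  lra.
Qed.

(** At maximal energy the circle of radius r leaves at most 2 M^2 (1 - r^2) for any higher
    frequency, which tends to 0 as r -> 1. Squares are compared so that the bound becomes linear in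
    1 - r. *)
Lemma remainder_rigid (Phi : C -> C -> C) (z : C) :
  additive_contraction Phi -> energy = 2 * M ^ 2 -> disk 1 z ->
  Phi (gradient_remainder p z) (gradient_remainder q z) = 0%C.
Proof.
  intros HPhi HE Hz. unfold disk in Hz. assert (Pz := Cmod_ge_0 z).
  set (L := Phi (gradient_remainder p z) (gradient_remainder q z)).
  assert (HL : L = (- (Phi (0 * gradient_remainder p z - gradient_remainder p z)
     (0 * gradient_remainder q z - gradient_remainder q z)))%C).
  { rewrite additive_contraction_minus by auto. fold L.
    replace (0 * gradient_remainder p z)%C with (0 - 0)%C by ring.
    replace (0 * gradient_remainder q z)%C with (0 - 0)%C by ring.
    rewrite additive_contraction_minus by auto. ring. }
  (* x bounds |z|/r for every r above (1 + |z|)/2. Its square root splits x^k into two equal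
     factors: one absorbs the coefficient k, the other yields a geometric series. *)
  set (x := 2 * Cmod z / (1 + Cmod z)).
  assert (Hx : 0 <= x < 1).
  { unfold x. split. apply Rdiv_le_0_compat; lra. apply Rlt_div_l; lra. }
  set (th := sqrt x).
  assert (Hth2 : th * th = x) by (apply sqrt_sqrt; tauto).
  assert (Hth : 0 <= th < 1).
  { split. apply sqrt_pos. assert (P : 0 <= th) by apply sqrt_pos. nra. }
  set (D := 1 / (1 - th) / (1 - th)).
  assert (HD : 0 <= D).
  { unfold D. repeat apply Rdiv_le_0_compat; lra. }
  apply Cmod_eq_0. apply Rle_antisym; [|apply Cmod_ge_0].
  apply Rsqr_incr_0_var; [|lra]. rewrite Rsqr_0.
  apply (le_of_le_near_1 _ (4 * M ^ 2 * D ^ 2) ((1 + Cmod z) / 2)). lra.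
  intros r Hr.
  set (c := M * sqrt (2 * (1 - r ^ 2))).
  assert (Hc0 : 0 <= c) by (apply Rmult_le_pos; auto; apply sqrt_pos).
  assert (Hc2 : c ^ 2 = 2 * M ^ 2 * (1 - r ^ 2)).
  { unfold c. rewrite Rpow_mult_distr, pow2_sqrt by nra. ring. }
  assert (B : Cmod L <= c * D).
  { rewrite HL, Cmod_opp.
    apply (remainder_combination_bound Phi u v p dp q dq r c (1 / (1 - th)) th 0 z z); auto.
    - lra.
    - lra.
    - apply Rdiv_le_0_compat; lra.
    - intros k Hk. assert (F := fourier_coeff_energy r k ltac:(lra) Hk).
      rewrite HE in F. lra.
    - intros k.
      replace (0 * (z / r) ^ (k + 2) - (z / r) ^ (k + 2))%C with (- (z / r) ^ (k + 2))%C by ring.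
      rewrite Cmod_opp, Cmod_pow, Cmod_div, Cmod_R, Rabs_pos_eq by
        (try (intros E; apply RtoC_inj in E); lra).
      assert (Q : Cmod z / r <= x).
      { unfold x. apply Rle_div_l; [lra|].
        replace (2 * Cmod z / (1 + Cmod z) * r) with (Cmod z * (r / ((1 + Cmod z) / 2)))
          by (field; lra).
        rewrite <- (Rmult_1_r (Cmod z)) at 1. apply Rmult_le_compat_l; auto.
        apply Rle_div_r; lra. }
      assert (Q2 : (Cmod z / r) ^ (k + 2) <= th ^ (k + 2) * th ^ (k + 2)).
      { rewrite <- Rpow_mult_distr, Hth2. apply pow_incr. split; auto.
        apply Rdiv_le_0_compat; lra. }
      assert (Q3 := linear_powers_dominated th (k + 2) Hth).
      assert (Pk : 0 <= th ^ k <= 1).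
      { split. apply pow_le; tauto. rewrite <- (pow1 k). apply pow_incr; lra. }
      assert (Q4 : th ^ (k + 2) <= th ^ k).
      { rewrite pow_add. simpl. nra. }
      assert (PI := pos_INR (k + 2)).
      assert (P2 : 0 <= th ^ (k + 2)) by (apply pow_le; tauto).
      apply Rle_trans with (INR (k + 2) * th ^ (k + 2) * th ^ (k + 2)).
      + rewrite Rmult_assoc. apply Rmult_le_compat_l; auto.
      + apply Rmult_le_compat; auto. apply Rmult_le_pos; auto. }
  apply Rle_trans with ((c * D) ^ 2).
  - rewrite Rsqr_pow2. apply pow_incr. split; auto. apply Cmod_ge_0.
  - rewrite Rpow_mult_distr, Hc2.
    assert (PM := pow2_ge_0 M). assert (PD := pow2_ge_0 D).
    replace (4 * M ^ 2 * D ^ 2 * (1 - r)) with (2 * M ^ 2 * (2 * (1 - r)) * D ^ 2) by ring.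
    apply Rmult_le_compat_r; auto. apply Rmult_le_compat_l; nra.
Qed.

End Rigidity.

(** Along the segment from 0 to z one has p(s z) z = p(0) z, so u(s z) - s Re (p(0) z) has
    derivative 0. For s > 0 this follows on dividing the vanishing remainder by s; at s = 0 it is
    trivial. *)
Lemma linear_of_gradient_remainder_0 (u : C -> R) (p dp : C -> C) :
  holomorphic_gradient u p dp -> (forall z, disk 1 z -> gradient_remainder p z = 0%C) ->
  u 0%C = 0 -> forall z, disk 1 z -> u z = Re (p 0 * z)%C.
Proof.
  intros Hu H0 Hu0 z Hz. destruct z as [x y].
  set (c := Re (p 0 * (x, y))%C).
  assert (Hd : forall s, 0 <= s <= 1 -> disk 1 (s * x, s * y)).
  { intros s Hs. unfold disk in *.
    replace (s * x, s * y) with (s * (x, y))%C.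
    2:{ unfold Cmult, RtoC; simpl. f_equal; ring. }
    rewrite Cmod_Rscal by tauto. assert (P := Cmod_ge_0 (x, y)). nra. }
  assert (D : forall s, 0 <= s <= 1 -> is_derive (fun s => u (s * x, s * y) - c * s) s 0).
  { intros s Hs.
    assert (D1 := is_derive_gradient_path u p dp (fun s => s * x) (fun s => s * y) s x y Hu (Hd s Hs)).
    set (w := (s * x, s * y) : C) in *.
    assert (Ew : w = (s * (x, y))%C).
    { unfold w, Cmult, RtoC; simpl. f_equal; ring. }
    assert (E : (p w * (x, y) = p 0 * (x, y))%C).
    { destruct (Req_dec s 0) as [E0|Hs0].
      - rewrite Ew, E0. now rewrite Cmult_0_l.
      - assert (Hsc : RtoC s <> 0%C) by (intros F; apply Hs0; now apply RtoC_inj).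
        assert (R0 := H0 _ (Hd s Hs)). fold w in R0. unfold gradient_remainder in R0.
        replace (p w * (x, y))%C with (/ s * ((w * p w - p 0 * w) + p 0 * w))%C.
        + rewrite R0, Ew. field; auto.
        + rewrite Ew at 1 3 4. field; auto. }
    replace 0 with (Re (p w * (x, y))%C - c * 1).
    - apply (is_derive_minus (V := R_NormedModule)).
      + apply D1; auto_derive; auto; ring.
      + apply (is_derive_scal (fun s => s)). apply (is_derive_id (K := R_AbsRing)).
    - rewrite E. unfold c. ring. }
  assert (E := eq_is_derive (fun s => u (s * x, s * y) - c * s) 0 1 D ltac:(lra)).
  cbv beta in E. rewrite !Rmult_0_l, !Rmult_1_l in E.
  change (0, 0) with (RtoC 0) in E. rewrite Hu0 in E. fold c. lra.
Qed.

(** * Harmonic mappings and the operator D *)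

Lemma disk_locally_2d (x y : R) : disk 1 (x, y) -> locally_2d (fun u v => disk 1 (u, v)) x y.
Proof.
  intros H. apply locally_2d_locally.
  apply filter_imp with (P := fun z : C => Cmod z < 1).
  - intros [a b]. auto.
  - apply (open_preimage_lt _ 1 continuous_Cmod). exact H.
Qed.

Lemma differentiable_of_partials (f : R -> R -> R) (x y : R) :
  locally_2d (fun u v => ex_derive (fun z => f z v) u) x y ->
  ex_derive (fun z => f x z) y ->
  continuity_2d_pt (fun u v => Derive (fun z => f z v) u) x y ->
  differentiable_pt_lim f x y (Derive (fun z => f z y) x) (Derive (fun z => f x z) y).
Proof.
  intros Hx Hy Hc. apply filterdiff_differentiable_pt_lim.
  eapply filterdiff_ext_lin.
  - apply (is_derive_filterdiff f x y (fun u v => Derive (fun z => f z v) u)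
      (Derive (fun z => f x z) y)).
    + apply locally_2d_locally in Hx. eapply filter_imp; [|exact Hx].
      intros [u v] H. now apply Derive_correct.
    + now apply Derive_correct.
    + apply continuity_2d_pt_filterlim in Hc. exact Hc.
  - intros [u v]. reflexivity.
Qed.

Section RealHarmonic.

Context (f : R -> R -> R).

Let fx (x y : R) : R := Derive (fun t => f t y) x.
Let fy (x y : R) : R := Derive (fun t => f x t) y.
Let fxx (x y : R) : R := Derive (fun t => fx t y) x.
Let fxy (x y : R) : R := Derive (fun t => fx x t) y.
Let fyx (x y : R) : R := Derive (fun t => fy t y) x.
Let fyy (x y : R) : R := Derive (fun t => fy x t) y.

Definition complex_gradient (z : C) : C := (fx (Re z) (Im z), - fy (Re z) (Im z)).

Lemma mixed_partials (x y : R) :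
  (forall x y, disk 1 (x, y) -> ex_diff_n f 2 x y) -> disk 1 (x, y) -> fyx x y = fxy x y.
Proof.
  intros Hf Hd.
  destruct (Hf x y Hd) as (C0 & X1 & Y1 & (C1 & X2 & Y2 & (C2 & _) & (C3 & _))
    & (C4 & X5 & Y5 & (C6 & _) & (C7 & _))).
  apply (Schwarz f); auto.
  eapply locally_2d_impl; [|exact (disk_locally_2d x y Hd)].
  apply locally_2d_forall. intros a b Hab.
  destruct (Hf a b Hab) as (_ & X1' & Y1' & (_ & X2' & Y2' & _) & (_ & X5' & Y5' & _)).
  auto.
Qed.

(** The Cauchy-Riemann equations for u_x - i u_y are Laplace's equation and the symmetry of mixed
    partials. *)
Lemma harmonic_holomorphic_gradient :
  (forall x y, disk 1 (x, y) -> ex_diff_n f 2 x y) ->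
  (forall x y, disk 1 (x, y) -> fxx x y + fyy x y = 0) ->
  holomorphic_gradient (fun z => f (Re z) (Im z)) complex_gradient
    (fun z => (fxx (Re z) (Im z), - fxy (Re z) (Im z))).
Proof.
  intros Hf HL. split.
  - intros x y Hd.
    destruct (Hf x y Hd) as (C0 & X1 & Y1 & (C1 & X2 & Y2 & (C2 & _) & (C3 & _))
      & (C4 & X5 & Y5 & (C6 & _) & (C7 & _))).
    assert (Hloc := disk_locally_2d x y Hd).
    cbn [Re Im fst snd complex_gradient].
    split; [|split; [|split]].
    + rewrite Ropp_involutive. apply (differentiable_of_partials fx); auto.
      eapply locally_2d_impl; [|exact Hloc]. apply locally_2d_forall. intros a b Hab.
      apply (Hf a b Hab).
    + assert (Hfyy : fxx x y = - fyy x y) by (assert (H := HL x y Hd); lra).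
      rewrite Hfyy, <- mixed_partials by auto.
      apply differentiable_pt_lim_opp. apply (differentiable_of_partials fy); auto.
      eapply locally_2d_impl; [|exact Hloc]. apply locally_2d_forall. intros a b Hab.
      apply (Hf a b Hab).
    + exact C2.
    + apply continuity_2d_pt_opp. exact C3.
  - intros x y Hd. destruct (Hf x y Hd) as (C0 & X1 & Y1 & (C1 & _) & _).
    cbn [Re Im fst snd complex_gradient]. rewrite Ropp_involutive.
    apply (differentiable_of_partials f); auto.
    eapply locally_2d_impl; [|exact (disk_locally_2d x y Hd)].
    apply locally_2d_forall. intros a b Hab. apply (Hf a b Hab).
Qed.

End RealHarmonic.

Definition re_part (G : C -> C) (x y : R) : R := Re (G (x, y)).
Definition im_part (G : C -> C) (x y : R) : R := Im (G (x, y)).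

Lemma dzbar_parts (G : C -> C) (x y : R) :
  dzbar G (x, y) =
   ((Derive (fun t => re_part G t y) x - Derive (fun t => im_part G x t) y) / 2,
    (Derive (fun t => im_part G t y) x + Derive (fun t => re_part G x t) y) / 2).
Proof.
  unfold dzbar, dx, dy, re_part, im_part, Ci, Cdiv, Cmult, Cplus, Cinv, RtoC; simpl. f_equal; field.
Qed.

Lemma dz_parts (G : C -> C) (x y : R) :
  dz G (x, y) =
   ((Derive (fun t => re_part G t y) x + Derive (fun t => im_part G x t) y) / 2,
    (Derive (fun t => im_part G t y) x - Derive (fun t => re_part G x t) y) / 2).
Proof.
  unfold dz, dx, dy, re_part, im_part, Ci, Cdiv, Cmult, Cminus, Copp, Cplus, Cinv, RtoC; simpl.
  f_equal; field.
Qed.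

Lemma Derive_half_minus (g h : R -> R) (x : R) : ex_derive g x -> ex_derive h x ->
  Derive (fun t => (g t - h t) / 2) x = (Derive g x - Derive h x) / 2.
Proof.
  intros Hg Hh. apply is_derive_unique.
  auto_derive; auto. change (fun x0 : R => g x0) with g. change (fun x0 : R => h x0) with h. field.
Qed.

Lemma Derive_half_plus (g h : R -> R) (x : R) : ex_derive g x -> ex_derive h x ->
  Derive (fun t => (g t + h t) / 2) x = (Derive g x + Derive h x) / 2.
Proof.
  intros Hg Hh. apply is_derive_unique.
  auto_derive; auto. change (fun x0 : R => g x0) with g. change (fun x0 : R => h x0) with h. field.
Qed.

(** The real part of 4 dz dzbar G is u_xx + u_yy + v_xy - v_yx, and similarly for the imaginary
    part; the mixed terms cancel by Schwarz. *)
Lemma harmonic_parts (G : C -> C) : harmonic G ->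
  (forall x y, disk 1 (x, y) -> ex_diff_n (re_part G) 2 x y /\ ex_diff_n (im_part G) 2 x y) /\
  (forall x y, disk 1 (x, y) ->
    Derive (fun s => Derive (fun t => re_part G t y) s) x
     + Derive (fun s => Derive (fun t => re_part G x t) s) y = 0 /\
    Derive (fun s => Derive (fun t => im_part G t y) s) x
     + Derive (fun s => Derive (fun t => im_part G x t) s) y = 0).
Proof.
  intros [HC HL].
  assert (HD : forall x y, disk 1 (x, y) ->
    ex_diff_n (re_part G) 2 x y /\ ex_diff_n (im_part G) 2 x y).
  { intros x y Hd. exact (HC (x, y) Hd). }
  split; auto.
  intros x y Hd. specialize (HL (x, y) Hd).
  change (Nat.iter 1 laplacian G (x, y)) with (4 * dz (dzbar G) (x, y))%C in HL.
  rewrite dz_parts in HL.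
  destruct (HD x y Hd) as [(_ & _ & _ & (_ & X2 & Y2 & _) & (_ & X5 & Y5 & _))
    (_ & _ & _ & (_ & X2' & Y2' & _) & (_ & X5' & Y5' & _))].
  assert (M1 := mixed_partials (re_part G) x y (fun a b H => proj1 (HD a b H)) Hd).
  assert (M2 := mixed_partials (im_part G) x y (fun a b H => proj2 (HD a b H)) Hd).
  unfold re_part at 1 2, im_part at 1 2 in HL.
  (* [dzbar_parts] holds at every point, [Derive] being total, so plain extensionality applies. *)
  rewrite (Derive_ext (fun t => Re (dzbar G (t, y))) (fun t =>
    (Derive (fun s => re_part G s y) t - Derive (fun s => im_part G t s) y) / 2)) in HL
    by (intros; now rewrite dzbar_parts).
  rewrite (Derive_ext (fun t => Im (dzbar G (t, y))) (fun t =>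
    (Derive (fun s => im_part G s y) t + Derive (fun s => re_part G t s) y) / 2)) in HL
    by (intros; now rewrite dzbar_parts).
  rewrite (Derive_ext (fun t => Re (dzbar G (x, t))) (fun t =>
    (Derive (fun s => re_part G s t) x - Derive (fun s => im_part G x s) t) / 2)) in HL
    by (intros; now rewrite dzbar_parts).
  rewrite (Derive_ext (fun t => Im (dzbar G (x, t))) (fun t =>
    (Derive (fun s => im_part G s t) x + Derive (fun s => re_part G x s) t) / 2)) in HL
    by (intros; now rewrite dzbar_parts).
  rewrite !Derive_half_minus, !Derive_half_plus in HL by auto.
  unfold Cmult, RtoC in HL; simpl in HL. injection HL as H1 H2.
  change (Derive (fun t => Derive (fun s => re_part G t s) y) x
    = Derive (fun t => Derive (fun s => re_part G s t) x) y) in M1.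
  change (Derive (fun t => Derive (fun s => im_part G t s) y) x
    = Derive (fun t => Derive (fun s => im_part G s t) x) y) in M2.
  change (Derive (Derive (fun t => re_part G t y)) x + Derive (Derive (fun t => re_part G x t)) y = 0
    /\ Derive (Derive (fun t => im_part G t y)) x + Derive (Derive (fun t => im_part G x t)) y = 0).
  lra.
Qed.

Lemma jacobian_det (G : C -> C) :
  jacobian G 0%C = det (complex_gradient (re_part G) 0%C) (complex_gradient (im_part G) 0%C).
Proof.
  unfold jacobian. rewrite !Cmod_sqr. change (RtoC 0) with ((0, 0) : C).
  rewrite dz_parts, dzbar_parts. unfold det, complex_gradient; simpl. field.
Qed.

Lemma Cmod_pow_double (x y : R) (m : nat) : Cmod (x, y) ^ (2 * m) = (x ^ 2 + y ^ 2) ^ m.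
Proof. rewrite pow_mult, Cmod_sqr. reflexivity. Qed.

Lemma locally_disk_fst (x y : R) : disk 1 (x, y) -> locally x (fun t => disk 1 (t, y)).
Proof. intros H. apply (locally_2d_1d_const_y (fun u v => disk 1 (u, v))), disk_locally_2d, H. Qed.

Lemma locally_disk_snd (x y : R) : disk 1 (x, y) -> locally y (fun t => disk 1 (x, t)).
Proof. intros H. apply (locally_2d_1d_const_x (fun u v => disk 1 (u, v))), disk_locally_2d, H. Qed.

(* The weight [|z|^(2m)] is radial, so the angular derivative does not see it. *)
Lemma angular_derivative_weight (f g : R -> R -> R) (m : nat) (x y : R) :
  (forall x y, disk 1 (x, y) -> f x y = (x ^ 2 + y ^ 2) ^ m * g x y) -> disk 1 (x, y) ->
  ex_derive (fun t => g t y) x -> ex_derive (fun t => g x t) y ->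
  x * Derive (fun t => f x t) y - y * Derive (fun t => f t y) x
  = (x ^ 2 + y ^ 2) ^ m * (x * Derive (fun t => g x t) y - y * Derive (fun t => g t y) x).
Proof.
  intros Hf Hd Hx Hy.
  rewrite (Derive_ext_loc (fun t => f x t) (fun t => (x ^ 2 + t ^ 2) ^ m * g x t)).
  2:{ eapply filter_imp; [|exact (locally_disk_snd x y Hd)]. intros t Ht. auto. }
  rewrite (Derive_ext_loc (fun t => f t y) (fun t => (t ^ 2 + y ^ 2) ^ m * g t y)).
  2:{ eapply filter_imp; [|exact (locally_disk_fst x y Hd)]. intros t Ht. auto. }
  rewrite !Derive_mult; auto; try (auto_derive; auto; fail).
  assert (E1 : Derive (fun t => (x ^ 2 + t ^ 2) ^ m) y
    = INR m * (2 * y) * (x ^ 2 + y ^ 2) ^ pred m).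
  { apply is_derive_unique. auto_derive; auto. simpl. ring. }
  assert (E2 : Derive (fun t => (t ^ 2 + y ^ 2) ^ m) x
    = INR m * (2 * x) * (x ^ 2 + y ^ 2) ^ pred m).
  { apply is_derive_unique. auto_derive; auto. simpl. ring. }
  rewrite E1, E2. change (Derive (fun t => g x t) y) with (Derive (g x) y). ring.
Qed.

(** D is -i times the angular derivative. *)
Lemma Dop_parts (f : C -> C) (x y : R) :
  Dop f (x, y) =
   (x * Derive (fun t => im_part f x t) y - y * Derive (fun t => im_part f t y) x,
    - (x * Derive (fun t => re_part f x t) y - y * Derive (fun t => re_part f t y) x)).
Proof.
  unfold Dop. rewrite dz_parts, dzbar_parts.
  unfold Cconj, Cmult, Cminus, Copp, Cplus; simpl. f_equal; field.
Qed.

Lemma Dop_weighted (f G : C -> C) (m : nat) (z : C) :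
  harmonic G -> (forall z, disk 1 z -> f z = (RtoC (Cmod z ^ (2 * m)) * G z)%C) -> disk 1 z ->
  Dop f z = (RtoC (Cmod z ^ (2 * m)) *
    (linear_part (complex_gradient (re_part G) 0%C) (complex_gradient (im_part G) 0%C) z +
     rot_im (gradient_remainder (complex_gradient (re_part G)) z)
            (gradient_remainder (complex_gradient (im_part G)) z)))%C.
Proof.
  intros HG Hf Hd. destruct (harmonic_parts G HG) as [HD _].
  unfold linear_part. rewrite <- (proj1 rot_im_additive_contraction).
  unfold gradient_remainder.
  replace (complex_gradient (re_part G) 0 * z
     + (z * complex_gradient (re_part G) z - complex_gradient (re_part G) 0 * z))%C
    with (z * complex_gradient (re_part G) z)%C by ring.
  replace (complex_gradient (im_part G) 0 * z
     + (z * complex_gradient (im_part G) z - complex_gradient (im_part G) 0 * z))%C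
    with (z * complex_gradient (im_part G) z)%C by ring.
  destruct z as [x y]. rewrite Dop_parts, Cmod_pow_double.
  destruct (HD x y Hd) as [(_ & X1 & Y1 & _) (_ & X2 & Y2 & _)].
  rewrite (angular_derivative_weight (re_part f) (re_part G) m x y); auto.
  rewrite (angular_derivative_weight (im_part f) (im_part G) m x y); auto.
  - unfold rot_im, complex_gradient, Cmult, RtoC; simpl. f_equal; ring.
  - intros a b Hab. unfold im_part. rewrite Hf, Cmod_pow_double by auto. simpl.
    unfold Im. ring.
  - intros a b Hab. unfold re_part. rewrite Hf, Cmod_pow_double by auto. simpl.
    unfold Re. ring.
Qed.

(** * The equation for the radius *)

Lemma atan_bounds (x : R) : 0 <= x -> x / (1 + x ^ 2) <= atan x <= x.
Proof.
  intros Hx.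
  destruct (MVT_gen atan 0 x (fun x => / (1 + x ^ 2))) as (c & Hc & E).
  - intros y _. apply is_derive_Reals, derivable_pt_lim_atan.
  - intros y _. apply derivable_continuous_pt. exists (/ (1 + y ^ 2)). apply derivable_pt_lim_atan.
  - rewrite atan_0, !Rminus_0_r in E. rewrite E.
    rewrite Rmin_left, Rmax_right in Hc by lra.
    assert (H1 : / (1 + x ^ 2) <= / (1 + c ^ 2)) by (apply Rinv_le_contravar; nra).
    assert (H2 : / (1 + c ^ 2) <= 1) by (rewrite <- Rinv_1; apply Rinv_le_contravar; nra).
    unfold Rdiv. split; nra.
Qed.

(** The upper bound is Machin's formula PI/4 = 4 atan (1/5) - atan (1/239) with the crude bounds
    atan (1/5) <= 1/5 and atan (1/239) >= 0. *)
Lemma PI_bounds : 3 < PI <= 16 / 5.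
Proof.
  split.
  - assert (H := PI2_3_2). lra.
  - assert (H := Machin_4_5_239).
    assert (H1 := atan_bounds (/ 5) ltac:(lra)).
    assert (H2 := atan_bounds (/ 239) ltac:(lra)).
    assert (0 <= / 239 / (1 + (/ 239) ^ 2)) by lra. lra.
Qed.

Lemma s0_lower : 41 / 10 <= s0.
Proof.
  unfold s0.
  assert (H0 : 4123 / 1000 <= sqrt 17).
  { rewrite <- (sqrt_square (4123 / 1000)) by lra. apply sqrt_le_1; lra. }
  assert (H1 : sqrt 17 <= 41232 / 10000).
  { rewrite <- (sqrt_square (41232 / 10000)) by lra. apply sqrt_le_1; lra. }
  assert (H2 : 11 / 4 <= (sqrt 17 - 1) / (sqrt 17 - 3))
    by (apply (Rle_div_r (11 / 4)); lra).
  assert (H3 : 3 / 2 <= sqrt (2 / (5 - sqrt 17))).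
  { rewrite <- (sqrt_square (3 / 2)) by lra. apply sqrt_le_1_alt.
    apply (Rle_div_r (3 / 2 * (3 / 2)) 2 (5 - sqrt 17)); lra. }
  nra.
Qed.

(** PI <= 16/5 gives 48/PI^2 >= 75/16, and 75/16 times 4.1 is about 19.22. *)
Lemma s0_constant_lower : 96 / 5 <= 48 / PI ^ 2 * s0.
Proof.
  assert (H := s0_lower). destruct PI_bounds as [H1 H2].
  assert (H3 : 75 / 16 <= 48 / PI ^ 2).
  { apply (Rle_div_r (75 / 16)); nra. }
  nra.
Qed.

Lemma lambda0_bounds (M : R) : 1 <= M ->
  0 < lambda0 M <= 1 /\ 88 / 100 * lambda0 M <= lambda_parseval M.
Proof.
  intros HM. destruct (lambda_parseval_spec M HM) as [Hl _].
  unfold lambda0. destruct (Rle_dec M M0) as [_|_].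
  - change (sqrt 2 / (sqrt (M ^ 2 - 1) + sqrt (M ^ 2 + 1))) with (lambda_parseval M). lra.
  - destruct PI_bounds as [P1 P2].
    split; [split|].
    + apply Rdiv_lt_0_compat; lra.
    + apply Rle_div_l; lra.
    + unfold lambda_parseval.
      set (s := sqrt (M ^ 2 - 1)). set (t := sqrt (M ^ 2 + 1)).
      assert (Hs : 0 <= s) by apply sqrt_pos.
      assert (Ht : 0 < t) by (apply sqrt_lt_R0; nra).
      assert (Hs2 : s ^ 2 = M ^ 2 - 1) by (apply pow2_sqrt; nra).
      assert (Ht2 : t ^ 2 = M ^ 2 + 1) by (apply pow2_sqrt; nra).
      assert (Hst : s + t <= 2 * M).
      { assert (H := pow2_ge_0 (s - t)). nra. }
      assert (H2 : 1412 / 1000 <= sqrt 2).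
      { rewrite <- (sqrt_square (1412 / 1000)) by lra. apply sqrt_le_1; lra. }
      (* sqrt 2 / (2 M) compared with PI / (4 M) gives the ratio 2 sqrt 2 / PI, which is above 0.88
         for PI <= 16/5. *)
      apply Rle_trans with (1412 / 1000 / (2 * M)).
      * apply Rmult_le_reg_r with (4 * M); [lra|].
        replace (88 / 100 * (PI / (4 * M)) * (4 * M)) with (88 / 100 * PI) by (field; lra).
        replace (1412 / 1000 / (2 * M) * (4 * M)) with (2824 / 1000) by (field; lra). lra.
      * unfold Rdiv. apply Rmult_le_compat; try lra.
        -- left. apply Rinv_0_lt_compat. lra.
        -- apply Rinv_le_contravar; lra.
Qed.

(** Both branches are at most sqrt 2 M, since 4/PI < sqrt 2. *)
Lemma T_bounds (M : R) : 1 <= M -> 0 <= T M <= 14143 / 10000 * M.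
Proof.
  intros HM. unfold T. destruct (Rle_dec M M1) as [_|_].
  - split. apply sqrt_pos.
    rewrite <- (sqrt_square (14143 / 10000 * M)) by lra. apply sqrt_le_1; nra.
  - destruct PI_bounds as [P1 P2]. split.
    + apply Rdiv_le_0_compat; lra.
    + apply Rle_div_l; [lra|]. nra.
Qed.

Definition radius_equation (M rho : R) : R :=
  lambda0 M - 48 * M / PI ^ 2 * s0 * atan rho - 2 * T M * rho / (1 - rho) ^ 3.

Lemma radius_exists (M : R) : 1 <= M -> exists rho, 0 < rho < 1 /\ radius_equation M rho = 0.
Proof.
  intros HM. destruct (lambda0_bounds M HM) as [[L0 L1] _]. destruct (T_bounds M HM) as [T0 _].
  assert (K := s0_constant_lower).
  assert (Hpi : 0 < PI ^ 2) by (apply pow_lt, PI_RGT_0).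
  (* At 0 the equation has the value lambda0 > 0; at 1/2 the arctangent term is at least 19.2 * 0.4,
     far above lambda0 <= 1. The sign is reversed to fit the form of the intermediate value
     theorem. *)
  destruct (IVT_interv (fun x => - radius_equation M x) 0 (1 / 2)) as (rho & [H1 H2] & E).
  - intros a Ha1. apply (continuity_pt_opp (radius_equation M)). unfold radius_equation.
    apply (continuity_pt_minus (fun x => lambda0 M - 48 * M / PI ^ 2 * s0 * atan x)
      (fun x => 2 * T M * x / (1 - x) ^ 3)).
    + apply (continuity_pt_minus (fun _ => lambda0 M) (fun x => 48 * M / PI ^ 2 * s0 * atan x)).
      * apply continuity_pt_const. intros ? ?. reflexivity.
      * apply (continuity_pt_scal atan). apply derivable_continuous_pt.
        exists (/ (1 + a ^ 2)). apply derivable_pt_lim_atan.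
    + apply continuity_pt_filterlim.
      apply (ex_derive_continuous (V := R_NormedModule) (fun x => 2 * T M * x / (1 - x) ^ 3) a). auto_derive.
      assert (0 < (1 - a) * ((1 - a) * ((1 - a) * 1))) by (repeat apply Rmult_lt_0_compat; lra).
      lra.
  - lra.
  - unfold radius_equation. rewrite atan_0. unfold Rdiv. rewrite !Rmult_0_r, Rmult_0_l. lra.
  - unfold radius_equation.
    assert (A := atan_bounds (1 / 2) ltac:(lra)).
    assert (B : 2 / 5 <= atan (1 / 2)) by lra.
    assert (C1 : 0 <= 2 * T M * (1 / 2) / (1 - 1 / 2) ^ 3) by (apply Rdiv_le_0_compat; lra).
    replace (48 * M / PI ^ 2 * s0 * atan (1 / 2)) with (M * (48 / PI ^ 2 * s0) * atan (1 / 2))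
      by (field; apply Rgt_not_eq, PI_RGT_0).
    assert (96 / 5 <= M * (48 / PI ^ 2 * s0)) by nra. nra.
  - exists rho. split; [|lra]. split; [|lra].
    destruct (Req_dec rho 0) as [->|]; [|lra].
    exfalso. revert E. unfold radius_equation. rewrite atan_0. unfold Rdiv.
    rewrite !Rmult_0_r, Rmult_0_l. lra.
Qed.

(** With c = 48 s0 / PI^2 >= 19.2 the equation reads lambda0 = c M atan rho + tau. For rho > 1/18
    the right side would exceed 1. Univalence: 0.88 * 19.2 * 0.996 is about 16.8, above 10.5.
    Covering: c/3 must pay for 0.12 lambda0 and for 3.2 M rho; as tau <= 3.36 M rho, it suffices
    that (1/3 - 0.12) * 19.2 * 0.996, about 4.08, exceeds 3.2 + 0.12 * 3.36. *)
Lemma radius_estimates (M rho : R) : 1 <= M -> 0 < rho < 1 -> radius_equation M rho = 0 ->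
  rho <= 1 / 18 /\ 7 * M * rho + 7 / 2 * M * rho < lambda_parseval M /\
  0 < lambda0 M - 16 * M / PI ^ 2 * s0 * atan rho <= lambda_parseval M - 16 / 5 * M * rho.
Proof.
  intros HM Hrho E. unfold radius_equation in E.
  destruct (lambda0_bounds M HM) as [[L0 L1] L2]. destruct (T_bounds M HM) as [T0 T1].
  assert (K := s0_constant_lower).
  assert (Hpi := PI_RGT_0).
  set (c := 48 / PI ^ 2 * s0) in *.
  replace (48 * M / PI ^ 2 * s0 * atan rho) with (c * (M * atan rho)) in E by (unfold c; field; lra).
  replace (16 * M / PI ^ 2 * s0 * atan rho) with (c / 3 * (M * atan rho)) by (unfold c; field; lra).
  set (tau := 2 * T M * rho / (1 - rho) ^ 3) in *.
  assert (Hc3 : 0 < (1 - rho) ^ 3) by (apply pow_lt; lra).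
  assert (Ht : 0 <= tau).
  { apply Rdiv_le_0_compat; auto. apply Rmult_le_pos; lra. }
  assert (A := atan_bounds rho ltac:(lra)).
  assert (A0 : 0 <= atan rho).
  { apply Rle_trans with (rho / (1 + rho ^ 2)); [|tauto].
    apply Rdiv_le_0_compat; nra. }
  assert (Hr : rho <= 1 / 18).
  { apply Rnot_lt_le. intros Hlt. apply atan_increasing in Hlt.
    assert (B := atan_bounds (1 / 18) ltac:(lra)).
    assert (H1 : 55 / 1000 <= atan rho) by lra.
    assert (H2 : 55 / 1000 <= M * atan rho) by nra.
    nra. }
  assert (HA : 996 / 1000 * rho <= atan rho).
  { eapply Rle_trans; [|apply A]. apply (Rle_div_r (996 / 1000 * rho)); nra. }
  assert (HMA : 996 / 1000 * (M * rho) <= M * atan rho) by nra.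
  assert (HMr : 0 < M * rho) by nra.
  assert (Hcm : 96 / 5 * (996 / 1000 * (M * rho)) <= c * (M * atan rho)).
  { apply Rmult_le_compat; lra. }
  assert (Ht2 : tau <= 336 / 100 * (M * rho)).
  { unfold tau. apply Rle_div_l; auto.
    assert (H3 : 4913 / 5832 <= (1 - rho) ^ 3).
    { replace (4913 / 5832) with ((17 / 18) ^ 3) by field. apply pow_incr. lra. }
    apply Rle_trans with (336 / 100 * (M * rho) * (4913 / 5832)).
    - nra.
    - apply Rmult_le_compat_l; lra. }
  split; auto. split; [|split]; lra.
Qed.

(** The injectivity lemma with A the identity and E = 0, on a disk large enough to contain both
    points. *)
Lemma power_weight_injective (m : nat) (z w : C) :
  (RtoC (Cmod z ^ (2 * m)) * z = RtoC (Cmod w ^ (2 * m)) * w)%C -> z = w.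
Proof.
  intros H.
  apply (weighted_perturbation_injective m (1 + Cmod z + Cmod w) 1 0 0 (fun y => y) (fun _ => 0%C)).
  - intros x y s. reflexivity.
  - intros y. lra.
  - intros x y _ _. replace (0 - 0)%C with (RtoC 0) by ring. rewrite Cmod_0. lra.
  - intros t y _ _. replace (t * 0 - 0)%C with (RtoC 0) by ring. rewrite Cmod_0. lra.
  - lra.
  - lra.
  - assert (P := Cmod_ge_0 w). lra.
  - assert (P := Cmod_ge_0 z). lra.
  - rewrite !Cplus_0_r. exact H.
Qed.

Theorem theorem4 :
  forall (p : nat) (M : R) (f G : C -> C),
    (1 <= p)%nat ->
    1 <= M ->
    p_harmonic p f ->
    harmonic G ->
    (forall z : C, disk 1 z ->
       f z = (RtoC (Cmod z ^ (2 * (p - 1))) * G z)%C) ->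
    G 0%C = 0%C ->
    jacobian G 0%C - 1 = 0 ->
    (forall z : C, disk 1 z -> Cmod (G z) <= M) ->
    (exists rho : R,
       0 < rho < 1 /\
       lambda0 M - 48 * M / PI ^ 2 * s0 * atan rho
         - 2 * T M * rho / (1 - rho) ^ 3 = 0 /\
       univalent_on (Dop f) (disk rho) /\
       range_contains_univalent_disk (Dop f) (disk rho)
         (rho ^ (2 * p - 1) * (lambda0 M - 16 * M / PI ^ 2 * s0 * atan rho)))
    /\
    (M = 1 ->
       exists alpha : C,
         Cmod alpha = 1 /\
         (forall z : C, disk 1 z -> G z = (alpha * z)%C) /\
         (forall z : C, disk 1 z ->
            f z = (alpha * (RtoC (Cmod z ^ (2 * (p - 1))) * z))%C) /\
         univalent_on f (disk 1)).
Proof.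
  intros p M f G Hp HM _ HG Hf HG0 HJ HGM.
  set (m := (p - 1)%nat) in *.
  destruct (harmonic_parts G HG) as [HD HL].
  set (a := complex_gradient (re_part G)). set (b := complex_gradient (im_part G)).
  set (u := fun z : C => re_part G (Re z) (Im z)).
  set (v := fun z : C => im_part G (Re z) (Im z)).
  assert (EG : forall z, G z = (u z, v z)).
  { intros [x y]. unfold u, v, re_part, im_part; simpl. destruct (G (x, y)); reflexivity. }
  assert (Hu := harmonic_holomorphic_gradient (re_part G)
    (fun x y H => proj1 (HD x y H)) (fun x y H => proj1 (HL x y H))).
  assert (Hv := harmonic_holomorphic_gradient (im_part G)
    (fun x y H => proj2 (HD x y H)) (fun x y H => proj2 (HL x y H))).
  fold a u in Hu. fold b v in Hv.
  match type of Hu with holomorphic_gradient _ _ ?d => set (da := d) in Hu end.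
  match type of Hv with holomorphic_gradient _ _ ?d => set (db := d) in Hv end.
  assert (Huv : forall z, disk 1 z -> u z ^ 2 + v z ^ 2 <= M ^ 2).
  { intros z Hz. assert (H := HGM z Hz). assert (S := Cmod_sqr (G z)).
    rewrite EG in S at 2 3. simpl Re in S. simpl Im in S. rewrite <- S.
    apply pow_incr. split; auto. apply Cmod_ge_0. }
  assert (M0' : 0 <= M) by lra.
  assert (Hdet : det (a 0%C) (b 0%C) = 1).
  { unfold a, b. rewrite <- jacobian_det. lra. }
  assert (Hen := energy_bound u v a da b db M Hu Hv Huv).
  destruct (lambda_parseval_spec M HM) as [Hlam Hlam4].
  split.
  - destruct (radius_exists M HM) as (rho & Hrho & Heq).
    destruct (radius_estimates M rho HM Hrho Heq) as (Hr18 & HLQ & HR).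
    exists rho. split; [exact Hrho|]. split; [exact Heq|].
    set (E := fun z => rot_im (gradient_remainder a z) (gradient_remainder b z)).
    assert (HF : forall z, Cmod z < rho ->
      Dop f z = (RtoC (Cmod z ^ (2 * m)) * (linear_part (a 0%C) (b 0%C) z + E z))%C).
    { intros z Hz. apply (Dop_weighted f G m z HG Hf). unfold disk. lra. }
    assert (Hr : 0 < rho <= 1 / 18) by lra.
    assert (HEL := remainder_lipschitz u v a da b db M rho Hu Hv M0' Huv Hr).
    assert (HEQ := remainder_radial_defect u v a da b db M rho Hu Hv M0' Huv Hr).
    assert (HEe := remainder_size u v a da b db M rho Hu Hv M0' Huv Hr).
    assert (HA := linear_part_real_linear (a 0%C) (b 0%C)).
    assert (Hlow : forall z, lambda_parseval M * Cmod z <= Cmod (linear_part (a 0%C) (b 0%C) z)).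
    { intros z. apply linear_part_lower; auto. lra.
      rewrite Hlam4, (Rmult_comm (2 * M ^ 2)). apply Rmult_le_compat_l; auto.
      apply pow2_ge_0. }
    assert (HMr : 0 <= M * rho) by nra.
    assert (Huniv : univalent_on (Dop f) (disk rho)).
    { intros z w Hz Hw Hzw. rewrite !HF in Hzw by auto.
      apply (weighted_perturbation_injective m rho (lambda_parseval M) (7 * M * rho)
        (7 / 2 * M * rho) (linear_part (a 0%C) (b 0%C)) E z w HA Hlow); auto.
      - intros x y Hx Hy. apply HEL; lra.
      - intros t x Ht Hx. apply HEQ; auto; lra.
      - lra. }
    split; [exact Huniv|].
    destruct (linear_part_surjective (a 0%C) (b 0%C) Hdet) as [B HB].
    apply (weighted_perturbation_range m rho (lambda_parseval M)
      (sqrt (Cmod (a 0%C) ^ 2 + Cmod (b 0%C) ^ 2)) (7 * M * rho) (16 / 5 * M * rho) _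
      (linear_part (a 0%C) (b 0%C)) B E); auto.
    + lra.
    + intros z. apply linear_part_upper.
    + lra.
    + lra.
    (* The exponent splits into the weight rho^(2m) and one factor rho from the modulus of z on the
       boundary circle. *)
    + replace (2 * p - 1)%nat with (2 * m + 1)%nat by (unfold m; lia).
      rewrite pow_add, pow_1.
      assert (P : 0 < rho ^ (2 * m)) by (apply pow_lt; lra).
      split.
      * apply Rmult_lt_0_compat; [apply Rmult_lt_0_compat|]; lra.
      * rewrite Rmult_assoc. apply Rmult_le_compat_l; [lra|].
        apply Rmult_le_compat_l; lra.
  - intros HM1.
    (* For M = 1 the lower bound 2 det = 2 meets the upper bound 2 M^2. *)
    assert (HE : Cmod (a 0%C) ^ 2 + Cmod (b 0%C) ^ 2 = 2 * M ^ 2).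
    { apply Rle_antisym; auto. assert (H := det_le_energy (a 0%C) (b 0%C)).
      rewrite Hdet in H. rewrite HM1. lra. }
    assert (Hproj1 : additive_contraction (fun x _ => x)).
    { split; auto. intros x y. assert (H := pow2_ge_0 (Cmod y)). lra. }
    assert (Hproj2 : additive_contraction (fun _ y => y)).
    { split; auto. intros x y. assert (H := pow2_ge_0 (Cmod x)). lra. }
    assert (Hu0 : u 0%C = 0 /\ v 0%C = 0).
    { rewrite EG in HG0. now injection HG0. }
    assert (Hul : forall z, disk 1 z -> u z = Re (a 0%C * z)%C).
    { apply (linear_of_gradient_remainder_0 u a da Hu); [|tauto].
      intros z Hz. exact (remainder_rigid u v a da b db M Hu Hv M0' Huv _ z Hproj1 HE Hz). }
    assert (Hvl : forall z, disk 1 z -> v z = Re (b 0%C * z)%C).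
    { apply (linear_of_gradient_remainder_0 v b db Hv); [|tauto].
      intros z Hz. exact (remainder_rigid u v a da b db M Hu Hv M0' Huv _ z Hproj2 HE Hz). }
    exists (a 0%C).
    (* Equality in [det_le_energy] makes both squares vanish, that is, b(0) = -i a(0); hence u + i v
       = a(0) z, and det = |a(0)|^2 = 1. *)
    assert (Hconf : Re (b 0%C) = Im (a 0%C) /\ Im (b 0%C) = - Re (a 0%C)).
    { rewrite HM1, !Cmod_sqr in HE. unfold det in Hdet.
      assert (S : (Im (a 0%C) - Re (b 0%C)) ^ 2 + (Re (a 0%C) + Im (b 0%C)) ^ 2 = 0) by lra.
      assert (S1 := pow2_ge_0 (Im (a 0%C) - Re (b 0%C))).
      assert (S2 := pow2_ge_0 (Re (a 0%C) + Im (b 0%C))).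
      split; apply Rminus_diag_uniq; apply Rsqr_0_uniq; rewrite Rsqr_pow2; [|].
      - replace (Re (b 0%C) - Im (a 0%C)) with (- (Im (a 0%C) - Re (b 0%C))) by ring.
        rewrite <- Rsqr_pow2, <- Rsqr_neg, Rsqr_pow2. lra.
      - replace (Im (b 0%C) - - Re (a 0%C)) with (Re (a 0%C) + Im (b 0%C)) by ring. lra. }
    destruct Hconf as [C1 C2].
    assert (Hmod : Cmod (a 0%C) = 1).
    { unfold det in Hdet. rewrite C1, C2 in Hdet.
      assert (S := Cmod_sqr (a 0%C)). assert (P := Cmod_ge_0 (a 0%C)). nra. }
    assert (HGl : forall z, disk 1 z -> G z = (a 0%C * z)%C).
    { intros z Hz. rewrite EG, Hul, Hvl by auto. destruct (a 0%C) as [a1 a2], (b 0%C) as [b1 b2], z as [x y].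
      simpl in C1, C2. subst b1 b2. unfold Cmult; simpl. f_equal. ring. }
    assert (Hfl : forall z, disk 1 z -> f z = (a 0%C * (RtoC (Cmod z ^ (2 * m)) * z))%C).
    { intros z Hz. rewrite Hf, HGl by auto. ring. }
    split; [exact Hmod|]. split; [exact HGl|]. split; [exact Hfl|].
    intros z w Hz Hw Hzw. rewrite !Hfl in Hzw by auto.
    apply (power_weight_injective m).
    assert (Ha : a 0%C <> 0%C).
    { intros H. rewrite H, Cmod_0 in Hmod. lra. }
    replace (RtoC (Cmod z ^ (2 * m)) * z)%C
      with (/ a 0%C * (a 0%C * (RtoC (Cmod z ^ (2 * m)) * z)))%C by (field; auto).
    rewrite Hzw. field; auto.
Qed.
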